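(* The model-checking problem $\mathrm{MC}(\mathtt{KS},\mathtt{fCTL})$ is in $\textsc{Exp}$: there is a deterministic algorithm that, given a (finite) Kripke structure $\mathcal{K}$ and an $\mathtt{fCTL}$ formula $\Phi$ (with the numbers in frequency constraints encoded in binary), decides whether $\mathcal{K}\models\Phi$ in time exponential in the size of the input.
   Context: Let $AP$ be a finite set of atomic propositions. A Kripke structure is $\mathcal{K}=(S,s_I,E,\lambda)$ with $S$ a finite set of states, $s_I\in S$ the initial state, $E\subseteq S\times S$ and $\lambda:S\to 2^{AP}$. A path is a (finite or infinite) sequence of states whose consecutive pairs are in $E$; a run is an infinite path $\rho$ with $\rho(0)=s_I$ ($\rho(i)$ denotes its $(i+1)$-th state); $\mathtt{Runs}(\mathcal{K})$ is the set of runs. $\mathtt{KS}$ is the class of all Kripke structures. $\mathtt{fCTL}$ formulae are given by $\varphi ::= p \mid \varphi\land\varphi \mid \neg\varphi \mid \mathtt{E}\beta \mid \mathtt{A}\beta$ and $\beta ::= \mathtt{X}\varphi \mid \varphi\,\mathtt{U}^{\frac{n}{m}}\varphi$ with $p\in AP$ and natural numbers $n\le m$, $m>0$. Semantics is over a run $\rho$ and a position $i\in\mathbb{N}$: $(\rho,i)\models p$ iff $p\in\lambda(\rho(i))$; Boolean connectives as usual; $(\rho,i)\models\mathtt{X}\varphi$ iff $(\rho,i+1)\models\varphi$; $(\rho,i)\models\varphi\,\mathtt{U}^{\frac{n}{m}}\psi$ iff $(\rho,i)\models\psi$, or there is $k\ge i$ with $(\rho,k+1)\models\psi$ and $m\cdot|\{j\in[i,k]\mid(\rho,j)\models\varphi\}|\ge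 n\cdot(k-i+1)$; $(\rho,i)\models\mathtt{E}\varphi$ iff there is $\rho'\in\mathtt{Runs}(\mathcal{K})$ with $\rho'(j)=\rho(j)$ for all $j\le i$ and $(\rho',i)\models\varphi$; $\mathtt{A}\varphi\equiv\neg\mathtt{E}\neg\varphi$. A state $s$ satisfies $\varphi$ if there are $\rho\in\mathtt{Runs}(\mathcal{K})$ and $i$ with $\rho(i)=s$ and $(\rho,i)\models\varphi$; $\mathcal{K}\models\varphi$ iff $s_I$ satisfies $\varphi$. The model-checking problem $\mathrm{MC}(\mathfrak{K},\mathcal{L})$: given $\mathcal{K}\in\mathfrak{K}$ and $\varphi\in\mathcal{L}$, decide whether $\mathcal{K}\models\varphi$. The formula size counts numbers in binary. *)

(* Defs.v *)
From Stdlib Require Import List Arith.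
Import ListNotations.

(* Kripke structures: states are 0 .. ks_n - 1, atomic propositions are
   natural numbers; E and lambda are given as finite lists.            *)
Record KS := {
  ks_n : nat;
  ks_init : nat;
  ks_edges : list (nat * nat);
  ks_labels : list (nat * nat)      (* (s,p) : p \in lambda(s) *)
}.

Definition ks_wf (K : KS) : Prop :=
  ks_init K < ks_n K /\
  (forall s t, In (s, t) (ks_edges K) -> s < ks_n K /\ t < ks_n K) /\
  (forall s p, In (s, p) (ks_labels K) -> s < ks_n K).

Definition is_run (K : KS) (rho : nat -> nat) : Prop :=
  rho 0 = ks_init K /\ forall i, In (rho i, rho (S i)) (ks_edges K).

Inductive form : Type :=
  | FAtom : nat -> form
  | FAnd : form -> form -> form
  | FNot : form -> form
  | FE : pform -> form
  | FA : pform -> form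
with pform : Type :=
  | PX : form -> pform
  | PU : nat -> nat -> form -> form -> pform.  (* PU n m f g = f U^{n/m} g *)

Fixpoint form_wf (f : form) : Prop :=
  match f with
  | FAtom _ => True
  | FAnd f g => form_wf f /\ form_wf g
  | FNot f => form_wf f
  | FE b | FA b => pform_wf b
  end
with pform_wf (b : pform) : Prop :=
  match b with
  | PX f => form_wf f
  | PU n m f g => n <= m /\ 0 < m /\ form_wf f /\ form_wf g
  end.

Fixpoint sat (K : KS) (f : form) (rho : nat -> nat) (i : nat) {struct f} : Prop :=
  match f with
  | FAtom p => In (rho i, p) (ks_labels K)
  | FAnd f g => sat K f rho i /\ sat K g rho i
  | FNot f => ~ sat K f rho i
  | FE b => exists rho', is_run K rho' /\ (forall j, j <= i -> rho' j = rho j)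
                          /\ psat K b rho' i
  | FA b => ~ (exists rho', is_run K rho' /\ (forall j, j <= i -> rho' j = rho j)
                          /\ ~ psat K b rho' i)
  end
with psat (K : KS) (b : pform) (rho : nat -> nat) (i : nat) {struct b} : Prop :=
  match b with
  | PX f => sat K f rho (S i)
  | PU n m f g =>
      sat K g rho i \/
      exists k, i <= k /\ sat K g rho (S k) /\
        exists l : list nat, NoDup l /\
          (forall j, In j l <-> (i <= j <= k /\ sat K f rho j)) /\
          n * (k - i + 1) <= m * length l
  end.

Definition models (K : KS) (f : form) : Prop :=
  exists rho i, is_run K rho /\ rho i = ks_init K /\ sat K f rho i.

(* Binary encoding of inputs (numbers in binary, self-delimiting). *)
Fixpoint bin_aux (fuel n : nat) : list bool :=
  match fuel with
  | 0 => []
  | S fu => match n with 0 => [] | _ => Nat.odd n :: bin_aux fu (Nat.div2 n) end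
  end.
Definition bin (n : nat) : list bool := bin_aux n n.

Definition enc_nat (n : nat) : list bool :=
  flat_map (fun b => [true; b]) (bin n) ++ [false].

Definition enc_list {A} (e : A -> list bool) (l : list A) : list bool :=
  flat_map (fun x => true :: e x) l ++ [false].

Definition enc_pair (x : nat * nat) : list bool := enc_nat (fst x) ++ enc_nat (snd x).

Definition enc_ks (K : KS) : list bool :=
  enc_nat (ks_n K) ++ enc_nat (ks_init K) ++
  enc_list enc_pair (ks_edges K) ++ enc_list enc_pair (ks_labels K).

Fixpoint enc_form (f : form) : list bool :=
  match f with
  | FAtom p => [false; false; false] ++ enc_nat p
  | FAnd f g => [false; false; true] ++ enc_form f ++ enc_form g
  | FNot f => [false; true; false] ++ enc_form f
  | FE b => [false; true; true] ++ enc_pform b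
  | FA b => [true; false; false] ++ enc_pform b
  end
with enc_pform (b : pform) : list bool :=
  match b with
  | PX f => [false] ++ enc_form f
  | PU n m f g => [true] ++ enc_nat n ++ enc_nat m ++ enc_form f ++ enc_form g
  end.

(* Deterministic single-tape Turing machines, two-way infinite tape.
   States 0..tm_Q-1, tape symbols 0..tm_Sig-1 with 0 = blank,
   input bits false/true written as symbols 1/2.
   delta q s = None means the machine halts in state q.              *)
Inductive dir := DL | DR | DS.

Record TM := {
  tm_Q : nat;
  tm_Sig : nat;
  tm_start : nat;
  tm_delta : nat -> nat -> option (nat * nat * dir);
  tm_accept : nat -> bool;
  tm_start_ok : tm_start < tm_Q;
  tm_Sig_ok : 3 <= tm_Sig;
  tm_delta_ok : forall q s q' s' d, q < tm_Q -> s < tm_Sig ->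
      tm_delta q s = Some (q', s', d) -> q' < tm_Q /\ s' < tm_Sig
}.

Record config := { c_state : nat; c_left : list nat; c_head : nat; c_right : list nat }.
(* c_left is stored reversed (nearest cell first); missing cells are blank *)

Definition step (M : TM) (c : config) : option config :=
  match tm_delta M (c_state c) (c_head c) with
  | None => None
  | Some (q, w, DS) => Some {| c_state := q; c_left := c_left c; c_head := w;
                               c_right := c_right c |}
  | Some (q, w, DL) => Some {| c_state := q; c_left := tl (c_left c);
                               c_head := hd 0 (c_left c); c_right := w :: c_right c |}
  | Some (q, w, DR) => Some {| c_state := q; c_left := w :: c_left c;
                               c_head := hd 0 (c_right c); c_right := tl (c_right c) |}
  end.

Fixpoint nsteps (M : TM) (t : nat) (c : config) : config :=
  match t with
  | 0 => c
  | S t' => match step M c with None => c | Some c' => nsteps M t' c' end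
  end.

Definition halted (M : TM) (c : config) : Prop :=
  tm_delta M (c_state c) (c_head c) = None.

Definition init_config (M : TM) (w : list bool) : config :=
  let l := map (fun b : bool => if b then 2 else 1) w in
  {| c_state := tm_start M; c_left := []; c_head := hd 0 l; c_right := tl l |}.

Definition decides_within (M : TM) (w : list bool) (T : nat) (P : Prop) : Prop :=
  exists t, t <= T /\ halted M (nsteps M t (init_config M w)) /\
            (tm_accept M (c_state (nsteps M t (init_config M w))) = true <-> P).

(* Main.v *)
Require Import Defs.
From Stdlib Require Import List Arith Lia Bool ZArith FunctionalExtensionality.
From Stdlib Require Import Classical ClassicalEpsilon ListDec.
Import ListNotations.

(** A state formula depends only on the current state, so its truth values form
    a table indexed by subformulas and states. For [E(f U^{n/m} g)], give a
    position the weight [m - n] or [-n] according to whether [f] holds there: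
    the formula holds iff some walk to a [g]-state has weight at least 0, and by
    cutting cycles out this is witnessed either by a walk of polynomial length
    or by polynomial walks around a cycle of positive weight. Dually
    [A(f U^{n/m} g)] fails iff there is an infinite path whose weight is
    negative whenever it meets [g]; cutting out cycles of positive weight yields
    a lasso of polynomial length whose cycle has weight at most 0 or avoids [g].
    Hence [models K Phi] says that some table of polynomially many bits
    satisfies local conditions with polynomial-size witnesses. Parsing the input
    is expressed by walks over its positions as well, so everything fits in a
    single first-order formula, not depending on the input, whose variables
    range over the numbers up to [2 ^ poly]. Such a formula is evaluated by
    exhaustive search by a program on counters bounded by [2 ^ poly], and a
    Turing machine simulates this program with its counters kept in unary. *)

(** * Simulation of counter programs by Turing machines *)

(** Two scales coexist. Positions of the input and lengths of walks are at most [dim N], polynomial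
    in the input length [N], whereas states and the numbers in constraints, being written in binary,
    are only bounded by [base N]. A walk is therefore coded by digits in base [base N + 1]. So is
    the table: there may be exponentially many states, but only sources of edges matter, and there
    are no more of these than edges, so each position gets a short list of states. [bound N] is
    chosen large enough for all these codes. Exhaustive search stays exponential because the formula
    is fixed: a constant number of nested quantifiers over [bound N + 1] values costs a fixed power
    of [bound N], which is again of the form [2 ^ poly]. The table is guessed rather than computed;
    this is sound because the local conditions force its relevant entries, by induction on the
    length of the subformula. Negative weights are never stored: a walk records how often [f] held,
    and its weight is recovered from this count and the index. *)

Definition store := nat -> nat.

Definition upd (st : store) (r v : nat) : store :=
  fun x => if x =? r then v else st x.

Lemma upd_eq st r v : upd st r v r = v.
Proof. unfold upd. now rewrite Nat.eqb_refl. Qed.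

Lemma upd_neq st r v x : x <> r -> upd st r v x = st x.
Proof. intros H. unfold upd. now destruct (Nat.eqb_spec x r). Qed.

(* Register 0 bounds all the other registers, so that the running time of a
   loop program is a polynomial in the final value of register 0. *)
Definition inc (r : nat) (st : store) : store :=
  if (r =? 0) || (st r <? st 0) then upd st r (S (st r)) else st.

Definition dec (r : nat) (st : store) : store := upd st r (pred (st r)).

Definition reads (w : list bool) (i : nat) (b : bool) : bool :=
  match nth_error w i with Some c => Bool.eqb c b | None => false end.

Inductive instr :=
  | IInc (r : nat)
  | IDec (r : nat)
  | IJz (r a : nat)
  | IJin (r : nat) (b : bool) (a : nat)
  | IJmp (a : nat).

Definition fstep (w : list bool) (prog : list instr) (c : nat * store)
  : option (nat * store) :=
  let (pc, st) := c in
  match nth_error prog pc with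
  | None => None
  | Some (IInc r) => Some (S pc, inc r st)
  | Some (IDec r) => Some (S pc, dec r st)
  | Some (IJz r a) => Some (if st r =? 0 then a else S pc, st)
  | Some (IJin r b a) => Some (if reads w (st r) b then S pc else a, st)
  | Some (IJmp a) => Some (a, st)
  end.

Inductive fsteps (w : list bool) (prog : list instr)
  : nat -> nat * store -> nat * store -> Prop :=
  | fsteps_0 c : fsteps w prog 0 c c
  | fsteps_S n c c' c'' :
      fstep w prog c = Some c' -> fsteps w prog n c' c'' ->
      fsteps w prog (S n) c c''.

Lemma fsteps_trans w prog n m a b c :
  fsteps w prog n a b -> fsteps w prog m b c -> fsteps w prog (n + m) a c.
Proof. induction 1; simpl; auto; intros; econstructor; eauto. Qed.

Lemma fsteps_1 w prog a b : fstep w prog a = Some b -> fsteps w prog 1 a b.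
Proof. intros; econstructor; eauto; constructor. Qed.

Definition bounded (st : store) : Prop := forall r, st r <= st 0.

Lemma inc_bounded r st : bounded st -> bounded (inc r st) /\ st 0 <= inc r st 0.
Proof.
  intros H. unfold inc. destruct (Nat.eqb_spec r 0) as [->|Hr]; cbn [orb].
  - rewrite upd_eq. split; [|lia]. intros x. rewrite upd_eq. unfold upd.
    destruct (x =? 0); [lia|]. specialize (H x). lia.
  - destruct (Nat.ltb_spec (st r) (st 0)).
    + rewrite upd_neq by auto. split; [|lia]. intros x. rewrite (upd_neq _ _ _ 0) by auto.
      unfold upd. destruct (x =? r); [lia|]. apply H.
    + split; auto.
Qed.

Lemma dec_bounded r st :
  r <> 0 -> bounded st -> bounded (dec r st) /\ st 0 <= dec r st 0.
Proof.
  intros Hr H. unfold dec. rewrite upd_neq by auto. split; [|lia].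
  intros x. rewrite (upd_neq _ _ _ 0) by auto. unfold upd.
  pose proof (H r). destruct (x =? r); [lia|apply H].
Qed.

(** Addresses up to [S n] are allowed because both [n] and [S n] halt: the first accepts, the second
    rejects. Register 0 is never decremented, so it keeps bounding the other registers and its final
    value bounds all its earlier ones. *)
Definition instr_ok (n R : nat) (i : instr) : Prop :=
  match i with
  | IInc r => r < R
  | IDec r => 0 < r < R
  | IJz r a | IJin r _ a => r < R /\ a <= S n
  | IJmp a => a <= S n
  end.

Lemma lt_pow2_bits x m : (forall k, m <= k -> Nat.testbit x k = false) -> x < 2 ^ m.
Proof.
  intros H. destruct (Nat.lt_ge_cases x (2 ^ m)) as [|Hx]; auto.
  assert (x <> 0) by (pose proof (Nat.pow_nonzero 2 m); lia).
  assert (m <= Nat.log2 x) by (apply Nat.log2_le_pow2; lia).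
  pose proof (Nat.bit_log2 x H0) as E. rewrite H in E by auto. discriminate.
Qed.

Section Machine.
Variables (prog : list instr) (R : nat).
Let n := length prog.

Definition init_state := 4 * (n + 2).
Definition num_states := 4 * (n + 2) + 2.
Definition num_symbols := 2 ^ (3 + R).

(** Bits 3 and 4 belong to registers 0 and 1: marking the cells that hold the input sets both
    registers to the input length. *)
Definition mark (s : nat) : nat := Nat.setbit (Nat.setbit s 3) 4.

(* State [4 * pc] : at the origin, about to execute instruction [pc];
   [4 * pc + 1] : moving right to the end of the register;
   [4 * pc + 2] : on the last cell of a register to be decremented;
   [4 * pc + 3] : returning to the origin.
   In a symbol, bits 0 and 1 are the input, bit 2 marks the origin, and bit
   [3 + r] of cell [i] says that register [r] exceeds [i]. *)
Definition raw_delta (q s : nat) : option (nat * nat * dir) :=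
  if q =? init_state then
    Some (S init_state, Nat.setbit (if s =? 0 then s else mark s) 2, DR)
  else if q =? S init_state then
    if s =? 0 then Some (3, s, DL) else Some (q, mark s, DR)
  else
    let pc := q / 4 in
    match q mod 4, nth_error prog pc with
    | 0, Some (IInc _) | 0, Some (IJin _ _ _) => Some (4 * pc + 1, s, DS)
    | 0, Some (IDec r) =>
        Some (4 * (if Nat.testbit s (3 + r) then pc else S pc)
              + (if Nat.testbit s (3 + r) then 1 else 0), s, DS)
    | 0, Some (IJz r a) =>
        Some (4 * (if Nat.testbit s (3 + r) then S pc else a) + 0, s, DS)
    | 0, Some (IJmp a) => Some (4 * a + 0, s, DS)
    | 1, Some (IInc r) =>
        if Nat.testbit s (3 + r) then Some (4 * pc + 1, s, DR) else
        Some (4 * S pc + 3,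
              if (r =? 0) || Nat.testbit s 3 then Nat.setbit s (3 + r) else s, DS)
    | 1, Some (IDec r) =>
        if Nat.testbit s (3 + r) then Some (4 * pc + 1, s, DR) else
        Some (4 * pc + 2, s, DL)
    | 1, Some (IJin r b a) =>
        if Nat.testbit s (3 + r) then Some (4 * pc + 1, s, DR) else
        Some (4 * (if Nat.testbit s (if b then 1 else 0) then S pc else a) + 3, s, DS)
    | 2, Some (IDec r) => Some (4 * S pc + 3, Nat.clearbit s (3 + r), DS)
    | 3, _ => if Nat.testbit s 2 then Some (4 * pc + 0, s, DS)
              else Some (4 * pc + 3, s, DL)
    | _, _ => None
    end.

(** Transitions that leave the range of states or symbols are dropped, which makes the closure
    condition of [TM] hold for any program. By [raw_to_delta] nothing is lost on the tapes that the
    simulation meets. *)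
Definition delta (q s : nat) : option (nat * nat * dir) :=
  match raw_delta q s with
  | Some (q', s', d) =>
      if (q' <? num_states) && (s' <? num_symbols) then Some (q', s', d) else None
  | None => None
  end.

Lemma num_symbols_ge : 3 <= num_symbols.
Proof.
  unfold num_symbols. rewrite Nat.pow_add_r.
  pose proof (Nat.pow_nonzero 2 R). simpl (2 ^ 3). lia.
Qed.

Lemma init_state_lt : init_state < num_states.
Proof. unfold init_state, num_states. lia. Qed.

Lemma delta_ok q s q' s' d :
  q < num_states -> s < num_symbols -> delta q s = Some (q', s', d) ->
  q' < num_states /\ s' < num_symbols.
Proof.
  intros _ _. unfold delta. destruct (raw_delta q s) as [[[? ?] ?]|]; [|easy].
  destruct (Nat.ltb_spec n0 num_states), (Nat.ltb_spec n1 num_symbols); simpl; try easy.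
  intros [= -> -> ->]. auto.
Qed.

Definition machine : TM :=
  {| tm_Q := num_states; tm_Sig := num_symbols; tm_start := init_state;
     tm_delta := delta; tm_accept := fun q => q =? 4 * n;
     tm_start_ok := init_state_lt; tm_Sig_ok := num_symbols_ge;
     tm_delta_ok := delta_ok |}.

(** Only the cells from the origin on are described. The simulation never steps to the left of the
    origin, so [c_left] is constrained on its first [i] cells only. *)
Definition at_cfg (c : config) (q i : nat) (T : nat -> nat) : Prop :=
  c_state c = q /\ c_head c = T i /\
  (forall k, k < i -> nth k (c_left c) 0 = T (i - 1 - k)) /\
  (forall k, nth k (c_right c) 0 = T (i + 1 + k)).

Definition reach (t q i : nat) (T : nat -> nat) (q' i' : nat) (T' : nat -> nat) :=
  forall c, at_cfg c q i T -> at_cfg (nsteps machine t c) q' i' T'.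

Lemma nsteps_add M a b c : nsteps M (a + b) c = nsteps M b (nsteps M a c).
Proof.
  revert c; induction a as [|a IH]; intros c; simpl; auto.
  destruct (step M c) eqn:E; auto.
  destruct b; simpl; auto. now rewrite E.
Qed.

Lemma reach_trans a b q i T q' i' T' q'' i'' T'' :
  reach a q i T q' i' T' -> reach b q' i' T' q'' i'' T'' ->
  reach (a + b) q i T q'' i'' T''.
Proof. intros H1 H2 c Hc. rewrite nsteps_add. auto. Qed.

Lemma nth_tl (l : list nat) k : nth k (tl l) 0 = nth (S k) l 0.
Proof. destruct l; [destruct k|]; reflexivity. Qed.

Lemma hd_nth (l : list nat) : hd 0 l = nth 0 l 0.
Proof. now destruct l. Qed.

Lemma reach_step q i T q' s' d :
  delta q (T i) = Some (q', s', d) -> (d = DL -> 0 < i) ->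
  reach 1 q i T q' (match d with DL => i - 1 | DR => S i | DS => i end) (upd T i s').
Proof.
  intros Hd Hl c (Hq & Hh & HL & HR). simpl. unfold step. simpl.
  rewrite Hq, Hh, Hd.
  destruct d; unfold at_cfg; simpl; repeat split.
  - specialize (Hl eq_refl). rewrite hd_nth, HL, upd_neq by lia. f_equal; lia.
  - intros k Hk. rewrite nth_tl, HL, upd_neq by lia. f_equal; lia.
  - specialize (Hl eq_refl). intros [|k].
    + transitivity (upd T i s' i); [now rewrite upd_eq|f_equal; lia].
    + rewrite HR, upd_neq by lia. f_equal; lia.
  - rewrite hd_nth, HR, upd_neq by lia. f_equal; lia.
  - intros [|k] Hk.
    + transitivity (upd T i s' i); [now rewrite upd_eq|f_equal; lia].
    + rewrite HL, upd_neq by lia. f_equal; lia.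
  - intros k. rewrite nth_tl, HR, upd_neq by lia. f_equal; lia.
  - now rewrite upd_eq.
  - intros k Hk. rewrite HL, upd_neq by lia. reflexivity.
  - intros k. rewrite HR, upd_neq by lia. reflexivity.
Qed.

Lemma reach_ext t q i T q' i' T' T'' :
  (forall x, T' x = T'' x) -> reach t q i T q' i' T' -> reach t q i T q' i' T''.
Proof.
  intros E H c Hc. destruct (H c Hc) as (h1 & h2 & h3 & h4).
  repeat split; intros; rewrite <- ?E; auto.
Qed.

Definition tape_bit (w : list bool) (st : store) (i k : nat) : bool :=
  match k with
  | 0 => reads w i false
  | 1 => reads w i true
  | 2 => i =? 0
  | S (S (S r)) => (r <? R) && (i <? st r)
  end.

Definition tape_ok w st (T : nat -> nat) : Prop :=
  forall i k, Nat.testbit (T i) k = tape_bit w st i k.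

Lemma tape_symbol_lt w st T i : tape_ok w st T -> T i < num_symbols.
Proof.
  intros H. apply lt_pow2_bits. intros k Hk. rewrite H.
  destruct k as [|[|[|r]]]; [lia..|]. simpl.
  destruct (Nat.ltb_spec r R); [lia|reflexivity].
Qed.

Lemma setbit_lt s k : s < num_symbols -> k < 3 + R -> Nat.setbit s k < num_symbols.
Proof.
  intros Hs Hk. apply lt_pow2_bits. intros j Hj. rewrite Nat.setbit_eqb.
  destruct (Nat.eqb_spec k j); [lia|]. simpl.
  destruct (Nat.eq_dec s 0) as [->|Hs0]; [apply Nat.bits_0|].
  apply Nat.bits_above_log2. apply Nat.log2_lt_pow2; [lia|].
  apply Nat.lt_le_trans with (1 := Hs). apply Nat.pow_le_mono_r; lia.
Qed.

Lemma clearbit_lt s k : s < num_symbols -> Nat.clearbit s k < num_symbols.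
Proof.
  intros Hs. apply lt_pow2_bits. intros j Hj. rewrite Nat.clearbit_eqb.
  destruct (Nat.eq_dec s 0) as [->|Hs0]; [now rewrite Nat.bits_0|].
  rewrite Nat.bits_above_log2; auto. apply Nat.log2_lt_pow2; [lia|].
  apply Nat.lt_le_trans with (1 := Hs). apply Nat.pow_le_mono_r; lia.
Qed.

Lemma raw_delta_main pc k s :
  pc < n + 2 -> k < 4 ->
  raw_delta (4 * pc + k) s =
    match k, nth_error prog pc with
    | 0, Some (IInc _) | 0, Some (IJin _ _ _) => Some (4 * pc + 1, s, DS)
    | 0, Some (IDec r) =>
        Some (4 * (if Nat.testbit s (3 + r) then pc else S pc)
              + (if Nat.testbit s (3 + r) then 1 else 0), s, DS)
    | 0, Some (IJz r a) =>
        Some (4 * (if Nat.testbit s (3 + r) then S pc else a) + 0, s, DS)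
    | 0, Some (IJmp a) => Some (4 * a + 0, s, DS)
    | 1, Some (IInc r) =>
        if Nat.testbit s (3 + r) then Some (4 * pc + 1, s, DR) else
        Some (4 * S pc + 3,
              if (r =? 0) || Nat.testbit s 3 then Nat.setbit s (3 + r) else s, DS)
    | 1, Some (IDec r) =>
        if Nat.testbit s (3 + r) then Some (4 * pc + 1, s, DR) else
        Some (4 * pc + 2, s, DL)
    | 1, Some (IJin r b a) =>
        if Nat.testbit s (3 + r) then Some (4 * pc + 1, s, DR) else
        Some (4 * (if Nat.testbit s (if b then 1 else 0) then S pc else a) + 3, s, DS)
    | 2, Some (IDec r) => Some (4 * S pc + 3, Nat.clearbit s (3 + r), DS)
    | 3, _ => if Nat.testbit s 2 then Some (4 * pc + 0, s, DS)
              else Some (4 * pc + 3, s, DL)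
    | _, _ => None
    end.
Proof.
  intros Hpc Hk. unfold raw_delta, init_state.
  destruct (Nat.eqb_spec (4 * pc + k) (4 * (n + 2))); [lia|].
  destruct (Nat.eqb_spec (4 * pc + k) (S (4 * (n + 2)))); [lia|].
  replace ((4 * pc + k) / 4) with pc by (apply (Nat.div_unique _ _ _ k); lia).
  replace ((4 * pc + k) mod 4) with k by (apply (Nat.mod_unique _ _ pc k); lia).
  reflexivity.
Qed.

Lemma raw_to_delta q s q' s' d :
  raw_delta q s = Some (q', s', d) -> q' < num_states -> s' < num_symbols ->
  delta q s = Some (q', s', d).
Proof.
  intros H H1 H2. unfold delta. rewrite H.
  apply Nat.ltb_lt in H1. apply Nat.ltb_lt in H2. now rewrite H1, H2.
Qed.

Lemma state_lt pc k : pc < n + 2 -> k < 4 -> 4 * pc + k < num_states.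
Proof. unfold num_states. lia. Qed.

Lemma upd_same T (i : nat) x : upd T i (T i) x = T x.
Proof. unfold upd. now destruct (Nat.eqb_spec x i) as [->|]. Qed.

Lemma reach_move q i T q' d :
  raw_delta q (T i) = Some (q', T i, d) -> (d = DL -> 0 < i) ->
  q' < num_states -> T i < num_symbols ->
  reach 1 q i T q' (match d with DL => i - 1 | DR => S i | DS => i end) T.
Proof.
  intros H Hl H1 H2. eapply reach_ext; [|eapply reach_step; eauto using raw_to_delta].
  apply upd_same.
Qed.

Lemma reach_return w st T pc i :
  tape_ok w st T -> pc < n + 2 -> reach (i + 1) (4 * pc + 3) i T (4 * pc + 0) 0 T.
Proof.
  intros HT Hpc. induction i as [|i IH].
  - eapply (reach_move _ 0 T _ DS); try easy.
    + rewrite raw_delta_main by lia. now rewrite HT.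
    + apply state_lt; lia.
    + eapply tape_symbol_lt; eauto.
  - replace (S i + 1) with (1 + (i + 1)) by lia.
    apply reach_trans with (4 * pc + 3) i T; [|exact IH].
    replace i with (S i - 1) at 2 by lia.
    eapply (reach_move _ (S i) T _ DL); try lia.
    + rewrite raw_delta_main by lia. now rewrite HT.
    + apply state_lt; lia.
    + eapply tape_symbol_lt; eauto.
Qed.

Definition scans (i : instr) : option nat :=
  match i with IInc r | IDec r | IJin r _ _ => Some r | _ => None end.

Lemma reach_scan w st T pc ins r j :
  tape_ok w st T -> pc < n -> nth_error prog pc = Some ins -> scans ins = Some r ->
  r < R -> j <= st r -> reach j (4 * pc + 1) 0 T (4 * pc + 1) j T.
Proof.
  intros HT Hpc Hn Hs Hr. induction j as [|j IH]; intros Hj.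
  - intros c Hc; exact Hc.
  - replace (S j) with (j + 1) at 1 by lia.
    apply reach_trans with (4 * pc + 1) j T; [apply IH; lia|].
    eapply (reach_move _ j T _ DR); try easy.
    + rewrite raw_delta_main, Hn by lia.
      assert (E : Nat.testbit (T j) (3 + r) = true).
      { rewrite HT. cbn -[Nat.ltb]. apply andb_true_intro; split; apply Nat.ltb_lt; lia. }
      destruct ins; inversion Hs; subst; now rewrite E.
    + apply state_lt; lia.
    + eapply tape_symbol_lt; eauto.
Qed.

Lemma tape_reg w st T i r : tape_ok w st T -> r < R ->
  Nat.testbit (T i) (3 + r) = (i <? st r).
Proof.
  intros HT Hr. rewrite HT. cbn -[Nat.ltb]. apply Nat.ltb_lt in Hr. now rewrite Hr.
Qed.

Lemma bool_eq_iff (a b : bool) : (a = true <-> b = true) -> a = b.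
Proof. destruct a, b; intuition congruence. Qed.

Lemma tape_inc w st T r :
  tape_ok w st T -> r < R ->
  tape_ok w (upd st r (S (st r))) (upd T (st r) (Nat.setbit (T (st r)) (3 + r))).
Proof.
  intros HT Hr i k. unfold upd at 1. destruct (Nat.eqb_spec i (st r)) as [->|Hi].
  - rewrite Nat.setbit_eqb, HT. destruct k as [|[|[|k]]]; try reflexivity.
    cbn -[Nat.ltb]. unfold upd. rewrite (Nat.eqb_sym k).
    destruct (Nat.eqb_spec r k) as [<-|]; cbn -[Nat.ltb]; auto.
    apply bool_eq_iff. rewrite andb_true_iff, !Nat.ltb_lt. intuition lia.
  - rewrite HT. destruct k as [|[|[|k]]]; try reflexivity.
    cbn -[Nat.ltb]. unfold upd.
    destruct (Nat.eqb_spec k r) as [->|]; auto.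
    apply bool_eq_iff. rewrite !andb_true_iff, !Nat.ltb_lt. intuition lia.
Qed.

Lemma tape_dec w st T r :
  tape_ok w st T -> r < R -> 0 < st r ->
  tape_ok w (dec r st)
    (upd T (st r - 1) (Nat.clearbit (T (st r - 1)) (3 + r))).
Proof.
  intros HT Hr Hp i k. unfold upd at 1. destruct (Nat.eqb_spec i (st r - 1)) as [->|Hi].
  - rewrite Nat.clearbit_eqb, HT. destruct k as [|[|[|k]]]; cbn -[Nat.ltb Nat.sub Nat.eqb];
      rewrite ?andb_true_r; try reflexivity.
    unfold dec, upd. rewrite (Nat.eqb_sym k). cbn [Nat.eqb].
    destruct (Nat.eqb_spec r k) as [<-|]; cbn -[Nat.ltb Nat.sub]; rewrite ?andb_true_r; auto.
    apply bool_eq_iff. rewrite !andb_true_iff, !Nat.ltb_lt. intuition (try discriminate; lia).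
  - rewrite HT. destruct k as [|[|[|k]]]; try reflexivity.
    cbn -[Nat.ltb]. unfold dec, upd.
    destruct (Nat.eqb_spec k r) as [->|]; auto.
    apply bool_eq_iff. rewrite !andb_true_iff, !Nat.ltb_lt. intuition lia.
Qed.

Lemma tape_eq w st st' T :
  (forall r, st r = st' r) -> tape_ok w st T -> tape_ok w st' T.
Proof.
  intros E H i k. rewrite H. destruct k as [|[|[|k]]]; auto. simpl. now rewrite E.
Qed.

Hypothesis prog_ok : forall ins, In ins prog -> instr_ok n R ins.

(** An instruction costs at most a walk to the end of one register and back, and register 0 bounds
    every register. *)
Lemma simulate_step w pc st pc' st' T :
  fstep w prog (pc, st) = Some (pc', st') -> tape_ok w st T -> bounded st ->
  pc' < n + 2 /\ bounded st' /\ st 0 <= st' 0 /\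
  exists t T', t <= 2 * st' 0 + 4 /\ tape_ok w st' T' /\
    reach t (4 * pc + 0) 0 T (4 * pc' + 0) 0 T'.
Proof.
  intros Hf HT HB. unfold fstep in Hf.
  destruct (nth_error prog pc) as [ins|] eqn:Hn; [|discriminate].
  assert (Hpc : pc < n) by (apply nth_error_Some; congruence).
  pose proof (prog_ok ins (nth_error_In _ _ Hn)) as Hok.
  assert (HS : forall i, T i < num_symbols) by (intros; eapply tape_symbol_lt; eauto).
  destruct ins as [r|r|r a|r b a|a]; simpl in Hok; injection Hf as <- <-.
  - assert (Hend : exists T', tape_ok w (inc r st) T' /\
      reach 1 (4 * pc + 1) (st r) T (4 * S pc + 3) (st r) T').
    { unfold inc. pose proof (tape_reg w st T (st r) r HT Hok) as E1.
      rewrite Nat.ltb_irrefl in E1.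
      (* In the first cell beyond register [r], bit 3 tells whether register 0 exceeds [st r]: this
         is the ceiling test of [inc]. *)
      assert (E2 : (r =? 0) || Nat.testbit (T (st r)) 3 = (r =? 0) || (st r <? st 0)).
      { change 3 with (3 + 0). rewrite (tape_reg w st) by (auto; lia). reflexivity. }
      eexists; split; [|eapply (reach_step _ (st r) T _ _ DS); [|easy];
        apply raw_to_delta;
        [rewrite raw_delta_main, Hn, E1, E2 by lia; reflexivity
        |apply state_lt; lia|destruct ((r =? 0) || (st r <? st 0)); auto; apply setbit_lt; auto; lia]].
      destruct ((r =? 0) || (st r <? st 0)).
      - now apply tape_inc.
      - intros i k. rewrite upd_same. apply HT. }
    destruct Hend as (T' & HT' & Hend).
    destruct (inc_bounded r st HB) as [HB' Hle].
    split; [lia|]. split; [auto|]. split; [auto|].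
    exists (1 + (st r + (1 + (st r + 1)))), T'. split; [|split; auto].
    + specialize (HB r). lia.
    + apply reach_trans with (4 * pc + 1) 0 T.
      { eapply (reach_move _ 0 T _ DS); try easy.
        - rewrite raw_delta_main, Hn by lia. reflexivity.
        - apply state_lt; lia. }
      eapply reach_trans; [eapply reach_scan; eauto; reflexivity|].
      eapply reach_trans; [exact Hend|]. eapply reach_return; eauto. lia.
  - destruct Hok as [Hr0 Hr].
    destruct (dec_bounded r st) as [HB' Hle]; [lia|auto|].
    split; [lia|]. split; [auto|]. split; [auto|].
    destruct (Nat.eq_dec (st r) 0) as [Hz|Hz].
    + exists 1, T. split; [lia|]. split.
      { apply tape_eq with st; auto. intros x. unfold dec, upd.
        destruct (Nat.eqb_spec x r) as [->|]; lia. }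
      eapply (reach_move _ 0 T _ DS); try easy.
      * rewrite raw_delta_main, Hn, (tape_reg w st) by (auto; lia).
        rewrite Hz. reflexivity.
      * apply state_lt; lia.
    + exists (1 + (st r + (1 + (1 + ((st r - 1) + 1))))).
      eexists. split; [specialize (HB r); lia|]. split; [apply tape_dec; eauto; lia|].
      apply reach_trans with (4 * pc + 1) 0 T.
      { eapply (reach_move _ 0 T _ DS); try easy.
        - rewrite raw_delta_main, Hn, (tape_reg w st) by (auto; lia).
          destruct (Nat.ltb_spec 0 (st r)); [reflexivity|lia].
        - apply state_lt; lia. }
      eapply reach_trans; [eapply reach_scan; eauto; reflexivity|].
      (* The scan stops on the first cell beyond the register, so the cell to be cleared is one to
         the left. *)
      apply reach_trans with (4 * pc + 2) (st r - 1) T.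
      { eapply (reach_move _ (st r) T _ DL); auto; try lia.
        - rewrite raw_delta_main, Hn, (tape_reg w st), Nat.ltb_irrefl by (auto; lia).
          reflexivity.
        - apply state_lt; lia. }
      eapply reach_trans.
      { eapply (reach_step _ (st r - 1) T _ _ DS); [|easy]. apply raw_to_delta.
        - rewrite raw_delta_main, Hn by lia. reflexivity.
        - apply state_lt; lia.
        - now apply clearbit_lt. }
      eapply reach_return; [apply tape_dec; eauto; lia|lia].
  - split; [destruct (st r =? 0); lia|]. do 2 (split; [auto|]).
    exists 1, T. split; [lia|]. split; [auto|].
    eapply (reach_move _ 0 T _ DS); try easy.
    + rewrite raw_delta_main, Hn, (tape_reg w st) by (auto; lia).
      destruct (st r) eqn:E; simpl; reflexivity.
    + apply state_lt; destruct (st r =? 0); lia.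
  - split; [destruct (reads w (st r) b); lia|]. do 2 (split; [auto|]).
    destruct Hok as [Hr Ha].
    exists (1 + (st r + (1 + (st r + 1)))), T.
    split; [specialize (HB r); lia|]. split; [auto|].
    apply reach_trans with (4 * pc + 1) 0 T.
    { eapply (reach_move _ 0 T _ DS); try easy.
      - rewrite raw_delta_main, Hn by lia. reflexivity.
      - apply state_lt; lia. }
    eapply reach_trans; [eapply reach_scan; eauto; reflexivity|].
    eapply reach_trans; [|eapply reach_return; eauto; destruct (reads w (st r) b); lia].
    eapply (reach_move _ (st r) T _ DS); try easy.
    + rewrite raw_delta_main, Hn, (tape_reg w st), Nat.ltb_irrefl by (auto; lia).
      rewrite HT. destruct b; reflexivity.
    + apply state_lt; destruct (reads w (st r) b); lia.
  - split; [lia|]. do 2 (split; [auto|]).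
    exists 1, T. split; [lia|]. split; [auto|].
    eapply (reach_move _ 0 T _ DS); try easy.
    + rewrite raw_delta_main, Hn by lia. reflexivity.
    + apply state_lt; lia.
Qed.

Lemma simulate w k pc st pc' st' T :
  fsteps w prog k (pc, st) (pc', st') -> pc < n + 2 -> tape_ok w st T -> bounded st ->
  pc' < n + 2 /\ st 0 <= st' 0 /\
  exists t T', t <= k * (2 * st' 0 + 4) /\ tape_ok w st' T' /\
    reach t (4 * pc + 0) 0 T (4 * pc' + 0) 0 T'.
Proof.
  revert pc st T. induction k as [|k IH]; intros pc st T H Hpc HT HB.
  - inversion H; subst. split; [auto|]. split; [auto|]. exists 0, T.
    split; [lia|]. split; auto. intros c Hc; exact Hc.
  - inversion H as [|? ? [pc1 st1] ? H1 H2]; subst.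
    destruct (simulate_step _ _ _ _ _ _ H1 HT HB)
      as (Hpc1 & HB1 & Hle1 & t1 & T1 & Ht1 & HT1 & R1).
    destruct (IH _ _ _ H2 Hpc1 HT1 HB1) as (Hpc' & Hle & t2 & T2 & Ht2 & HT2 & R2).
    split; [auto|]. split; [lia|]. exists (t1 + t2), T2.
    split; [|split; [auto|eapply reach_trans; eauto]].
    simpl. nia.
Qed.

Definition init_store (w : list bool) : store :=
  fun r => if r <? 2 then length w else 0.

Definition input_symbol (w : list bool) (i : nat) : nat :=
  match nth_error w i with Some b => if b then 2 else 1 | None => 0 end.

Lemma input_symbol_bit w i k :
  Nat.testbit (input_symbol w i) k =
  match k with 0 => reads w i false | 1 => reads w i true | _ => false end.
Proof.
  unfold input_symbol, reads.
  destruct (nth_error w i) as [[|]|]; destruct k as [|[|k]]; simpl; auto using Nat.bits_0;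
    apply Nat.bits_0.
Qed.

Definition marked (w : list bool) (j i : nat) : nat :=
  if i <? j then
    let s := if i <? length w then mark (input_symbol w i) else input_symbol w i in
    if i =? 0 then Nat.setbit s 2 else s
  else input_symbol w i.

Hypothesis R_ge : 2 <= R.

Lemma input_symbol_lt w i : input_symbol w i < num_symbols.
Proof.
  pose proof num_symbols_ge. unfold input_symbol.
  destruct (nth_error w i) as [[|]|]; lia.
Qed.

Lemma input_symbol_eqb w i : (input_symbol w i =? 0) = negb (i <? length w).
Proof.
  unfold input_symbol. destruct (nth_error w i) as [b|] eqn:E.
  - assert (i < length w) by (apply nth_error_Some; congruence).
    apply Nat.ltb_lt in H. rewrite H. now destruct b.
  - apply nth_error_None in E. apply Nat.ltb_ge in E. now rewrite E.
Qed.

Lemma reach_mark w j :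
  1 <= j <= length w \/ j = 1 ->
  reach j init_state 0 (input_symbol w) (S init_state) j (marked w j).
Proof.
  induction j as [|j IH]; [lia|]. intros Hj.
  assert (Hq : S init_state < num_states) by (unfold init_state, num_states; lia).
  destruct (Nat.eq_dec j 0) as [->|Hj0].
  - eapply reach_ext; [|eapply (reach_step _ 0 (input_symbol w) _ _ DR); [|easy];
      apply raw_to_delta; [unfold raw_delta; rewrite Nat.eqb_refl; reflexivity|auto|]].
    + intros x. unfold upd, marked. rewrite input_symbol_eqb.
      destruct (Nat.eqb_spec x 0) as [->|]; simpl.
      * destruct (0 <? length w); reflexivity.
      * destruct (Nat.ltb_spec x 1); [lia|reflexivity].
    + pose proof (input_symbol_lt w 0).
      destruct (_ =? 0); unfold mark; repeat apply setbit_lt; auto; lia.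
  - replace (S j) with (j + 1) at 1 by lia.
    eapply reach_trans; [apply IH; lia|].
    assert (E : marked w j j = input_symbol w j).
    { unfold marked. now rewrite Nat.ltb_irrefl. }
    eapply reach_ext; [|eapply (reach_step _ j (marked w j) _ (mark (input_symbol w j)) DR); [|easy];
      apply raw_to_delta; [unfold raw_delta|auto|]].
    + intros x. unfold upd, marked.
      destruct (Nat.eqb_spec x j) as [->|].
      * destruct (Nat.ltb_spec j (S j)); [|lia].
        destruct (Nat.ltb_spec j (length w)); [|lia].
        destruct (Nat.eqb_spec j 0); [lia|reflexivity].
      * destruct (Nat.ltb_spec x (S j)), (Nat.ltb_spec x j); try lia; reflexivity.
    + rewrite E, input_symbol_eqb, Nat.eqb_refl.
      destruct (Nat.eqb_spec (S init_state) init_state); [lia|].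
      destruct (Nat.ltb_spec j (length w)); [reflexivity|lia].
    + unfold mark. repeat apply setbit_lt; try lia. apply input_symbol_lt.
Qed.

Lemma marked_ok w : tape_ok w (init_store w) (marked w (S (length w))).
Proof.
  intros i k. unfold marked.
  assert (Hk : forall s, Nat.testbit s k = match k with 0 => reads w i false
     | 1 => reads w i true | _ => false end ->
     Nat.testbit (if i =? 0 then Nat.setbit s 2 else s) k =
     match k with 2 => i =? 0 | _ => Nat.testbit s k end).
  { intros s Hs. destruct (i =? 0); rewrite ?Nat.setbit_eqb, ?Hs;
      destruct k as [|[|[|k]]]; reflexivity. }
  assert (H0 : 0 <? R = true) by (apply Nat.ltb_lt; lia).
  assert (H1 : 1 <? R = true) by (apply Nat.ltb_lt; lia).
  assert (S0 : init_store w 0 = length w) by reflexivity.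
  assert (S1 : init_store w 1 = length w) by reflexivity.
  assert (S2 : forall r, init_store w (S (S r)) = 0) by reflexivity.
  unfold mark, tape_bit.
  destruct (Nat.ltb_spec i (S (length w))).
  - destruct (Nat.ltb_spec i (length w)) as [Hi|Hi]; destruct (Nat.eqb_spec i 0) as [E|E];
      rewrite ?Nat.setbit_eqb, input_symbol_bit;
      destruct k as [|[|[|[|[|k]]]]]; cbn -[Nat.ltb init_store];
      rewrite ?H0, ?H1, ?S0, ?S1, ?S2, ?orb_false_r, ?andb_false_r; cbn -[Nat.ltb init_store]; auto;
      symmetry; auto; try (apply Nat.ltb_lt; lia); try (apply Nat.ltb_ge; lia);
      try (apply Nat.eqb_neq; lia); apply andb_false_r.
  - rewrite input_symbol_bit. destruct k as [|[|[|[|[|k]]]]]; cbn -[Nat.ltb init_store]; auto;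
      rewrite ?H0, ?H1, ?S0, ?S1, ?S2; cbn -[Nat.ltb]; symmetry;
      try (apply Nat.eqb_neq; lia); try (apply Nat.ltb_ge; lia); apply andb_false_r.
Qed.

Lemma reach_init w :
  exists t T, t <= 2 * length w + 4 /\ tape_ok w (init_store w) T /\
    reach t init_state 0 (input_symbol w) (4 * 0 + 0) 0 T.
Proof.
  set (N := length w).
  assert (Hq : 3 < num_states) by (unfold num_states; lia).
  (* The origin is marked even if the input is empty, so the initial pass treats at least one
     cell. *)
  set (j := max 1 N).
  assert (Hj : forall x, marked w j x = marked w (S N) x).
  { intros x. unfold marked, j. fold N.
    destruct (Nat.ltb_spec x (max 1 N)), (Nat.ltb_spec x (S N)); try lia; auto.
    assert (x = N) by lia. subst x. rewrite Nat.ltb_irrefl.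
    destruct (Nat.eqb_spec N 0); [lia|reflexivity]. }
  assert (Hok : tape_ok w (init_store w) (marked w j)).
  { intros i k. rewrite Hj. apply marked_ok. }
  exists (j + (1 + ((j - 1) + 1))), (marked w j). split; [lia|]. split; [auto|].
  eapply reach_trans; [apply reach_mark; lia|].
  eapply reach_trans; [|apply (reach_return w (init_store w)); auto; lia].
  eapply (reach_move _ j _ _ DL); try lia.
  - assert (E : marked w j j = input_symbol w j).
    { unfold marked. now rewrite Nat.ltb_irrefl. }
    unfold raw_delta. rewrite Nat.eqb_refl, E, input_symbol_eqb.
    destruct (Nat.eqb_spec (S init_state) init_state); [lia|].
    destruct (Nat.ltb_spec j (length w)); [lia|reflexivity].
  - eapply tape_symbol_lt; eauto.
Qed.

Lemma init_at_cfg w :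
  at_cfg (init_config machine w) init_state 0 (input_symbol w).
Proof.
  assert (E : forall k, nth k (map (fun b : bool => if b then 2 else 1) w) 0
     = input_symbol w k).
  { intros k. unfold input_symbol. rewrite <- (map_id (A := nat) (map _ _)).
    revert k; induction w as [|b w' IH]; intros [|k]; simpl; auto. }
  unfold init_config. repeat split; simpl; try lia.
  - rewrite hd_nth. apply E.
  - intros k. rewrite nth_tl. apply E.
Qed.

Lemma machine_decides w k pc st (P : Prop) T :
  fsteps w prog k (0, init_store w) (pc, st) -> n <= pc ->
  (pc = n <-> P) ->
  (k + 1) * (2 * st 0 + 4) <= T ->
  decides_within machine w T P.
Proof.
  intros Hf Hpc HP HT.
  destruct (reach_init w) as (t1 & T1 & Ht1 & HT1 & R1).
  assert (HB : bounded (init_store w)).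
  { intros r. unfold init_store. destruct (r <? 2); simpl; lia. }
  destruct (simulate _ _ _ _ _ _ _ Hf ltac:(lia) HT1 HB)
    as (Hpc' & Hle & t2 & T2 & Ht2 & HT2 & R2).
  destruct (reach_trans _ _ _ _ _ _ _ _ _ _ _ R1 R2 _ (init_at_cfg w)) as (Hq & Hh & _).
  exists (t1 + t2). split; [change (init_store w 0) with (length w) in Hle; nia|].
  assert (Hnone : nth_error prog pc = None) by now apply nth_error_None.
  split.
  - unfold halted. rewrite Hq. cbn [machine tm_delta]. unfold delta.
    rewrite raw_delta_main, Hnone by lia. reflexivity.
  - rewrite Hq. simpl tm_accept. rewrite Nat.eqb_eq, <- HP. lia.
Qed.

End Machine.

(** * Loop programs *)

(** The number of rounds of a loop is fixed on entry, so termination is built in and the cost can be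
    bounded by recursion on the program. *)
Inductive cmd :=
  | CSkip
  | CInc (r : nat)
  | CDec (r : nat)
  | CSeq (a b : cmd)
  | CIf (r : nat) (a b : cmd)
  | CIn (r : nat) (bit : bool) (a b : cmd)
  | CLoop (r : nat) (a : cmd).

Fixpoint run (w : list bool) (c : cmd) (st : store) : store :=
  match c with
  | CSkip => st
  | CInc r => inc r st
  | CDec r => dec r st
  | CSeq a b => run w b (run w a st)
  | CIf r a b => if st r =? 0 then run w b st else run w a st
  | CIn r bit a b => if reads w (st r) bit then run w a st else run w b st
  | CLoop r a => Nat.iter (st r) (fun s => run w a (dec r s)) st
  end.

(* [CLoop r a] is compiled to a while loop on [r], hence [a] must preserve [r]. *)
Fixpoint cmd_ok (R : nat) (c : cmd) : Prop :=
  match c with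
  | CSkip => True
  | CInc r => r < R
  | CDec r => 0 < r < R
  | CSeq a b => cmd_ok R a /\ cmd_ok R b
  | CIf r a b | CIn r _ a b => r < R /\ cmd_ok R a /\ cmd_ok R b
  | CLoop r a => 0 < r < R /\ cmd_ok R a /\
      forall w st, bounded st -> run w a st r = st r
  end.

Fixpoint size (c : cmd) : nat :=
  match c with
  | CSkip => 0
  | CInc _ | CDec _ => 1
  | CSeq a b => size a + size b
  | CIf _ a b | CIn _ _ a b => size a + size b + 2
  | CLoop _ a => size a + 3
  end.

Fixpoint compile (c : cmd) (pc : nat) : list instr :=
  match c with
  | CSkip => []
  | CInc r => [IInc r]
  | CDec r => [IDec r]
  | CSeq a b => compile a pc ++ compile b (pc + size a)
  | CIf r a b =>
      IJz r (pc + size a + 2) :: compile a (pc + 1)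
      ++ IJmp (pc + size a + size b + 2) :: compile b (pc + size a + 2)
  | CIn r bit a b =>
      IJin r bit (pc + size a + 2) :: compile a (pc + 1)
      ++ IJmp (pc + size a + size b + 2) :: compile b (pc + size a + 2)
  | CLoop r a =>
      IJz r (pc + size a + 3) :: IDec r :: compile a (pc + 2) ++ [IJmp pc]
  end.

Lemma compile_length c pc : length (compile c pc) = size c.
Proof.
  revert pc; induction c; intros; simpl; rewrite ?length_app; simpl;
    rewrite ?IHc, ?IHc1, ?IHc2; simpl; lia.
Qed.

Lemma compile_ok R n c pc ins :
  cmd_ok R c -> pc + size c <= n -> In ins (compile c pc) -> instr_ok n R ins.
Proof.
  revert pc; induction c; simpl; intros pc Hok Hn Hin.
  - easy.
  - destruct Hin as [<-|[]]. auto.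
  - destruct Hin as [<-|[]]. auto.
  - apply in_app_iff in Hin as [Hin|Hin]; [eapply IHc1|eapply IHc2]; eauto; try tauto; lia.
  - destruct Hok as (? & ? & ?).
    destruct Hin as [<-|Hin]; [simpl; lia|].
    apply in_app_iff in Hin as [Hin|[<-|Hin]]; [eapply IHc1|simpl|eapply IHc2]; eauto; lia.
  - destruct Hok as (? & ? & ?).
    destruct Hin as [<-|Hin]; [simpl; lia|].
    apply in_app_iff in Hin as [Hin|[<-|Hin]]; [eapply IHc1|simpl|eapply IHc2]; eauto; lia.
  - destruct Hok as (? & ? & ?).
    destruct Hin as [<-|[<-|Hin]]; [simpl; lia|simpl; lia|].
    apply in_app_iff in Hin as [Hin|[<-|[]]]; [eapply IHc|simpl]; eauto; lia.
Qed.

Fixpoint cost (c : cmd) (B : nat) : nat :=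
  match c with
  | CSkip => 0
  | CInc _ | CDec _ => 1
  | CSeq a b => cost a B + cost b B
  | CIf _ a b | CIn _ _ a b => cost a B + cost b B + 2
  | CLoop _ a => B * (cost a B + 3) + 1
  end.

Lemma cost_mono c B B' : B <= B' -> cost c B <= cost c B'.
Proof. intros H. induction c; simpl; nia. Qed.

Fixpoint degree (c : cmd) : nat :=
  match c with
  | CSkip => 0
  | CInc _ | CDec _ => 1
  | CSeq a b => degree a + degree b + 1
  | CIf _ a b | CIn _ _ a b => degree a + degree b + 2
  | CLoop _ a => degree a + 3
  end.

(** The base [B + 2] is at least 2 even for [B = 0], so sums, additive constants and the factor [B]
    of a loop are all absorbed by raising the exponent. *)
Lemma cost_poly c B : cost c B <= (B + 2) ^ degree c.
Proof.
  assert (P : forall d, 1 <= (B + 2) ^ d).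
  { intros d. pose proof (Nat.pow_nonzero (B + 2) d). lia. }
  induction c; simpl cost; simpl degree; try (simpl; lia);
    rewrite ?Nat.pow_add_r; change ((B + 2) ^ 3) with ((B + 2) * ((B + 2) * ((B + 2) * 1)));
    change ((B + 2) ^ 2) with ((B + 2) * ((B + 2) * 1)); rewrite ?Nat.pow_1_r.
  - pose proof (P (degree c1)). pose proof (P (degree c2)). nia.
  - pose proof (P (degree c1)). pose proof (P (degree c2)).
    set (x := (B + 2) ^ degree c1) in *. set (y := (B + 2) ^ degree c2) in *.
    assert (x + y <= 2 * (x * y)) by nia. nia.
  - pose proof (P (degree c1)). pose proof (P (degree c2)).
    set (x := (B + 2) ^ degree c1) in *. set (y := (B + 2) ^ degree c2) in *.
    assert (x + y <= 2 * (x * y)) by nia. nia.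
  - pose proof (P (degree c)). set (x := (B + 2) ^ degree c) in *.
    assert (B * (cost c B + 3) + 1 <= B * (x + 3) + 1) by nia. nia.
Qed.

(** * Correctness and cost of compiled loop programs *)

Definition code_at (prog : list instr) (pc : nat) (code : list instr) : Prop :=
  exists pre post, prog = pre ++ code ++ post /\ length pre = pc.

Lemma code_at_app prog pc a b :
  code_at prog pc (a ++ b) -> code_at prog pc a /\ code_at prog (pc + length a) b.
Proof.
  intros (pre & post & -> & <-). split.
  - exists pre, (b ++ post). now rewrite <- app_assoc.
  - exists (pre ++ a), post. rewrite length_app, <- !app_assoc. auto.
Qed.

Lemma code_at_cons prog pc i b :
  code_at prog pc (i :: b) -> nth_error prog pc = Some i /\ code_at prog (pc + 1) b.
Proof.
  intros H. split.
  - destruct H as (pre & post & -> & <-). rewrite nth_error_app2, Nat.sub_diag by lia.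
    reflexivity.
  - now apply (code_at_app _ _ [i]) in H.
Qed.

Lemma fstep_at w prog pc st i :
  nth_error prog pc = Some i ->
  fstep w prog (pc, st) = match i with
  | IInc r => Some (S pc, inc r st)
  | IDec r => Some (S pc, dec r st)
  | IJz r a => Some (if st r =? 0 then a else S pc, st)
  | IJin r b a => Some (if reads w (st r) b then S pc else a, st)
  | IJmp a => Some (a, st)
  end.
Proof. intros H. unfold fstep. rewrite H. now destruct i. Qed.

Lemma iter_in {A} (f : A -> A) k x : Nat.iter (S k) f x = Nat.iter k f (f x).
Proof. apply Nat.iter_succ_r. Qed.

(** The cost is evaluated at the final value of register 0: this register never decreases and bounds
    all others, so its final value bounds the number of rounds of every loop met during the run. *)
Lemma compile_correct R w prog c pc st :
  cmd_ok R c -> code_at prog pc (compile c pc) -> bounded st ->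
  bounded (run w c st) /\ st 0 <= run w c st 0 /\
  exists k, k <= cost c (run w c st 0) /\
    fsteps w prog k (pc, st) (pc + size c, run w c st).
Proof.
  revert pc st. induction c as [|r|r|a IHa b IHb|r a IHa b IHb|r bit a IHa b IHb|r a IHa];
    intros pc st Hok Hc HB; cbn [run cost size].
  - split; [auto|]. split; [auto|]. exists 0. rewrite Nat.add_0_r. split; [lia|constructor].
  - apply code_at_cons in Hc as [Hn _]. destruct (inc_bounded r st HB).
    split; [auto|]. split; [auto|]. exists 1. split; [lia|]. apply fsteps_1.
    rewrite (fstep_at _ _ _ _ _ Hn), Nat.add_1_r. reflexivity.
  - apply code_at_cons in Hc as [Hn _]. destruct (dec_bounded r st) as [? ?]; [simpl in Hok; lia|auto|].
    split; [auto|]. split; [auto|]. exists 1. split; [lia|]. apply fsteps_1.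
    rewrite (fstep_at _ _ _ _ _ Hn), Nat.add_1_r. reflexivity.
  - destruct Hok as [Hok1 Hok2]. apply code_at_app in Hc as [Hc1 Hc2].
    rewrite compile_length in Hc2.
    destruct (IHa _ _ Hok1 Hc1 HB) as (HB1 & Hle1 & k1 & Hk1 & R1).
    destruct (IHb _ _ Hok2 Hc2 HB1) as (HB2 & Hle2 & k2 & Hk2 & R2).
    split; [auto|]. split; [lia|]. exists (k1 + k2). split.
    + pose proof (cost_mono a _ _ Hle2). lia.
    + eapply fsteps_trans; [exact R1|]. now rewrite Nat.add_assoc.
  - destruct Hok as (Hr & Hok1 & Hok2). cbn [compile] in Hc.
    apply code_at_cons in Hc as [Hn Hc].
    apply code_at_app in Hc as [Hc1 Hc2]. rewrite compile_length in Hc2.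
    apply code_at_cons in Hc2 as [Hn2 Hc2].
    replace (pc + 1 + size a + 1) with (pc + size a + 2) in Hc2 by lia.
    destruct (Nat.eqb_spec (st r) 0) as [E|E].
    + destruct (IHb _ _ Hok2 Hc2 HB) as (HB2 & Hle2 & k2 & Hk2 & R2).
      split; [auto|]. split; [auto|]. exists (S k2). split; [lia|].
      econstructor; [rewrite (fstep_at _ _ _ _ _ Hn), E; reflexivity|].
      replace (pc + (size a + size b + 2)) with (pc + size a + 2 + size b) by lia.
      exact R2.
    + destruct (IHa _ _ Hok1 Hc1 HB) as (HB2 & Hle2 & k2 & Hk2 & R2).
      split; [auto|]. split; [auto|]. exists (S (k2 + 1)). split; [lia|].
      apply Nat.eqb_neq in E.
      econstructor; [rewrite (fstep_at _ _ _ _ _ Hn), E, <- Nat.add_1_r; reflexivity|].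
      eapply fsteps_trans; [exact R2|]. apply fsteps_1.
      rewrite (fstep_at _ _ _ _ _ Hn2). do 2 f_equal. lia.
  - destruct Hok as (Hr & Hok1 & Hok2). cbn [compile] in Hc.
    apply code_at_cons in Hc as [Hn Hc].
    apply code_at_app in Hc as [Hc1 Hc2]. rewrite compile_length in Hc2.
    apply code_at_cons in Hc2 as [Hn2 Hc2].
    replace (pc + 1 + size a + 1) with (pc + size a + 2) in Hc2 by lia.
    destruct (reads w (st r) bit) eqn:E.
    + destruct (IHa _ _ Hok1 Hc1 HB) as (HB2 & Hle2 & k2 & Hk2 & R2).
      split; [auto|]. split; [auto|]. exists (S (k2 + 1)). split; [lia|].
      econstructor; [rewrite (fstep_at _ _ _ _ _ Hn), E, <- Nat.add_1_r; reflexivity|].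
      eapply fsteps_trans; [exact R2|]. apply fsteps_1.
      rewrite (fstep_at _ _ _ _ _ Hn2). do 2 f_equal. lia.
    + destruct (IHb _ _ Hok2 Hc2 HB) as (HB2 & Hle2 & k2 & Hk2 & R2).
      split; [auto|]. split; [auto|]. exists (S k2). split; [lia|].
      econstructor; [rewrite (fstep_at _ _ _ _ _ Hn), E; reflexivity|].
      replace (pc + (size a + size b + 2)) with (pc + size a + 2 + size b) by lia.
      exact R2.
  - destruct Hok as (Hr & Hoka & Hpres). cbn [compile] in Hc.
    apply code_at_cons in Hc as [Hn Hc]. apply code_at_cons in Hc as [Hn1 Hc].
    replace (pc + 1 + 1) with (pc + 2) in Hc by lia.
    apply code_at_app in Hc as [Hc1 Hc2]. rewrite compile_length in Hc2.
    apply code_at_cons in Hc2 as [Hn2 _].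
    set (f := fun s => run w a (dec r s)).
    assert (Main : forall m st, bounded st -> st r = m ->
      bounded (Nat.iter m f st) /\ st 0 <= Nat.iter m f st 0 /\
      exists k, k <= m * (cost a (Nat.iter m f st 0) + 3) + 1 /\
        fsteps w prog k (pc, st) (pc + (size a + 3), Nat.iter m f st)).
    { induction m as [|m IHm]; intros s Hs Hm.
      - split; [auto|]. split; [auto|]. exists 1. split; [lia|]. apply fsteps_1.
        rewrite (fstep_at _ _ _ _ _ Hn), Hm. cbn. do 2 f_equal. lia.
      - rewrite iter_in.
        destruct (dec_bounded r s) as [HBd Hled]; [lia|auto|].
        destruct (IHa _ _ Hoka Hc1 HBd) as (HB1 & Hle1 & k1 & Hk1 & R1).
        destruct (IHm (f s)) as (HB2 & Hle2 & k2 & Hk2 & R2); [exact HB1| |].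
        { unfold f. rewrite Hpres by auto. unfold dec. rewrite upd_eq. lia. }
        split; [auto|]. split; [unfold f in Hle2 at 1; lia|].
        exists (S (S (k1 + (1 + k2)))). split.
        + pose proof (cost_mono a _ _ Hle2). unfold f at 1 in H.
          simpl Nat.mul. lia.
        + econstructor; [rewrite (fstep_at _ _ _ _ _ Hn), Hm; reflexivity|].
          rewrite <- (Nat.add_1_r pc) at 1.
          econstructor; [rewrite (fstep_at _ _ _ _ _ Hn1); reflexivity|].
          replace (S (pc + 1)) with (pc + 2) by lia.
          eapply fsteps_trans; [exact R1|].
          eapply fsteps_trans; [|exact R2]. apply fsteps_1.
          now rewrite (fstep_at _ _ _ _ _ Hn2). }
    destruct (Main (st r) st HB eq_refl) as (H1 & H2 & k & Hk & H3).
    split; [auto|]. split; [auto|]. exists k. split; [|exact H3].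
    specialize (H1 r). fold f.
    assert (st r <= Nat.iter (st r) f st 0) by (specialize (HB r); lia). nia.
Qed.

Lemma run_bounded R w c st :
  cmd_ok R c -> bounded st -> bounded (run w c st).
Proof.
  intros H HB. eapply (compile_correct R w (compile c 0) c 0 st); eauto.
  exists [], []. now rewrite app_nil_r.
Qed.

(** If [res] is nonzero, the last instruction falls through to the accepting address, the length of
    the code; otherwise it jumps one address further, which rejects. *)
Definition code (c : cmd) (res : nat) : list instr :=
  compile c 0 ++ [IJz res (size c + 2)].

Theorem cmd_decides R c res w (P : Prop) T :
  2 <= R -> res < R -> cmd_ok R c ->
  let st := run w c (init_store w) in
  (st res <> 0 <-> P) ->
  (cost c (st 0) + 2) * (2 * st 0 + 4) <= T ->
  decides_within (machine (code c res) R) w T P.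
Proof.
  intros HR Hres Hok st HP HT.
  assert (Hlen : length (code c res) = size c + 1).
  { unfold code. rewrite length_app, compile_length. reflexivity. }
  assert (HB : bounded (init_store w)).
  { intros r. unfold init_store. destruct (r <? 2); simpl; lia. }
  destruct (compile_correct R w (code c res) c 0 (init_store w) Hok)
    as (_ & _ & k & Hk & Hs); auto.
  { exists [], [IJz res (size c + 2)]. auto. }
  fold st in Hk, Hs.
  assert (Hn : nth_error (code c res) (0 + size c) = Some (IJz res (size c + 2))).
  { unfold code. rewrite nth_error_app2; rewrite compile_length; [|simpl; lia].
    now rewrite Nat.sub_diag. }
  eapply machine_decides with (k := k + 1) (pc := if st res =? 0 then size c + 2 else S (size c))
    (st := st); auto.
  - intros ins Hin. unfold code in Hin. apply in_app_iff in Hin as [Hin|[<-|[]]].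
    + eapply compile_ok; eauto. lia.
    + simpl. lia.
  - eapply fsteps_trans; [exact Hs|]. apply fsteps_1.
    rewrite (fstep_at _ _ _ _ _ Hn). reflexivity.
  - destruct (_ =? _); lia.
  - rewrite <- HP, Hlen. destruct (Nat.eqb_spec (st res) 0); lia.
  - nia.
Qed.

Lemma cmd_ok_mono R R' c : R <= R' -> cmd_ok R c -> cmd_ok R' c.
Proof.
  intros H. induction c; simpl; intuition (auto; lia).
Qed.

(** Hides the number of registers, which matters only when the machine is built. *)
Definition good (c : cmd) : Prop := exists R, cmd_ok R c.

Lemma good_skip : good CSkip.
Proof. now exists 0. Qed.

Lemma good_inc r : good (CInc r).
Proof. intros. exists (S r). simpl. lia. Qed.

Lemma good_dec r : 0 < r -> good (CDec r).
Proof. intros. exists (S r). simpl. lia. Qed.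

Lemma good_seq a b : good a -> good b -> good (CSeq a b).
Proof.
  intros [R1 H1] [R2 H2]. exists (max R1 R2).
  split; (eapply cmd_ok_mono; [|eassumption]; lia).
Qed.

Lemma good_if r a b : good a -> good b -> good (CIf r a b).
Proof.
  intros [R1 H1] [R2 H2]. exists (max (S r) (max R1 R2)).
  split; [lia|]. split; (eapply cmd_ok_mono; [|eassumption]; lia).
Qed.

Lemma good_in r bit a b : good a -> good b -> good (CIn r bit a b).
Proof.
  intros [R1 H1] [R2 H2]. exists (max (S r) (max R1 R2)).
  split; [lia|]. split; (eapply cmd_ok_mono; [|eassumption]; lia).
Qed.

Lemma good_loop r a :
  0 < r -> good a -> (forall w st, bounded st -> run w a st r = st r) ->
  good (CLoop r a).
Proof.
  intros Hr [R1 H1] H. exists (max (S r) R1).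
  split; [lia|]. split; auto. (eapply cmd_ok_mono; [|eassumption]; lia).
Qed.

Lemma good_bounded w c st : good c -> bounded st -> bounded (run w c st).
Proof. intros [R H]. eapply run_bounded; eauto. Qed.

Lemma loop_inv (I : nat -> store -> Prop) w r a st :
  I 0 st -> (forall k s, k < st r -> I k s -> I (S k) (run w a (dec r s))) ->
  I (st r) (run w (CLoop r a) st).
Proof.
  intros H0 HS. simpl.
  assert (H : forall k, k <= st r -> I k (Nat.iter k (fun s => run w a (dec r s)) st)).
  { induction k as [|k IH]; intros Hk; simpl; auto. apply HS; [lia|]. apply IH. lia. }
  now apply H.
Qed.

Lemma run_seq w a b st : run w (CSeq a b) st = run w b (run w a st).
Proof. reflexivity. Qed.

Ltac reg_cases :=
  repeat match goal with
  | |- context [?x =? ?y] => destruct (Nat.eqb_spec x y); subst; try lia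
  | H : context [?x =? ?y] |- _ => destruct (Nat.eqb_spec x y); subst; try lia
  end; try lia.

Ltac store_ext :=
  apply functional_extensionality; intro; unfold dec, upd; reg_cases; try lia.

(** Arithmetic outside register 0 saturates at register 0, which is why [teval] truncates sums and
    products at [B]. *)
Lemma inc_min r st : 0 < r -> bounded st -> inc r st = upd st r (min (st 0) (S (st r))).
Proof.
  intros Hr HB. unfold inc. specialize (HB r).
  destruct (Nat.eqb_spec r 0); [lia|]. simpl.
  destruct (Nat.ltb_spec (st r) (st 0)); store_ext.
Qed.

(** * Register arithmetic: copying, addition and Euclidean division *)

Definition zero (r : nat) : cmd := CLoop r CSkip.

Definition addto (r s : nat) : cmd := CLoop s (CInc r).

(** A loop destroys its counter, so [x] is drained into [r] and [t] at once and then restored from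
    [t]. *)
Definition copy (x r t : nat) : cmd :=
  CSeq (zero r) (CSeq (zero t)
    (CSeq (CLoop x (CSeq (CInc r) (CInc t))) (addto x t))).

Lemma run_zero w r st : run w (zero r) st = upd st r 0.
Proof.
  unfold zero. rewrite (loop_inv (fun k s => s = upd st r (st r - k)) w r CSkip st).
  - rewrite Nat.sub_diag. reflexivity.
  - store_ext.
  - intros k s Hk ->. cbn [run]. store_ext.
Qed.

Lemma bounded_upd st r v : 0 < r -> bounded st -> v <= st 0 -> bounded (upd st r v).
Proof.
  intros Hr HB Hv x. rewrite (upd_neq _ _ _ 0) by lia. unfold upd.
  destruct (x =? r); auto.
Qed.

Lemma run_addto w r s st :
  0 < r -> 0 < s -> r <> s -> bounded st ->
  run w (addto r s) st = upd (upd st s 0) r (min (st 0) (st r + st s)).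
Proof.
  intros Hr Hs Hrs HB. unfold addto. pose proof (HB r). pose proof (HB s).
  rewrite (loop_inv (fun k s' => k <= st s ->
    s' = upd (upd st s (st s - k)) r (min (st 0) (st r + k))) w s (CInc r) st).
  - store_ext.
  - intros _. store_ext.
  - intros k s' Hk E _. rewrite E by lia. cbn [run].
    rewrite inc_min; [store_ext|lia|].
    repeat (apply bounded_upd; [lia| |unfold upd; reg_cases]). auto.
  - lia.
Qed.

Lemma run_copy w x r t st :
  0 < x -> 0 < r -> 0 < t -> x <> r -> x <> t -> r <> t -> bounded st ->
  run w (copy x r t) st = upd (upd st t 0) r (st x).
Proof.
  intros Hx Hr Ht H1 H2 H3 HB. unfold copy. cbn [run].
  rewrite !run_zero.
  set (s0 := upd (upd st r 0) t 0).
  assert (HB0 : bounded s0) by (unfold s0; repeat apply bounded_upd; auto; lia).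
  assert (E : run w (CLoop x (CSeq (CInc r) (CInc t))) s0 =
     upd (upd (upd s0 x 0) r (st x)) t (st x)).
  { assert (Ex : s0 x = st x) by (unfold s0; now rewrite !upd_neq by auto).
    assert (E0 : s0 0 = st 0) by (unfold s0; now rewrite !upd_neq by lia).
    pose proof (HB x).
    rewrite (loop_inv (fun k s => k <= st x ->
      s = upd (upd (upd s0 x (st x - k)) r k) t k) w x _ s0).
    - rewrite Ex, Nat.sub_diag. reflexivity.
    - intros _. unfold s0. store_ext.
    - intros k s Hk HI Hk'. rewrite HI by lia. cbn [run].
      rewrite (inc_min r); [|lia|].
      2: { repeat (apply bounded_upd; [lia| |unfold s0, dec, upd; reg_cases]). auto. }
      rewrite (inc_min t); [|lia|].
      2: { repeat (apply bounded_upd; [lia| |unfold s0, dec, upd; reg_cases]). auto. }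
      unfold s0, dec. store_ext.
    - rewrite Ex. lia. }
  cbn [run] in E. rewrite E. rewrite run_addto; auto.
  - unfold s0. pose proof (HB x). store_ext.
  - pose proof (HB x).
    repeat (apply bounded_upd; [lia| |unfold s0, upd; reg_cases]). auto.
Qed.

Lemma good_zero r : 0 < r -> good (zero r).
Proof. intros. apply good_loop; auto using good_skip. Qed.

Lemma good_addto r s : 0 < s -> r <> s -> good (addto r s).
Proof.
  intros. apply good_loop; auto using good_inc. intros w st _. simpl. unfold inc.
  destruct (_ || _); auto. apply upd_neq. auto.
Qed.

Lemma good_copy x r t :
  0 < x -> 0 < r -> 0 < t -> x <> r -> x <> t -> r <> t -> good (copy x r t).
Proof.
  intros. unfold copy.
  repeat first [apply good_seq|apply good_zero|apply good_addto|apply good_loop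
    |apply good_inc]; auto.
  intros w st _. simpl. unfold inc.
  repeat (destruct (_ || _); rewrite ?upd_neq by auto); auto.
Qed.

Create HintDb good.
#[local] Hint Resolve good_skip good_inc good_seq good_if good_in : good.
#[local] Hint Extern 2 (good (CDec _)) => apply good_dec; lia : good.
#[local] Hint Extern 2 (good (zero _)) => apply good_zero; lia : good.
#[local] Hint Extern 2 (good (addto _ _)) => apply good_addto; lia : good.
#[local] Hint Extern 2 (good (copy _ _ _)) => apply good_copy; lia : good.

(** Register [d + 1] holds the divisor minus one, say [b]. After [k] units of the dividend in [d]
    have been consumed, [d + 4] holds [b - k mod S b] and [d + 3] the result for [k]. Register
    [d + 2] is left alone because it counts the divisions when a digit is extracted. *)
Definition quotient_body (d : nat) : cmd :=
  CIf (d + 4) (CDec (d + 4)) (CSeq (CInc (d + 3)) (copy (d + 1) (d + 4) (d + 5))).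

Definition remainder_body (d : nat) : cmd :=
  CIf (d + 4) (CSeq (CDec (d + 4)) (CInc (d + 3)))
    (CSeq (copy (d + 1) (d + 4) (d + 5)) (zero (d + 3))).

Definition euclid (body : nat -> cmd) (d : nat) : cmd :=
  CSeq (zero (d + 3)) (CSeq (copy (d + 1) (d + 4) (d + 5))
    (CSeq (CLoop d (body d)) (addto d (d + 3)))).

Lemma div_mod_succ k b :
  (k mod S b = b -> S k / S b = S (k / S b) /\ S k mod S b = 0) /\
  (k mod S b <> b -> S k / S b = k / S b /\ S k mod S b = S (k mod S b)).
Proof.
  pose proof (Nat.div_mod k (S b) ltac:(lia)) as E.
  pose proof (Nat.mod_upper_bound k (S b) ltac:(lia)) as L.
  split; intros H.
  - split; [symmetry; apply Nat.div_unique with 0; nia|].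
    symmetry. apply Nat.mod_unique with (S (k / S b)); nia.
  - split; [symmetry; apply Nat.div_unique with (S (k mod S b)); nia|].
    symmetry. apply Nat.mod_unique with (k / S b); nia.
Qed.

Lemma run_euclid w body (val : nat -> nat -> nat) d st :
  0 < d -> bounded st -> good (body d) ->
  (forall b, val 0 b = 0) -> (forall k b, val k b <= k) ->
  (forall k b s, bounded s -> k < s 0 -> s (d + 1) = b -> s (d + 3) = val k b ->
     s (d + 4) = b - k mod S b ->
     let s' := run w (body d) s in
     s' (d + 3) = val (S k) b /\ s' (d + 4) = b - S k mod S b /\
     forall x, x < d + 3 -> s' x = s x) ->
  let st' := run w (euclid body d) st in
  st' d = val (st d) (st (d + 1)) /\
  forall x, x < d + 3 -> x <> d -> st' x = st x.
Proof.
  intros Hd HB Hg V0 Vle HS. unfold euclid. rewrite !run_seq.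
  set (b := st (d + 1)).
  set (s0 := run w (copy _ _ _) _).
  assert (E0 : s0 = upd (upd (upd st (d + 3) 0) (d + 5) 0) (d + 4) b).
  { unfold s0. rewrite run_zero, run_copy by (try lia; apply bounded_upd; auto; lia).
    rewrite (upd_neq _ _ _ (d + 1)) by lia. reflexivity. }
  assert (HB0 : bounded s0).
  { rewrite E0. unfold b. pose proof (HB (d + 1)).
    repeat (apply bounded_upd; [lia| |unfold upd; reg_cases]). auto. }
  assert (Ed : s0 d = st d) by (rewrite E0; now rewrite !upd_neq by lia).
  assert (Ez : s0 0 = st 0) by (rewrite E0; now rewrite !upd_neq by lia).
  pose proof (loop_inv (fun k s => bounded s /\ s d = st d - k /\ s (d + 3) = val k b /\
     s (d + 4) = b - k mod S b /\ forall x, x < d + 3 -> x <> d -> s x = st x)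
     w d (body d) s0) as H.
  destruct H as (H1 & H2 & H3 & H4 & H5).
  - split; auto. split; [lia|]. rewrite V0, Nat.Div0.mod_0_l, Nat.sub_0_r by lia.
    rewrite E0. repeat split.
    + unfold upd; reg_cases.
    + now rewrite upd_eq.
    + intros x Hx1 Hx2. now rewrite !upd_neq by lia.
  - intros k s Hk (J1 & J2 & J3 & J4 & J5).
    assert (JB : bounded (dec d s)) by (apply dec_bounded; auto; lia).
    assert (Edec : forall x, x <> d -> dec d s x = s x)
      by (intros; unfold dec; now rewrite upd_neq).
    destruct (HS k b (dec d s)) as (K1 & K2 & K3); auto.
    + rewrite Edec, J5 by lia. specialize (HB d). lia.
    + rewrite Edec, J5 by lia. reflexivity.
    + rewrite Edec by lia. auto.
    + rewrite Edec by lia. auto.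
    + split; [now apply good_bounded|]. split; [|split; [auto|split; [auto|]]].
      * rewrite K3 by lia. unfold dec. rewrite upd_eq. lia.
      * intros x Hx1 Hx2. rewrite K3, Edec by lia. auto.
  - rewrite Ed in *. cbn zeta. rewrite run_addto by (auto; lia). split.
    + rewrite upd_eq, H2, H3, H5 by lia. rewrite Nat.sub_diag. pose proof (Vle (st d) b).
      specialize (HB d). lia.
    + intros x Hx1 Hx2. rewrite !upd_neq by lia. auto.
Qed.

Lemma run_quotient w d st :
  0 < d -> bounded st ->
  let st' := run w (euclid quotient_body d) st in
  st' d = st d / S (st (d + 1)) /\ forall x, x < d + 3 -> x <> d -> st' x = st x.
Proof.
  intros Hd HB. apply (run_euclid w quotient_body (fun k b => k / S b)); auto.
  - unfold quotient_body. auto 10 with good.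
  - intros k b. apply Nat.Div0.div_le_upper_bound. nia.
  - intros k b s HBs Hk H1 H3 H4. unfold quotient_body. cbn [run].
    pose proof (Nat.mod_upper_bound k (S b) ltac:(lia)) as L.
    destruct (div_mod_succ k b) as [D1 D2].
    destruct (Nat.eqb_spec (s (d + 4)) 0) as [E|E].
    + destruct D1 as [D1 D1']; [lia|]. rewrite D1, D1'.
      assert (k / S b <= k) by (apply Nat.Div0.div_le_upper_bound; nia).
      rewrite inc_min by (auto; lia).
      rewrite run_copy by (try lia; apply bounded_upd; auto; lia).
      repeat split; [unfold upd; reg_cases..|].
      intros x Hx. now rewrite !upd_neq by lia.
    + destruct D2 as [D2 D2']; [lia|]. rewrite D2, D2'. unfold dec.
      repeat split; [unfold upd; reg_cases..|].
      intros x Hx. now rewrite !upd_neq by lia.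
Qed.

Lemma run_remainder w d st :
  0 < d -> bounded st ->
  let st' := run w (euclid remainder_body d) st in
  st' d = st d mod S (st (d + 1)) /\ forall x, x < d + 3 -> x <> d -> st' x = st x.
Proof.
  intros Hd HB. apply (run_euclid w remainder_body (fun k b => k mod S b)); auto.
  - unfold remainder_body. auto 10 with good.
  - intros b. apply Nat.Div0.mod_0_l.
  - intros k b. apply Nat.Div0.mod_le.
  - intros k b s HBs Hk H1 H3 H4. unfold remainder_body. cbn [run].
    pose proof (Nat.mod_upper_bound k (S b) ltac:(lia)) as L.
    destruct (div_mod_succ k b) as [D1 D2].
    destruct (Nat.eqb_spec (s (d + 4)) 0) as [E|E].
    + destruct D1 as [D1 D1']; [lia|]. rewrite D1'.
      rewrite run_zero, run_copy by (auto; lia).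
      repeat split; [unfold upd; reg_cases..|].
      intros x Hx. now rewrite !upd_neq by lia.
    + destruct D2 as [D2 D2']; [lia|]. rewrite D2'.
      rewrite inc_min by (try lia; apply dec_bounded; auto; lia). unfold dec.
      assert (k mod S b <= k) by apply Nat.Div0.mod_le.
      repeat split; [unfold upd; reg_cases..|].
      intros x Hx. now rewrite !upd_neq by lia.
Qed.

Lemma good_euclid body d :
  0 < d -> good (body d) ->
  (forall w st, bounded st -> run w (body d) st d = st d) ->
  good (euclid body d).
Proof.
  intros Hd Hg Hp. unfold euclid.
  do 2 (apply good_seq; [auto with good|]). apply good_seq; [now apply good_loop|].
  auto with good.
Qed.

Lemma good_quotient d : 0 < d -> good (euclid quotient_body d).
Proof.
  intros Hd. apply good_euclid; auto.
  - unfold quotient_body. auto 10 with good.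
  - intros w st HB. unfold quotient_body. cbn [run].
    destruct (_ =? _).
    + rewrite inc_min, run_copy by (try lia; auto; apply bounded_upd; auto; lia).
      now rewrite !upd_neq by lia.
    + unfold dec. now rewrite upd_neq by lia.
Qed.

Lemma good_remainder d : 0 < d -> good (euclid remainder_body d).
Proof.
  intros Hd. apply good_euclid; auto.
  - unfold remainder_body. auto 10 with good.
  - intros w st HB. unfold remainder_body. cbn [run].
    destruct (_ =? _).
    + rewrite run_zero, run_copy by (auto; lia). now rewrite !upd_neq by lia.
    + rewrite inc_min by (try lia; apply dec_bounded; auto; lia).
      unfold dec. now rewrite !upd_neq by lia.
Qed.

#[local] Hint Extern 2 (good (euclid quotient_body _)) => apply good_quotient; lia : good.
#[local] Hint Extern 2 (good (euclid remainder_body _)) => apply good_remainder; lia : good.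

(** * Bounded formulas and their evaluation *)

Inductive term (V : Type) :=
  | TVar (x : V)
  | TConst (c : nat)
  | TAdd (s t : term V)
  | TMul (s t : term V)
  | TDigit (x b i : term V).

(* Bounded first-order formulas over the input word, in parametric
   higher-order abstract syntax. *)
Inductive formula (V : Type) :=
  | LLe (s t : term V)
  | LBit (bit : bool) (t : term V)
  | LAnd (f g : formula V)
  | LNot (f : formula V)
  | LEx (F : V -> formula V).

Arguments TVar {V}. Arguments TConst {V}. Arguments TAdd {V}.
Arguments TMul {V}. Arguments TDigit {V}.
Arguments LLe {V}. Arguments LBit {V}. Arguments LAnd {V}.
Arguments LNot {V}. Arguments LEx {V}.

(* Base [b + 1], so that [b] bounds the digits and the base is never zero; a
   number below [(b + 1) ^ k] encodes a sequence of [k] such digits. *)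
Definition digit (b x i : nat) : nat := (x / S b ^ i) mod S b.

Fixpoint teval (B : nat) (t : term nat) : nat :=
  match t with
  | TVar x => x
  | TConst c => min B c
  | TAdd s t => min B (teval B s + teval B t)
  | TMul s t => min B (teval B s * teval B t)
  | TDigit x b i => digit (teval B b) (teval B x) (teval B i)
  end.

Fixpoint holds (w : list bool) (B : nat) (f : formula nat) : Prop :=
  match f with
  | LLe s t => teval B s <= teval B t
  | LBit bit t => nth_error w (teval B t) = Some bit
  | LAnd f g => holds w B f /\ holds w B g
  | LNot f => ~ holds w B f
  | LEx F => exists x, x <= B /\ holds w B (F x)
  end.

(** * Related instances of a parametric formula, and their compilation *)

Section Parametricity.
Variables V1 V2 : Type.

(** For the compiler, the variables of the first instance are values and those of the second are
    register numbers; the context [G] records which register holds which value. *)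
Inductive term_rel (G : list (V1 * V2)) : term V1 -> term V2 -> Prop :=
  | rel_var x y : In (x, y) G -> term_rel G (TVar x) (TVar y)
  | rel_const c : term_rel G (TConst c) (TConst c)
  | rel_add s t s' t' : term_rel G s s' -> term_rel G t t' ->
      term_rel G (TAdd s t) (TAdd s' t')
  | rel_mul s t s' t' : term_rel G s s' -> term_rel G t t' ->
      term_rel G (TMul s t) (TMul s' t')
  | rel_digit x b i x' b' i' : term_rel G x x' -> term_rel G b b' -> term_rel G i i' ->
      term_rel G (TDigit x b i) (TDigit x' b' i').

Inductive formula_rel : list (V1 * V2) -> formula V1 -> formula V2 -> Prop :=
  | rel_le G s t s' t' : term_rel G s s' -> term_rel G t t' ->
      formula_rel G (LLe s t) (LLe s' t')
  | rel_bit G b t t' : term_rel G t t' -> formula_rel G (LBit b t) (LBit b t')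
  | rel_and G f g f' g' : formula_rel G f f' -> formula_rel G g g' ->
      formula_rel G (LAnd f g) (LAnd f' g')
  | rel_not G f f' : formula_rel G f f' -> formula_rel G (LNot f) (LNot f')
  | rel_ex G F F' : (forall x y, formula_rel ((x, y) :: G) (F x) (F' y)) ->
      formula_rel G (LEx F) (LEx F').

End Parametricity.

(* Registers: 0 and 1 hold the bound [B], 2 the truth value; a term is computed
   into register [d], using only the registers from [d] on as scratch space. *)
Fixpoint cterm (d : nat) (t : term nat) : cmd :=
  match t with
  | TVar x => copy x d (d + 1)
  | TConst c => CSeq (zero d) (Nat.iter c (fun a => CSeq a (CInc d)) CSkip)
  | TAdd s t => CSeq (cterm d s) (CSeq (cterm (d + 1) t) (addto d (d + 1)))
  | TMul s t =>
      CSeq (cterm d s) (CSeq (cterm (d + 1) t) (CSeq (zero (d + 2))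
        (CSeq (CLoop d (CSeq (copy (d + 1) (d + 3) (d + 4)) (addto (d + 2) (d + 3))))
          (addto d (d + 2)))))
  | TDigit x b i =>
      CSeq (cterm d x) (CSeq (cterm (d + 1) b) (CSeq (cterm (d + 2) i)
        (CSeq (CLoop (d + 2) (euclid quotient_body d)) (euclid remainder_body d))))
  end.

(** In the case of [LEx], register [d] runs through the candidates, [d + 1] counts those that remain
    and [d + 2] remembers a success. The body runs once before the loop because there are [B + 1]
    candidates, 0 included. *)
Fixpoint cformula (d : nat) (f : formula nat) : cmd :=
  match f with
  | LLe s t =>
      CSeq (cterm d s) (CSeq (cterm (d + 1) t) (CSeq (CLoop (d + 1) (CDec d))
        (CSeq (zero 2) (CIf d CSkip (CInc 2)))))
  | LBit bit t => CSeq (cterm d t) (CSeq (zero 2) (CIn d bit (CInc 2) CSkip))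
  | LAnd f g => CSeq (cformula d f) (CIf 2 (cformula d g) CSkip)
  | LNot f => CSeq (cformula d f) (CIf 2 (zero 2) (CInc 2))
  | LEx F =>
      let body := CSeq (cformula (d + 3) (F d))
                    (CIf 2 (CSeq (zero (d + 2)) (CInc (d + 2))) CSkip) in
      CSeq (zero d) (CSeq (zero (d + 2)) (CSeq (copy 1 (d + 1) (d + 3))
        (CSeq body (CSeq (CLoop (d + 1) (CSeq (CInc d) body))
          (CSeq (zero 2) (CIf (d + 2) (CInc 2) CSkip))))))
  end.

Definition context_ok (d : nat) (G : list (nat * nat)) : Prop :=
  forall x y, In (x, y) G -> 2 < y < d.

Definition agrees (G : list (nat * nat)) (st : store) : Prop :=
  forall x y, In (x, y) G -> st y = x.

Lemma div_pow_mod b x i : x / S b ^ i / S b = x / S b ^ S i.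
Proof. rewrite Nat.Div0.div_div. f_equal. simpl. lia. Qed.

(** The frame condition is claimed on every bounded store, even one that disagrees with the context:
    an enclosing loop must preserve its counter on all such stores to satisfy [cmd_ok]. *)
Definition cterm_spec (d : nat) (G : list (nat * nat)) (t t' : term nat) : Prop :=
  good (cterm d t') /\
  forall w st, bounded st -> 
    let st' := run w (cterm d t') st in
    (forall x, x < d -> st' x = st x) /\
    (agrees G st -> st' d = teval (st 0) t).

Lemma cterm_correct G t t' d :
  term_rel _ _ G t t' -> 3 <= d -> context_ok d G -> cterm_spec d G t t'.
Proof.
  intros H. revert d.
  induction H as [x y HG|c|s t s' t' Hs IHs Ht IHt|s t s' t' Hs IHs Ht IHt
    |x b i x' b' i' Hx IHx Hb IHb Hi IHi]; intros d Hd HG'; simpl cterm.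
  - specialize (HG' _ _ HG). split; cbn [cterm]; [auto with good|].
    intros w st HB. rewrite run_copy by (auto; lia). split.
    + intros z Hz. now rewrite !upd_neq by lia.
    + intros Ha. rewrite upd_eq. now apply Ha.
  - assert (Hg : good (CSeq (zero d) (Nat.iter c (fun a => CSeq a (CInc d)) CSkip))).
    { apply good_seq; auto with good. induction c; simpl; auto with good. }
    split; [exact Hg|]. intros w st HB.
    assert (E : run w (CSeq (zero d) (Nat.iter c (fun a => CSeq a (CInc d)) CSkip)) st
                = upd st d (min (st 0) c)).
    { clear Hg. rewrite run_seq, run_zero. induction c as [|c IH]; simpl.
      - now rewrite Nat.min_0_r.
      - rewrite IH, inc_min by (try lia; apply bounded_upd; auto; lia). store_ext. }
    simpl cterm. rewrite E. split.
    + intros z Hz. now rewrite upd_neq by lia.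
    + intros _. now rewrite upd_eq.
  - destruct (IHs d) as [G1 S1]; auto.
    destruct (IHt (d + 1)) as [G2 S2]; [lia|intros ? ? h; specialize (HG' _ _ h); lia|].
    split; [cbn [cterm]; auto with good|]. intros w st HB. cbn [cterm]. rewrite !run_seq.
    destruct (S1 w st HB) as [F1 V1]. pose proof (good_bounded w _ _ G1 HB) as B1.
    set (s1 := run w (cterm d s') st) in *.
    destruct (S2 w s1 B1) as [F2 V2]. pose proof (good_bounded w _ _ G2 B1) as B2.
    set (s2 := run w (cterm (d + 1) t') s1) in *.
    rewrite run_addto by (auto; lia). split.
    + intros z Hz. rewrite !upd_neq, F2, F1 by lia. reflexivity.
    + intros Ha. rewrite upd_eq, (F2 d), (F2 0), V1, V2, (F1 0) by
        (auto; try lia; intros u v h; rewrite F1 by (specialize (HG' _ _ h); lia); auto).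
      reflexivity.
  - destruct (IHs d) as [G1 S1]; auto.
    destruct (IHt (d + 1)) as [G2 S2]; [lia|intros ? ? h; specialize (HG' _ _ h); lia|].
    set (body := CSeq (copy (d + 1) (d + 3) (d + 4)) (addto (d + 2) (d + 3))).
    assert (Eb : forall w st, bounded st -> run w body st =
       upd (upd (upd st (d + 4) 0) (d + 3) 0) (d + 2) (min (st 0) (st (d + 2) + st (d + 1)))).
    { intros w st HB. unfold body. rewrite run_seq, run_copy by (auto; lia).
      pose proof (HB (d + 1)).
      rewrite run_addto by (try lia; repeat (apply bounded_upd;
        [lia| |unfold upd; reg_cases]); auto). store_ext. }
    assert (Gb : good body) by (unfold body; auto with good).
    assert (Gl : good (CLoop d body)).
    { apply good_loop; [lia|auto|]. intros w st HB. rewrite Eb by auto.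
      now rewrite !upd_neq by lia. }
    split; [cbn [cterm]; auto with good|]. intros w st HB. cbn [cterm]. rewrite !run_seq.
    destruct (S1 w st HB) as [F1 V1]. pose proof (good_bounded w _ _ G1 HB) as B1.
    set (s1 := run w (cterm d s') st) in *.
    destruct (S2 w s1 B1) as [F2 V2]. pose proof (good_bounded w _ _ G2 B1) as B2.
    set (s2 := run w (cterm (d + 1) t') s1) in *.
    rewrite run_zero. set (s3 := upd s2 (d + 2) 0).
    assert (B3 : bounded s3) by (apply bounded_upd; auto; lia).
    pose proof (loop_inv (fun k s => bounded s /\ s d = s3 d - k /\
      s (d + 2) = min (s3 0) (k * s3 (d + 1)) /\ s (d + 1) = s3 (d + 1) /\
      forall x, x < d -> s x = s3 x) w d body s3) as J.
    destruct J as (J1 & J2 & J3 & J4 & J5).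
    + split; auto. split; [lia|]. split; [unfold s3; rewrite upd_eq; simpl; lia|auto].
    + intros k s1' Hk (K1 & K2 & K3 & K4 & K5).
      assert (KB : bounded (dec d s1')) by (apply dec_bounded; auto; lia).
      split; [now apply good_bounded|]. rewrite Eb by auto. unfold dec. repeat split.
      * rewrite !upd_neq, upd_eq by lia. lia.
      * rewrite upd_eq, !upd_neq by lia. rewrite K3, K4, (K5 0) by lia. simpl. lia.
      * rewrite !upd_neq by lia. auto.
      * intros z Hz. rewrite !upd_neq by lia. auto.
    + fold body. set (s4 := run w (CLoop d body) s3) in *.
      rewrite run_addto by (auto; lia).
      assert (E3 : forall z, z < d + 2 -> s3 z = s2 z)
        by (intros; unfold s3; now rewrite upd_neq by lia).
      split.
      * intros z Hz. rewrite !upd_neq, J5, E3, F2, F1 by lia. reflexivity.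
      * intros Ha. rewrite upd_eq, J2, J3, (J5 0), (E3 d), (E3 0), (E3 (d + 1)) by lia.
        rewrite (F2 d), (F2 0), V1, V2, (F1 0) by
        (auto; try lia; intros u v h; rewrite F1 by (specialize (HG' _ _ h); lia); auto).
        simpl teval. lia.
  - destruct (IHx d) as [G1 S1]; auto.
    destruct (IHb (d + 1)) as [G2 S2]; [lia|intros ? ? h; specialize (HG' _ _ h); lia|].
    destruct (IHi (d + 2)) as [G3 S3]; [lia|intros ? ? h; specialize (HG' _ _ h); lia|].
    assert (Gl : good (CLoop (d + 2) (euclid quotient_body d))).
    { apply good_loop; [lia|auto with good|]. intros w st HB.
      apply run_quotient; auto; lia. }
    split; [cbn [cterm]; auto 10 with good|]. intros w st HB. cbn [cterm]. rewrite !run_seq.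
    destruct (S1 w st HB) as [F1 V1]. pose proof (good_bounded w _ _ G1 HB) as B1.
    set (s1 := run w (cterm d x') st) in *.
    destruct (S2 w s1 B1) as [F2 V2]. pose proof (good_bounded w _ _ G2 B1) as B2.
    set (s2 := run w (cterm (d + 1) b') s1) in *.
    destruct (S3 w s2 B2) as [F3 V3]. pose proof (good_bounded w _ _ G3 B2) as B3.
    set (s3 := run w (cterm (d + 2) i') s2) in *.
    pose proof (loop_inv (fun k s => bounded s /\ s (d + 2) = s3 (d + 2) - k /\
      s d = s3 d / S (s3 (d + 1)) ^ k /\ s (d + 1) = s3 (d + 1) /\
      forall x, x < d -> s x = s3 x) w (d + 2) (euclid quotient_body d) s3) as J.
    destruct J as (J1 & J2 & J3 & J4 & J5).
    + split; auto. split; [lia|]. split; [|auto]. now rewrite Nat.pow_0_r, Nat.div_1_r.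
    + intros k s Hk (K1 & K2 & K3 & K4 & K5).
      assert (KB : bounded (dec (d + 2) s)) by (apply dec_bounded; auto; lia).
      split; [apply good_bounded; auto with good|].
      destruct (run_quotient w d (dec (d + 2) s)) as [Q1 Q2]; [lia|auto|].
      rewrite Q1, !Q2 by lia. unfold dec. repeat split.
      * rewrite upd_eq. lia.
      * rewrite !upd_neq by lia. rewrite K3, K4. apply div_pow_mod.
      * rewrite !upd_neq by lia. auto.
      * intros z Hz. rewrite Q2 by lia. unfold dec. rewrite !upd_neq by lia. auto.
    + set (s4 := run w (CLoop (d + 2) (euclid quotient_body d)) s3) in *.
      destruct (run_remainder w d s4) as [Q1 Q2]; [lia|auto|].
      split.
      * intros z Hz. rewrite Q2, J5, F3, F2, F1 by lia. reflexivity.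
      * intros Ha.
        assert (A1 : agrees G s1).
        { intros u v h. rewrite F1 by (specialize (HG' _ _ h); lia). auto. }
        assert (A2 : agrees G s2).
        { intros u v h. rewrite F2 by (specialize (HG' _ _ h); lia). auto. }
        rewrite Q1, J3, J4, (F3 d), (F3 (d + 1)), (F2 d), V1, V2, V3 by (auto; lia).
        rewrite (F2 0), (F1 0) by lia. reflexivity.
Qed.

Lemma inc_2 st : bounded st -> 1 <= st 0 -> st 2 = 0 -> inc 2 st = upd st 2 1.
Proof. intros HB H E. rewrite inc_min by (auto; lia). rewrite E. f_equal. lia. Qed.

Lemma inc_neq r st x : x <> r -> inc r st x = st x.
Proof. intros H. unfold inc. destruct (_ || _); auto. now apply upd_neq. Qed.

Definition truth (P : Prop) (v : nat) : Prop := (P /\ v = 1) \/ (~ P /\ v = 0).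

Lemma truth_iff P Q v : (P <-> Q) -> truth P v -> truth Q v.
Proof. unfold truth. tauto. Qed.

Lemma reads_iff w i b : reads w i b = true <-> nth_error w i = Some b.
Proof.
  unfold reads. destruct (nth_error w i) as [[|]|]; destruct b; simpl; split; congruence.
Qed.

(** A loop on register 0 would decrement it, so an exhaustive search takes its length from the
    duplicate of the bound in register 1. The bound must be at least 1 for register 2 to be able to
    hold the value 1. *)
Definition cformula_spec (d : nat) (G : list (nat * nat)) (f f' : formula nat) : Prop :=
  good (cformula d f') /\
  forall w st, bounded st ->
    let st' := run w (cformula d f') st in
    (forall x, x < d -> x <> 2 -> st' x = st x) /\
    (st 1 = st 0 -> 1 <= st 0 -> agrees G st -> truth (holds w (st 0) f) (st' 2)).

Lemma agrees_frame d G st st' :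
  context_ok d G -> (forall x, x < d -> x <> 2 -> st' x = st x) ->
  agrees G st -> agrees G st'.
Proof.
  intros HG F Ha x y h. pose proof (HG _ _ h). rewrite F by lia. auto.
Qed.

Lemma cformula_correct G f f' d :
  formula_rel _ _ G f f' -> 3 <= d -> context_ok d G -> cformula_spec d G f f'.
Proof.
  intros H. revert d.
  induction H as [G s t s' t' Hs Ht|G b t t' Ht|G f g f' g' Hf IHf Hg IHg
    |G f f' Hf IHf|G F F' HF IHF]; intros d Hd HG.
  - destruct (cterm_correct _ _ _ d Hs) as [G1 S1]; auto.
    destruct (cterm_correct _ _ _ (d + 1) Ht) as [G2 S2];
      [lia|intros ? ? h; specialize (HG _ _ h); lia|].
    assert (Gl : good (CLoop (d + 1) (CDec d))).
    { apply good_loop; [lia|auto with good|]. intros w st _. simpl. unfold dec.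
      now rewrite upd_neq by lia. }
    split; [cbn [cformula]; auto 10 with good|]. intros w st HB. cbn [cformula].
    rewrite !run_seq.
    destruct (S1 w st HB) as [F1 V1]. pose proof (good_bounded w _ _ G1 HB) as B1.
    set (s1 := run w (cterm d s') st) in *.
    destruct (S2 w s1 B1) as [F2 V2]. pose proof (good_bounded w _ _ G2 B1) as B2.
    set (s2 := run w (cterm (d + 1) t') s1) in *.
    assert (E : run w (CLoop (d + 1) (CDec d)) s2 =
       upd (upd s2 (d + 1) 0) d (s2 d - s2 (d + 1))).
    { rewrite (loop_inv (fun k s => s =
        upd (upd s2 (d + 1) (s2 (d + 1) - k)) d (s2 d - k)) w (d + 1) (CDec d) s2).
      - store_ext.
      - store_ext.
      - intros k s0 Hk ->. cbn [run]. store_ext. }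
    rewrite E, run_zero. set (s3 := upd _ 2 0).
    assert (B3 : bounded s3).
    { unfold s3. pose proof (B2 d).
      repeat (apply bounded_upd; [lia| |unfold upd; reg_cases]). auto. }
    assert (E0 : s3 0 = st 0) by (unfold s3; rewrite !upd_neq, F2, F1 by lia; auto).
    assert (Ed : s3 d = s2 d - s2 (d + 1)) by (unfold s3; rewrite upd_neq, upd_eq by lia; auto).
    assert (F3 : forall x, x < d -> x <> 2 -> s3 x = st x).
    { intros x Hx Hx2. unfold s3. rewrite !upd_neq, F2, F1 by lia. reflexivity. }
    assert (Ed' : agrees G st -> s3 d = teval (st 0) s - teval (st 0) t).
    { intros Ha. rewrite Ed, (F2 d), V1, V2, (F1 0); auto; try lia.
      apply (agrees_frame d G st); auto. }
    cbn [run]. split.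
    + intros x Hx Hx2. destruct (_ =? _); rewrite ?inc_neq; auto.
    + intros Hm H1 Ha. rewrite Ed' by auto. unfold truth. simpl holds.
      destruct (Nat.eqb_spec (teval (st 0) s - teval (st 0) t) 0).
      * left. rewrite inc_2, upd_eq by (try (unfold s3; apply upd_eq); auto; lia). lia.
      * right. unfold s3. rewrite upd_eq. lia.
  - destruct (cterm_correct _ _ _ d Ht) as [G1 S1]; auto.
    split; [cbn [cformula]; auto 10 with good|]. intros w st HB. cbn [cformula].
    rewrite !run_seq.
    destruct (S1 w st HB) as [F1 V1]. pose proof (good_bounded w _ _ G1 HB) as B1.
    set (s1 := run w (cterm d t') st) in *.
    rewrite run_zero. cbn [run].
    assert (B2 : bounded (upd s1 2 0)) by (apply bounded_upd; auto; lia).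
    rewrite (upd_neq _ _ _ d) by lia. split.
    + intros x Hx Hx2. destruct (reads _ _ _); rewrite ?inc_neq, upd_neq by lia; auto.
    + intros Hm H1 Ha. unfold truth. simpl holds. rewrite <- reads_iff, <- V1 by auto.
      destruct (reads w (s1 d) b).
      * left. rewrite inc_2, upd_eq by (auto; rewrite upd_neq, F1 by lia; lia). auto.
      * right. rewrite upd_eq. auto.
  - destruct (IHf d) as [G1 S1]; auto. destruct (IHg d) as [G2 S2]; auto.
    split; [cbn [cformula]; auto with good|]. intros w st HB. cbn [cformula].
    rewrite run_seq.
    destruct (S1 w st HB) as [F1 V1]. pose proof (good_bounded w _ _ G1 HB) as B1.
    set (s1 := run w (cformula d f') st) in *.
    destruct (S2 w s1 B1) as [F2 V2]. cbn [run]. split.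
    + intros x Hx Hx2. destruct (_ =? _); rewrite ?F2; auto.
    + intros Hm H1 Ha. specialize (V1 Hm H1 Ha). rewrite !F1 in V2 by lia.
      specialize (V2 Hm H1 (agrees_frame _ _ _ _ HG F1 Ha)).
      simpl holds. unfold truth in *. destruct (Nat.eqb_spec (s1 2) 0); intuition lia.
  - destruct (IHf d) as [G1 S1]; auto.
    split; [cbn [cformula]; auto with good|]. intros w st HB. cbn [cformula].
    rewrite run_seq.
    destruct (S1 w st HB) as [F1 V1]. pose proof (good_bounded w _ _ G1 HB) as B1.
    set (s1 := run w (cformula d f') st) in *.
    assert (E : run w (CIf 2 (zero 2) (CInc 2)) s1 =
      if s1 2 =? 0 then inc 2 s1 else upd s1 2 0).
    { cbn [run]. now rewrite run_zero. }
    rewrite E. split.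
    + intros x Hx Hx2. destruct (_ =? _); rewrite ?inc_neq, ?upd_neq; auto.
    + intros Hm H1 Ha. specialize (V1 Hm H1 Ha). simpl holds. unfold truth in *.
      destruct (Nat.eqb_spec (s1 2) 0).
      * rewrite inc_2, upd_eq by (auto; rewrite F1 by lia; auto). intuition lia.
      * rewrite upd_eq. intuition lia.
  - assert (IH : forall x, cformula_spec (d + 3) ((x, d) :: G) (F x) (F' d)).
    { intros x. apply IHF; [lia|]. intros u v [h|h]; [inversion h; subst; lia|].
      specialize (HG _ _ h). lia. }
    assert (G1 : good (cformula (d + 3) (F' d))) by (apply (IH 0)).
    set (body := CSeq (cformula (d + 3) (F' d))
                    (CIf 2 (CSeq (zero (d + 2)) (CInc (d + 2))) CSkip)).
    assert (Gb : good body) by (unfold body; auto 10 with good).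
    (* [Q] stands for the success of an earlier candidate, as remembered in [d + 2]. *)
    assert (Hbody : forall w s, bounded s ->
      (forall x, x < d + 2 -> x <> 2 -> run w body s x = s x) /\
      (s 1 = s 0 -> 1 <= s 0 -> agrees G s -> forall Q, truth Q (s (d + 2)) ->
        truth (Q \/ holds w (s 0) (F (s d))) (run w body s (d + 2)))).
    { intros w s HB. unfold body. rewrite run_seq.
      destruct (IH (s d)) as [_ S1].
      destruct (S1 w s HB) as [F1 V1]. pose proof (good_bounded w _ _ G1 HB) as B1.
      set (s1 := run w (cformula (d + 3) (F' d)) s) in *.
      assert (E : run w (CIf 2 (CSeq (zero (d + 2)) (CInc (d + 2))) CSkip) s1 =
        if s1 2 =? 0 then s1 else upd s1 (d + 2) (min (s 0) 1)).
      { cbn [run]. destruct (_ =? _); auto.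
        rewrite run_zero, inc_min by (try lia; apply bounded_upd; auto; lia).
        rewrite (upd_neq _ _ _ 0), upd_eq, (F1 0) by lia. store_ext. }
      rewrite E. split.
      - intros x Hx Hx2. destruct (_ =? _); rewrite ?upd_neq by lia; apply F1; lia.
      - intros Hm H1 Ha Q HQ. destruct V1 as [[h1 h2]|[h1 h2]]; auto.
        { intros u v [h|h]; [now inversion h|auto]. }
        + rewrite h2. simpl. rewrite upd_eq. unfold truth. left. split; [auto|lia].
        + rewrite h2. simpl. rewrite F1 by lia. unfold truth in *. tauto. }
    assert (Gl : good (CLoop (d + 1) (CSeq (CInc d) body))).
    { apply good_loop; [lia|auto with good|]. intros w st HB. rewrite run_seq.
      cbn [run]. destruct (Hbody w (inc d st)) as [Fb _]; [now apply inc_bounded|].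
      rewrite Fb, inc_neq by lia. reflexivity. }
    split; [cbn [cformula]; fold body; auto 15 with good|].
    intros w st HB. cbn [cformula]. fold body. rewrite !run_seq, !run_zero.
    assert (B0 : bounded (upd (upd st d 0) (d + 2) 0))
      by (repeat (apply bounded_upd; [lia| |lia]); auto).
    rewrite run_copy by (auto; lia).
    set (s1 := upd _ (d + 1) _).
    assert (E1 : s1 (d + 1) = st 1)
      by (unfold s1; rewrite upd_eq, !upd_neq by lia; reflexivity).
    assert (F1 : forall x, x < d -> s1 x = st x)
      by (intros; unfold s1; now rewrite !upd_neq by lia).
    assert (B1 : bounded s1).
    { unfold s1. pose proof (HB 1).
      repeat (apply bounded_upd; [lia| |unfold upd; reg_cases]); auto. }
    destruct (Hbody w s1 B1) as [F2 V2].
    pose proof (good_bounded w _ _ Gb B1) as B2.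
    set (s2 := run w body s1) in *.
    pose proof (loop_inv (fun k s => bounded s /\ s d = min (st 0) k /\
      (forall x, x < d -> x <> 2 -> s x = st x) /\
      (st 1 = st 0 -> 1 <= st 0 -> agrees G st ->
       truth (exists x, x <= k /\ x <= st 0 /\ holds w (st 0) (F x)) (s (d + 2))))
      w (d + 1) (CSeq (CInc d) body) s2) as J.
    destruct J as (J1 & J2 & J3 & J4).
    + split; auto. split; [|split].
      * rewrite F2 by lia. unfold s1. rewrite !upd_neq, upd_eq by lia. lia.
      * intros x Hx Hx2. rewrite F2, F1 by lia. reflexivity.
      * intros Hm H1 Ha. rewrite !(F1 0), (F1 1) in V2 by lia.
        assert (Ed : s1 d = 0)
          by (unfold s1; rewrite !upd_neq, upd_eq by lia; reflexivity).
        rewrite Ed in V2.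
        eapply truth_iff; [|apply (V2 Hm H1) with (Q := False)].
        -- split; [intros [[]|h]; exists 0; split; [lia|split; [lia|auto]]|].
           intros (x & Hx & _ & Hh). right. replace x with 0 in Hh by lia. auto.
        -- apply (agrees_frame d G st); auto.
        -- right. split; [tauto|]. unfold s1. rewrite upd_neq, upd_neq, upd_eq by lia.
           reflexivity.
    + intros k s Hk (K1 & K2 & K3 & K4).
      assert (Bd : bounded (dec (d + 1) s)) by (apply dec_bounded; auto; lia).
      rewrite run_seq. cbn [run].
      assert (Ei : inc d (dec (d + 1) s) =
        upd (upd s (d + 1) (pred (s (d + 1)))) d (min (st 0) (S k))).
      { rewrite inc_min by (auto; lia). unfold dec. rewrite !(upd_neq _ _ _ 0) by lia.
        rewrite (upd_neq _ _ _ d), K2, (K3 0) by lia. f_equal. lia. }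
      assert (Bi : bounded (inc d (dec (d + 1) s))) by (now apply inc_bounded).
      rewrite Ei in *. clear Ei.
      set (s' := upd (upd s (d + 1) (pred (s (d + 1)))) d (min (st 0) (S k))) in *.
      assert (Fi : forall x, x < d -> x <> 2 -> s' x = st x)
        by (intros; unfold s'; rewrite !upd_neq by lia; auto).
      destruct (Hbody w s' Bi) as [F3 V3].
      split; [now apply good_bounded|].
      split; [rewrite F3 by lia; unfold s'; apply upd_eq|]. split.
      * intros x Hx Hx2. rewrite F3, Fi by lia. reflexivity.
      * intros Hm H1 Ha. rewrite !(Fi 0), (Fi 1) in V3 by lia.
        assert (Ed : s' d = min (st 0) (S k)) by (unfold s'; apply upd_eq).
        rewrite Ed in V3.
        eapply truth_iff; [|apply (V3 Hm H1) with
          (Q := exists x, x <= k /\ x <= st 0 /\ holds w (st 0) (F x))].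
        -- split.
           ++ intros [(x & h1 & h2 & h3)|h]; [exists x; split; [lia|auto]|].
              exists (min (st 0) (S k)). split; [lia|]. split; [lia|auto].
           ++ intros (x & h1 & h2 & h3). destruct (le_lt_dec x k).
              ** left. exists x. auto.
              ** right. replace (min (st 0) (S k)) with x by lia. auto.
        -- apply (agrees_frame d G st); auto.
        -- unfold s'. rewrite !upd_neq by lia. apply K4; auto.
    + set (s3 := run w (CLoop (d + 1) _) s2) in *.
      assert (B3 : bounded (upd s3 2 0)) by (apply bounded_upd; auto; lia).
      assert (E2 : s2 (d + 1) = st 1) by (rewrite F2, E1 by lia; reflexivity).
      rewrite E2 in *. cbn [run]. rewrite (upd_neq _ _ _ (d + 2)) by lia. split.
      * intros x Hx Hx2. destruct (_ =? _); rewrite ?inc_neq, ?upd_neq by lia; auto.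
      * intros Hm H1 Ha.
        assert (J5 : truth (holds w (st 0) (LEx F)) (s3 (d + 2))).
        { eapply truth_iff; [|apply J4; auto]. simpl. rewrite Hm.
          split; intros (x & h); exists x; tauto. }
        unfold truth in *. destruct J5 as [[h1 h2]|[h1 h2]]; rewrite h2; cbn [Nat.eqb].
        -- left. rewrite inc_2, upd_eq; auto. rewrite upd_neq, J3 by lia. lia.
        -- right. now rewrite upd_eq.
Qed.

(** * Choice of the bounds *)

Definition inc_bound : cmd := CSeq (CInc 0) (CInc 1).

Definition add_bound (r : nat) : cmd := CLoop r inc_bound.

Definition double_bound : cmd := CSeq (copy 1 5 6) (add_bound 5).

Definition square_bound : cmd :=
  CSeq (copy 1 5 8) (CSeq (copy 1 6 8) (CLoop 5 (CSeq (copy 6 7 8) (add_bound 7)))).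

Definition mirrored (st : store) : Prop := bounded st /\ st 1 = st 0.

(** Registers 5 to 8 are the scratch space of the commands that enlarge the bound. *)
Definition kept (x : nat) : Prop := 2 < x /\ ~ 5 <= x <= 8.

Definition bound_spec (c : cmd) (f : nat -> nat) : Prop :=
  good c /\
  forall w st, mirrored st ->
    st 0 <= f (st 0) /\ mirrored (run w c st) /\ run w c st 0 = f (st 0) /\
    forall x, kept x -> run w c st x = st x.

Definition set_bound (v : nat) (st : store) : store := upd (upd st 0 v) 1 v.

Lemma good_inc_bound : good inc_bound.
Proof. unfold inc_bound. auto with good. Qed.

Lemma run_inc_bound w st :
  mirrored st -> run w inc_bound st = set_bound (S (st 0)) st.
Proof.
  intros [HB E]. unfold inc_bound, set_bound. cbn [run]. unfold inc at 2. cbn [Nat.eqb orb].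
  unfold inc. cbn [Nat.eqb orb]. rewrite upd_eq, upd_neq, E by lia.
  destruct (Nat.ltb_spec (st 0) (S (st 0))); [reflexivity|lia].
Qed.

Lemma set_bound_mirrored v st :
  bounded st -> st 0 <= v -> mirrored (set_bound v st).
Proof.
  intros HB Hv. split; [|reflexivity]. intros x. unfold set_bound, upd.
  simpl. specialize (HB x). destruct (x =? 1), (x =? 0); lia.
Qed.

Lemma run_add_bound w r st :
  1 < r -> mirrored st ->
  run w (add_bound r) st = upd (set_bound (st 0 + st r) st) r 0.
Proof.
  intros Hr HM. unfold add_bound.
  assert (H1 : bounded st) by apply HM. assert (H2 : st 1 = st 0) by apply HM.
  rewrite (loop_inv (fun k s => k <= st r ->
    s = upd (set_bound (st 0 + k) st) r (st r - k)) w r inc_bound st).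
  - now rewrite Nat.sub_diag.
  - intros _. unfold set_bound. store_ext.
  - intros k s Hk E Hk'. rewrite E by lia. rewrite run_inc_bound.
    + unfold set_bound. store_ext.
    + split; [|unfold dec, set_bound, upd; reg_cases].
      unfold dec. pose proof (H1 r). do 2 (apply bounded_upd; [lia| |unfold set_bound, upd; reg_cases]).
      apply set_bound_mirrored; auto; lia.
  - lia.
Qed.

Lemma good_add_bound r : 1 < r -> good (add_bound r).
Proof.
  intros Hr. apply good_loop; auto using good_inc_bound; [lia|].
  intros w st HB. unfold inc_bound. cbn [run]. now rewrite !inc_neq by lia.
Qed.

#[local] Hint Resolve good_inc_bound : good.
#[local] Hint Extern 2 (good (add_bound _)) => apply good_add_bound; lia : good.

Lemma good_mirrored w c st :
  good c -> mirrored st -> run w c st 1 = run w c st 0 -> mirrored (run w c st).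
Proof. intros Hg [HB _] E. split; auto. now apply good_bounded. Qed.

Lemma run_copy_mirrored w x r t st :
  0 < x -> 1 < r -> 1 < t -> x <> r -> x <> t -> r <> t -> mirrored st ->
  mirrored (run w (copy x r t) st) /\
  run w (copy x r t) st = upd (upd st t 0) r (st x).
Proof.
  intros ? ? ? ? ? ? HM.
  assert (E : run w (copy x r t) st = upd (upd st t 0) r (st x))
    by (apply run_copy; try lia; apply HM).
  split; auto. apply good_mirrored; auto with good.
  rewrite E, !upd_neq by lia. apply HM.
Qed.

Lemma double_bound_spec : bound_spec double_bound (fun v => 2 * v).
Proof.
  split; [unfold double_bound; auto with good|]. intros w st HM. split; [lia|].
  unfold double_bound. rewrite run_seq.
  destruct (run_copy_mirrored w 1 5 6 st) as [M1 E]; try lia; auto.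
  pose proof (proj2 M1) as M1'.
  split; [apply good_mirrored; auto with good|]; rewrite run_add_bound by (auto; lia);
    rewrite E; unfold set_bound.
  - unfold upd; simpl; lia.
  - split; [unfold upd; simpl; rewrite (proj2 HM); lia|].
    intros x [Hx1 Hx2]. now rewrite !upd_neq by lia.
Qed.

Lemma square_bound_spec : bound_spec square_bound (fun v => v + v * v).
Proof.
  set (body := CSeq (copy 6 7 8) (add_bound 7)).
  assert (Gb : good body) by (unfold body; auto with good).
  assert (E : forall w st, mirrored st -> mirrored (run w body st) /\
    run w body st 0 = st 0 + st 6 /\
    forall x, 1 < x -> x < 7 \/ kept x -> run w body st x = st x).
  { intros w st HM. unfold body. rewrite run_seq.
    destruct (run_copy_mirrored w 6 7 8 st) as [M1 E]; try lia; auto.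
    rewrite run_add_bound by (auto; lia).
    rewrite E. unfold set_bound. split; [|split].
    - pose proof (good_bounded w (add_bound 7) (run w (copy 6 7 8) st)) as h.
      rewrite run_add_bound in h by (auto; lia). rewrite E in h. split.
      + apply h; auto with good. rewrite <- E. apply M1.
      + unfold upd. simpl. reflexivity.
    - unfold upd. simpl. reflexivity.
    - unfold kept. intros x Hx1 Hx2. now rewrite !upd_neq by lia. }
  assert (Gl : good (CLoop 5 body)).
  (* The facts in [E] assume [mirrored], but the counter must be preserved on every bounded store,
     so the body is examined anew. *)
  { apply good_loop; [lia|auto|]. intros w st HB. unfold body. rewrite run_seq.
    rewrite run_copy by (auto; lia). unfold add_bound.
    pose proof (loop_inv (fun k s => s 5 = st 5) w 7 inc_bound) as h.
    cbv beta in h. rewrite h; [reflexivity|now rewrite !upd_neq by lia|].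
    - intros k s _ Hs. unfold inc_bound. cbn [run]. rewrite !inc_neq by lia.
      unfold dec. rewrite upd_neq; auto; lia. }
  split; [unfold square_bound; fold body; auto with good|]. intros w st HM. split; [lia|].
  unfold square_bound. fold body. rewrite !run_seq.
  destruct (run_copy_mirrored w 1 5 8 st) as [M1 E1]; try lia; auto.
  set (s1 := run w (copy 1 5 8) st) in *.
  destruct (run_copy_mirrored w 1 6 8 s1) as [M2 E2]; try lia; auto.
  set (s2 := run w (copy 1 6 8) s1) in *.
  assert (V0 : s2 0 = st 0) by (rewrite E2, !upd_neq, E1, !upd_neq by lia; reflexivity).
  assert (V5 : s2 5 = st 0)
    by (rewrite E2, !upd_neq, E1, upd_eq by lia; apply HM).
  assert (V6 : s2 6 = st 0)
    by (rewrite E2, upd_eq, E1, !upd_neq by lia; apply HM).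
  assert (Vk : forall x, kept x -> s2 x = st x).
  { intros x [Hx1 Hx2]. rewrite E2, !upd_neq, E1, !upd_neq by lia. reflexivity. }
  pose proof (loop_inv (fun k s => mirrored s /\ s 0 = st 0 + k * st 0 /\ s 6 = st 0 /\
    forall x, kept x -> s x = st x) w 5 body s2) as J.
  destruct J as (J1 & J2 & J3 & J4).
  - rewrite V0, V6. repeat split; auto; try lia; apply M2.
  - intros k s Hk (K1 & K2 & K3 & K4).
    assert (Md : mirrored (dec 5 s)).
    { split; [apply dec_bounded; [lia|apply K1]|].
      unfold dec. rewrite !upd_neq by lia. apply K1. }
    destruct (E w _ Md) as (L1 & L2 & L3). split; auto.
    rewrite L2, (L3 6) by lia. unfold dec. rewrite !upd_neq by lia.
    rewrite K2, K3. split; [lia|]. split; auto.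
    intros x Hx. rewrite L3 by (unfold kept in *; intuition lia).
    unfold dec. rewrite upd_neq by (unfold kept in *; lia). auto.
  - rewrite V5 in *. auto.
Qed.

Lemma bound_spec_seq c c' f f' :
  bound_spec c f -> bound_spec c' f' -> bound_spec (CSeq c c') (fun v => f' (f v)).
Proof.
  intros [G1 S1] [G2 S2]. split; [auto with good|]. intros w st HM. rewrite run_seq.
  destruct (S1 w st HM) as (L1 & M1 & E1 & F1).
  destruct (S2 w _ M1) as (L2 & M2 & E2 & F2). rewrite E1 in *.
  split; [lia|]. split; [auto|]. split; [auto|].
  intros x Hx. rewrite F2, F1; auto.
Qed.

Lemma inc_bound_spec : bound_spec inc_bound S.
Proof.
  split; [auto with good|]. intros w st HM. split; [lia|].
  rewrite run_inc_bound by auto. split; [|split; [reflexivity|]].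
  - apply set_bound_mirrored; [apply HM|lia].
  - intros x [Hx1 Hx2]. unfold set_bound. now rewrite !upd_neq by lia.
Qed.

Lemma good_double_loop r : kept r -> good (CLoop r double_bound).
Proof.
  intros [Hr1 Hr2]. apply good_loop; [lia|apply double_bound_spec|].
  intros w st HB. unfold double_bound. rewrite run_seq.
  rewrite run_copy by (auto; lia). unfold add_bound.
  pose proof (loop_inv (fun k s => s r = st r) w 5 inc_bound) as h.
  cbv beta in h. rewrite h; [reflexivity|now rewrite !upd_neq by lia|].
  - intros k s _ Hs. unfold inc_bound. cbn [run]. rewrite !inc_neq by lia.
    unfold dec. rewrite upd_neq; auto; lia.
Qed.

Lemma run_double_loop w r st :
  kept r -> mirrored st ->
  let st' := run w (CLoop r double_bound) st in
  mirrored st' /\ st' 0 = 2 ^ st r * st 0 /\ forall x, kept x -> x <> r -> st' x = st x.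
Proof.
  intros Hr HM.
  apply (loop_inv (fun k s => mirrored s /\ s 0 = 2 ^ k * st 0 /\
     forall x, kept x -> x <> r -> s x = st x)).
  - split; [auto|]. split; [simpl; lia|auto].
  - intros k s Hk (K1 & K2 & K3).
    assert (Md : mirrored (dec r s)).
    { split; [apply dec_bounded; [unfold kept in Hr; lia|apply K1]|].
      unfold dec. rewrite !upd_neq by (unfold kept in Hr; lia). apply K1. }
    destruct (proj2 double_bound_spec w _ Md) as (_ & M & E & F).
    split; auto. rewrite E. unfold dec. rewrite upd_neq by (unfold kept in Hr; lia).
    rewrite K2. split; [simpl; lia|].
    intros x Hx Hxr. rewrite F by auto. unfold dec. rewrite upd_neq; auto.
Qed.

Definition grow (v : nat) : nat := v + v * v.

(** [dim N] bounds positions and lengths of walks, [base N] bounds states and the numbers in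
    constraints, and [bound N] the codes of walks and of the table. Register 0 can only be enlarged,
    by doubling what it already holds; this explains the factor [iterations N] in [base N] and the
    factor [base N] in [bound N]. *)
Definition dim (N : nat) : nat := grow (S (S N)).
Definition iterations (N : nat) : nat := grow (grow (grow (dim N))).
Definition base (N : nat) : nat := 2 ^ dim N * iterations N.
Definition bound (N : nat) : nat := 2 ^ iterations N * base N.

Definition setup_dim : cmd := CSeq inc_bound (CSeq inc_bound square_bound).
Definition setup_iterations : cmd := CSeq square_bound (CSeq square_bound square_bound).

(* Leaves [dim N], [base N] and [bound N] in registers 3, 4 and 0. *)
Definition setup : cmd :=
  CSeq setup_dim (CSeq (copy 1 3 8) (CSeq setup_iterations (CSeq (copy 1 9 8)
    (CSeq (copy 3 10 8) (CSeq (CLoop 10 double_bound) (CSeq (copy 1 4 8)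
      (CLoop 9 double_bound))))))).

Lemma setup_correct :
  good setup /\ forall w,
  let N := length w in let st := run w setup (init_store w) in
  mirrored st /\ st 0 = bound N /\ st 3 = dim N /\ st 4 = base N.
Proof.
  assert (H1 : bound_spec setup_dim dim).
  { exact (bound_spec_seq _ _ _ _ inc_bound_spec
      (bound_spec_seq _ _ _ _ inc_bound_spec square_bound_spec)). }
  assert (H2 : bound_spec setup_iterations (fun v => grow (grow (grow v)))).
  { exact (bound_spec_seq _ _ _ _ square_bound_spec
      (bound_spec_seq _ _ _ _ square_bound_spec square_bound_spec)). }
  assert (Hk : forall x, x = 3 \/ x = 4 \/ x = 9 \/ x = 10 -> kept x) by (unfold kept; lia).
  split.
  { unfold setup. apply good_seq; [apply H1|]. apply good_seq; [auto with good|].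
    apply good_seq; [apply H2|]. do 2 (apply good_seq; [auto with good|]).
    apply good_seq; [apply good_double_loop; auto|]. apply good_seq; [auto with good|].
    apply good_double_loop; auto. }
  intros w N. unfold setup. rewrite !run_seq.
  assert (M0 : mirrored (init_store w)).
  { split; [|reflexivity]. intros r. unfold init_store. simpl. destruct (r <? 2); lia. }
  destruct (proj2 H1 w _ M0) as (_ & M1 & E1 & _).
  change (init_store w 0) with N in E1. set (s1 := run w setup_dim _) in *.
  destruct (run_copy_mirrored w 1 3 8 s1) as [M2 E2]; try lia; auto.
  set (s2 := run w (copy 1 3 8) _) in *.
  destruct (proj2 H2 w _ M2) as (_ & M3 & E3 & F3). set (s3 := run w setup_iterations _) in *.
  destruct (run_copy_mirrored w 1 9 8 s3) as [M4 E4]; try lia; auto.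
  set (s4 := run w (copy 1 9 8) _) in *.
  destruct (run_copy_mirrored w 3 10 8 s4) as [M5 E5]; try lia; auto.
  set (s5 := run w (copy 3 10 8) _) in *.
  destruct (run_double_loop w 10 s5) as (M6 & E6 & F6); auto.
  set (s6 := run w (CLoop 10 double_bound) _) in *.
  destruct (run_copy_mirrored w 1 4 8 s6) as [M7 E7]; try lia; auto.
  set (s7 := run w (copy 1 4 8) _) in *.
  destruct (run_double_loop w 9 s7) as (M8 & E8 & F8); auto.
  set (s8 := run w (CLoop 9 double_bound) _) in *.
  assert (A2 : s2 3 = dim N /\ s2 0 = dim N).
  { rewrite E2, upd_eq, !upd_neq by lia. rewrite (proj2 M1). auto. }
  assert (A3 : s3 3 = dim N /\ s3 0 = iterations N).
  { rewrite F3, E3 by auto. split; [tauto|]. rewrite (proj2 A2). reflexivity. }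
  assert (A5 : s5 3 = dim N /\ s5 0 = iterations N /\ s5 10 = dim N /\ s5 9 = iterations N).
  { rewrite E5, upd_eq, !upd_neq by lia.
    rewrite E4, upd_eq, !upd_neq by lia. rewrite (proj2 M3). tauto. }
  assert (A6 : s6 3 = dim N /\ s6 0 = base N /\ s6 9 = iterations N).
  { rewrite E6, !F6 by (auto; lia). destruct A5 as (a & b & c & d).
    rewrite a, b, c, d. auto. }
  assert (A7 : s7 3 = dim N /\ s7 0 = base N /\ s7 9 = iterations N /\ s7 4 = base N).
  { rewrite E7, upd_eq, !upd_neq by lia. rewrite (proj2 M6). tauto. }
  split; [auto|]. rewrite E8, !F8 by (auto; lia). destruct A7 as (a & b & c & d).
  rewrite a, b, c, d. auto.
Qed.

Lemma grow_le v : 2 <= v -> grow v <= v ^ 3.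
Proof. unfold grow. intros. simpl. nia. Qed.

Lemma grow_ge v : v <= grow v.
Proof. unfold grow. lia. Qed.

Lemma grow_pow v m k : 2 <= v -> v <= m ^ k -> grow v <= m ^ (k * 3).
Proof.
  intros H1 H2. rewrite Nat.pow_mul_r. etransitivity; [now apply grow_le|].
  now apply Nat.pow_le_mono_l.
Qed.

Lemma iterations_le N : 1 <= N -> iterations N <= (N + 1) ^ 162.
Proof.
  intros HN. unfold iterations, dim.
  pose proof (grow_ge (S (S N))). pose proof (grow_ge (grow (S (S N)))).
  pose proof (grow_ge (grow (grow (S (S N))))).
  (* [S (S N)] is at most [(N + 1) ^ 2], and each of the four applications of [grow] triples the
     exponent. *)
  change 162 with (2 * 3 * 3 * 3 * 3).
  repeat (apply grow_pow; [lia|]). simpl. nia.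
Qed.

Lemma dim_le_iterations N : dim N <= iterations N.
Proof.
  unfold iterations. pose proof (grow_ge (dim N)). pose proof (grow_ge (grow (dim N))).
  pose proof (grow_ge (grow (grow (dim N)))). lia.
Qed.

Lemma dim_ge N : 3 * N + 6 <= dim N.
Proof. unfold dim, grow. nia. Qed.

(** Each of the three factors of [bound N] is at most [2 ^ iterations N]; a fourth such factor
    absorbs the [+ 2]. *)
Lemma bound_le N : bound N + 2 <= 2 ^ (4 * iterations N).
Proof.
  unfold bound, base. pose proof (dim_le_iterations N). pose proof (dim_ge N).
  set (p := iterations N) in *.
  assert (Hp : p <= 2 ^ p) by (pose proof (Nat.pow_gt_lin_r 2 p); lia).
  assert (2 ^ dim N <= 2 ^ p) by (apply Nat.pow_le_mono_r; lia).
  replace (4 * p) with (p + (p + (p + p))) by lia. rewrite !Nat.pow_add_r.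
  assert (2 <= 2 ^ p).
  { change 2 with (2 ^ 1) at 1. apply Nat.pow_le_mono_r; lia. }
  set (e := 2 ^ p) in *.
  assert (2 ^ dim N * p <= e * e) by (apply Nat.mul_le_mono; auto).
  assert (e * (2 ^ dim N * p) <= e * (e * e)) by (apply Nat.mul_le_mono_l; auto).
  assert (2 <= e * (e * e)) by nia. nia.
Qed.

(** The machine is compiled once, from the instance of [F] whose free variables are the registers 3
    and 4 filled by [setup]. Parametricity relates this instance to the one at the values [dim N]
    and [base N], whatever the input length, so a single machine serves all inputs. *)
Theorem formula_decides
  (F : forall V : Type, V -> V -> formula V)
  (F_parametric : forall V1 V2 x1 x2 y1 y2,
     formula_rel V1 V2 [(x1, x2); (y1, y2)] (F V1 x1 y1) (F V2 x2 y2)) :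
  exists (M : TM) (c : nat), forall (w : list bool) (P : Prop),
    1 <= length w ->
    (holds w (bound (length w))
       (F nat (dim (length w)) (base (length w))) <-> P) ->
    decides_within M w (2 ^ ((length w + 1) ^ c)) P.
Proof.
  set (f := cformula 5 (F nat 3 4)). set (c := CSeq setup f).
  assert (Hspec : forall D b, cformula_spec 5 [(D, 3); (b, 4)] (F nat D b) (F nat 3 4)).
  { intros D b. apply cformula_correct; auto; try lia.
    intros x y [H|[H|[]]]; inversion H; lia. }
  destruct setup_correct as [Gs Hs].
  assert (Gf : good f) by apply (Hspec 0 0).
  destruct (good_seq _ _ Gs Gf) as [R0 HR]. set (R := max 3 R0).
  set (e := degree c + 3).
  (* The running time is at most [2 ^ (4 * iterations N * e)], where [iterations N] is at most
     [(N + 1) ^ 162] and [4 * e] is at most [(N + 1) ^ (4 * e)]. *)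
  exists (machine (code c 2) R), (162 + 4 * e). intros w P HN HP.
  set (N := length w) in *.
  destruct (Hs w) as (M & E0 & E3 & E4). fold N in E0, E3, E4.
  assert (Hb : 1 <= bound N).
  { unfold bound, base. pose proof (dim_le_iterations N). pose proof (dim_ge N).
    
    enough (2 ^ iterations N * (2 ^ dim N * iterations N) <> 0) by lia.
    repeat (apply Nat.neq_mul_0; split); try apply Nat.pow_nonzero; lia. }
  destruct (Hspec (dim N) (base N)) as [_ H]. unfold R.
  destruct (H w _ (proj1 M)) as [F1 V1].
  assert (T : truth P (run w c (init_store w) 2)).
  { unfold c. rewrite run_seq. eapply truth_iff; [|apply V1].
    - rewrite E0. exact HP.
    - apply M.
    - now rewrite E0.
    - intros x y [h|[h|[]]]; inversion h; subst; auto. }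
  apply cmd_decides; [lia|lia|apply (cmd_ok_mono R0); [lia|exact HR]| |].
  - unfold truth in T. intuition lia.
  - assert (EB : run w c (init_store w) 0 = bound N).
    { unfold c. rewrite run_seq, F1 by lia. auto. }
    rewrite EB.
    pose proof (cost_poly c (bound N)) as Hc.
    transitivity ((bound N + 2) ^ e).
    { unfold e. rewrite Nat.pow_add_r.
      change ((bound N + 2) ^ 3) with ((bound N + 2) * ((bound N + 2) * ((bound N + 2) * 1))).
      assert (1 <= (bound N + 2) ^ degree c)
        by (pose proof (Nat.pow_nonzero (bound N + 2) (degree c)); lia).
      set (u := (bound N + 2) ^ degree c) in *. set (v := bound N + 2) in *.
      assert (cost c (bound N) + 2 <= u * v) by nia.
      assert (2 * bound N + 4 <= v * v) by nia.
      replace (u * (v * (v * (v * 1)))) with ((u * v) * (v * v)) by lia.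
      apply Nat.mul_le_mono; auto. }
    transitivity ((2 ^ (4 * iterations N)) ^ e).
    { apply Nat.pow_le_mono_l, bound_le. }
    rewrite <- Nat.pow_mul_r. apply Nat.pow_le_mono_r; [lia|].
    rewrite Nat.pow_add_r.
    pose proof (iterations_le N HN) as Hit.
    assert (He : 4 * e <= (N + 1) ^ (4 * e)).
    { transitivity (2 ^ (4 * e)); [pose proof (Nat.pow_gt_lin_r 2 (4 * e)); lia|].
      apply Nat.pow_le_mono_l. lia. }
    replace (4 * iterations N * e) with (iterations N * (4 * e)) by lia.
    apply Nat.mul_le_mono; auto.
Qed.

(** * Walks in weighted graphs *)

Section Graph.
Variable edges : list (nat * nat).

Definition edge (u v : nat) : Prop := In (u, v) edges.

(* The list of the vertices visited by a walk excludes its last vertex. *)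
Inductive walk : nat -> list nat -> nat -> Prop :=
  | walk_nil a : walk a [] a
  | walk_cons a b p z : edge a b -> walk b p z -> walk a (a :: p) z.

Definition path (pi : nat -> nat) : Prop := forall i, edge (pi i) (pi (S i)).

Definition prefix (pi : nat -> nat) (k : nat) : list nat := map pi (seq 0 k).

Lemma prefix_S pi k : prefix pi (S k) = prefix pi k ++ [pi k].
Proof. unfold prefix. now rewrite seq_S, map_app. Qed.

Lemma prefix_length pi k : length (prefix pi k) = k.
Proof. unfold prefix. now rewrite length_map, length_seq. Qed.

Lemma prefix_cons pi k : prefix pi (S k) = pi 0 :: prefix (fun i => pi (S i)) k.
Proof. unfold prefix. simpl. now rewrite <- seq_shift, map_map. Qed.

Lemma walk_app a p x q z : walk a p x -> walk x q z -> walk a (p ++ q) z.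
Proof. induction 1; simpl; auto. intros. econstructor; eauto. Qed.

Lemma walk_split a p q z : walk a (p ++ q) z -> exists x, walk a p x /\ walk x q z.
Proof.
  revert a; induction p as [|b p IH]; simpl; intros a H.
  - exists a. split; [constructor|auto].
  - inversion H; subst. destruct (IH _ H5) as (x & H1 & H2).
    exists x. split; auto. econstructor; eauto.
Qed.

Lemma walk_head a x p z : walk a (x :: p) z -> a = x.
Proof. now inversion 1. Qed.

Lemma walk_split_at a p x q z :
  walk a (p ++ x :: q) z -> walk a p x /\ walk x (x :: q) z.
Proof.
  intros H. apply walk_split in H as (y & H1 & H2).
  pose proof (walk_head _ _ _ _ H2). now subst.
Qed.

Lemma walk_prefix pi k : path pi -> walk (pi 0) (prefix pi k) (pi k).
Proof.
  intros H. induction k as [|k IH]; [constructor|]. rewrite prefix_S.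
  eapply walk_app; [exact IH|]. econstructor; [apply H|constructor].
Qed.

Lemma walk_sources a p z : walk a p z -> incl p (map fst edges).
Proof.
  induction 1 as [|a b p z He _ IH]; [easy|]. intros x [<-|Hx]; auto.
  change a with (fst (a, b)). now apply in_map.
Qed.

(** Every listed vertex is the source of an edge, so among the first [length edges + 1] of them one
    is repeated. Counting edges instead of states is essential: the number of states is written in
    binary and may be exponential in the input length. *)
Lemma long_walk_cycle a p z :
  walk a p z -> length edges < length p ->
  exists p1 x p2 p3, p = p1 ++ (x :: p2) ++ x :: p3 /\
    length p1 + length (x :: p2) <= length edges.
Proof.
  intros H Hl. set (q := firstn (S (length edges)) p).
  assert (Hq : length q = S (length edges)) by (apply firstn_length_le; lia).
  assert (ND : ~ NoDup q).
  { intros ND. pose proof (NoDup_incl_length (l' := map fst edges) ND) as E.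
    rewrite length_map in E. enough (length q <= length edges) by lia. apply E.
    intros x Hx. apply (walk_sources _ _ _ H).
    rewrite <- (firstn_skipn (S (length edges)) p). apply in_or_app. now left. }
  apply not_NoDup in ND; [|intros x y; apply classic].
  destruct ND as (x & p1 & p2 & p3 & E).
  exists p1, x, p2, (p3 ++ skipn (S (length edges)) p). split.
  - rewrite <- (firstn_skipn (S (length edges)) p) at 1. fold q. rewrite E.
    rewrite <- app_assoc. simpl. now rewrite <- app_assoc.
  - rewrite E, !length_app in Hq. simpl in *. rewrite length_app in Hq. simpl in Hq. lia.
Qed.

Lemma walk_cut a p1 x p2 p3 z :
  walk a (p1 ++ (x :: p2) ++ x :: p3) z ->
  walk a p1 x /\ walk x (x :: p2) x /\ walk x (x :: p3) z.
Proof.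
  intros H. simpl in H. apply walk_split_at in H as [H1 H2].
  change (x :: p2 ++ x :: p3) with ((x :: p2) ++ x :: p3) in H2.
  apply walk_split_at in H2. tauto.
Qed.

Lemma walk_shorten a p z :
  walk a p z -> exists q, walk a q z /\ length q <= length edges.
Proof.
  remember (length p) as l eqn:El. revert p El.
  induction l as [l IH] using lt_wf_ind. intros p -> H.
  destruct (le_lt_dec (length p) (length edges)) as [|Hl]; [eauto|].
  destruct (long_walk_cycle _ _ _ H Hl) as (p1 & x & p2 & p3 & -> & _).
  apply walk_cut in H as (H1 & H2 & H3).
  eapply IH; [|reflexivity|eapply walk_app; eauto].
  rewrite !length_app. simpl. lia.
Qed.

(** * Weighted walks: lassos that avoid satisfying until, and walks that satisfy it *)

Section Weighted.
Variable wt : nat -> Z.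
Open Scope Z_scope.

Fixpoint sum (p : list nat) : Z :=
  match p with [] => 0 | a :: p => wt a + sum p end.

Lemma sum_app p q : sum (p ++ q) = sum p + sum q.
Proof. induction p; simpl; lia. Qed.

(** Dependent choice along an invariant that relates the current vertex to the weight accumulated so
    far. *)
Lemma exists_path (I : nat -> Z -> Prop) s c :
  (forall x c, I x c -> exists y, edge x y /\ I y (c + wt x)) -> I s c ->
  exists pi, pi 0%nat = s /\ path pi /\ forall k, I (pi k) (c + sum (prefix pi k)).
Proof.
  intros Hstep H0.
  assert (Hf : forall xc : nat * Z, exists y,
    I (fst xc) (snd xc) -> edge (fst xc) y /\ I y (snd xc + wt (fst xc))).
  { intros [x d]. simpl. destruct (classic (I x d)) as [H|H].
    - destruct (Hstep x d H) as [y Hy]. now exists y.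
    - exists 0%nat. tauto. }
  destruct (ClassicalEpsilon.choice _ Hf) as [f F].
  set (nx := fun xc : nat * Z => (f xc, snd xc + wt (fst xc))).
  set (cfg := fun k => Nat.iter k nx (s, c)).
  set (pi := fun k => fst (cfg k)).
  assert (Hc : forall k, snd (cfg k) = c + sum (prefix pi k) /\ I (pi k) (snd (cfg k))).
  { induction k as [|k [E HI]]; [simpl; split; [lia|auto]|].
    rewrite prefix_S, sum_app. destruct (F (cfg k) HI) as [_ H2].
    change (cfg (S k)) with (nx (cfg k)). change (pi (S k)) with (f (cfg k)).
    split; [|exact H2]. unfold nx. simpl. fold (pi k). lia. }
  exists pi. split; [reflexivity|]. split.
  - intros i. destruct (Hc i) as [_ HI]. now destruct (F (cfg i) HI).
  - intros k. destruct (Hc k) as [<- HI]. exact HI.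
Qed.

Variable G : nat -> Prop.

Fixpoint safe (c : Z) (p : list nat) : Prop :=
  match p with [] => True | a :: p => (G a -> c < 0) /\ safe (c + wt a) p end.

Lemma safe_app c p q : safe c (p ++ q) <-> safe c p /\ safe (c + sum p) q.
Proof.
  revert c; induction p as [|a p IH]; intros c; simpl.
  - rewrite Z.add_0_r. tauto.
  - rewrite IH, Z.add_assoc. tauto.
Qed.

Lemma safe_mono c c' p : c' <= c -> safe c p -> safe c' p.
Proof.
  revert c c'; induction p as [|a p IH]; simpl; intros c c' Hc; auto.
  intros [H1 H2]. split; [intros h; specialize (H1 h); lia|].
  eapply IH; [|exact H2]. lia.
Qed.

Lemma safe_free c p : Forall (fun a => ~ G a) p -> safe c p.
Proof. intros H. revert c. induction H; simpl; auto. intros. split; [tauto|auto]. Qed.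

(** At a visit to [G] the weight of the strictly earlier positions counts, as in the semantics of
    until. For [k = 0] the sum is 0, so the start is outside [G]; this covers the disjunct of until
    in which the right-hand formula holds at once. *)
Definition bad_path (s : nat) : Prop :=
  exists pi, pi 0%nat = s /\ path pi /\ forall k, G (pi k) -> sum (prefix pi k) < 0.

(* A closing cycle of weight at most 0 can be repeated because [safe] is
   antitone in the initial weight. *)
Definition lasso (s : nat) (p1 : list nat) (x : nat) (p2 : list nat) : Prop :=
  walk s p1 x /\ walk x p2 x /\ p2 <> [] /\ safe 0 p1 /\ safe (sum p1) p2 /\
  (sum p2 <= 0 \/ Forall (fun a => ~ G a) p2).

Lemma lasso_bad_path s p1 x p2 : lasso s p1 x p2 -> bad_path s.
Proof.
  intros (W1 & W2 & Hne & S1 & S2 & Hc).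
  assert (Loop : forall c, safe c p2 -> safe (c + sum p2) p2).
  { intros c Hs. destruct Hc as [Hc|Hc]; [|now apply safe_free].
    eapply safe_mono; [|exact Hs]. lia. }
  (* The invariant carries the unread part [r] of the current round and the promise that a further
     round of [p2] after it is safe. *)
  set (I := fun y c => exists r, walk y r x /\ safe c r /\ safe (c + sum r) p2).
  (* When the current round is exhausted, the promised round becomes the current one, so the unread
     part can be taken nonempty. *)
  assert (HI : forall y c, I y c -> exists r, walk y (y :: r) x /\ safe c (y :: r) /\
    safe (c + sum (y :: r)) p2).
  { intros y c ([|b r] & H1 & H2 & H3).
    - inversion H1; subst. simpl in H3. rewrite Z.add_0_r in H3.
      destruct p2 as [|b p2]; [easy|]. pose proof (walk_head _ _ _ _ W2). subst b.
      exists p2. auto.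
    - pose proof (walk_head _ _ _ _ H1). subst b. exists r. auto. }
  destruct (exists_path I s 0) as (pi & P0 & Pp & PI).
  - intros y c H. apply HI in H as (r & H1 & H2 & H3).
    inversion H1; subst. exists b. split; auto. exists r. simpl in *.
    split; auto. split; [tauto|]. now rewrite <- Z.add_assoc.
  - exists p1. auto.
  - exists pi. split; auto. split; auto. intros k Hk.
    destruct (HI _ _ (PI k)) as (r & _ & [H2 _] & _). specialize (H2 Hk). lia.
Qed.

Lemma bad_path_safe pi k :
  (forall k, G (pi k) -> sum (prefix pi k) < 0) -> safe 0 (prefix pi k).
Proof.
  intros H. induction k as [|k IH]; [exact I|].
  rewrite prefix_S, safe_app. split; auto. simpl. split; auto.
Qed.

Lemma sum_bound W p : (forall a, - W <= wt a) -> - (W * Z.of_nat (length p)) <= sum p.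
Proof.
  intros H. induction p as [|a p IH]; simpl length; [simpl; lia|].
  specialize (H a). rewrite Nat2Z.inj_succ. simpl sum. lia.
Qed.

Definition short_lasso (s : nat) : Prop :=
  exists p1 x p2, lasso s p1 x p2 /\
    (length p1 <= 2 * length edges)%nat /\ (length p2 <= length edges)%nat.

(* Without a short lasso, every cycle that is cut out has positive weight. *)
Lemma safe_walk_shorten s p z :
  ~ short_lasso s -> walk s p z -> safe 0 p ->
  exists q, walk s q z /\ safe 0 q /\ (length q <= length edges)%nat /\
    Z.of_nat (length p) - Z.of_nat (length q) <=
      Z.of_nat (length edges) * (sum p - sum q).
Proof.
  intros HL. remember (length p) as l eqn:El. revert p El.
  induction l as [l IH] using lt_wf_ind. intros p -> HW HS.
  destruct (le_lt_dec (length p) (length edges)) as [|Hl].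
  { exists p. split; [auto|]. split; [auto|]. split; [auto|]. lia. }
  destruct (long_walk_cycle _ _ _ HW Hl) as (p1 & x & p2 & p3 & -> & Hlen).
  apply walk_cut in HW as (W1 & W2 & W3).
  apply safe_app in HS as [S1 S2]. apply safe_app in S2 as [S2 S3].
  assert (Hpos : 0 < sum (x :: p2)).
  { apply Z.nle_gt. intros Hle. apply HL. exists p1, x, (x :: p2).
    split; [|split; lia]. rewrite Z.add_0_l in S2.
    do 2 (split; [auto|]). split; [easy|]. split; [auto|]. split; [exact S2|auto]. }
  destruct (IH (length (p1 ++ x :: p3))) with (p := p1 ++ x :: p3) as (q & Q1 & Q2 & Q3 & Q4).
  - rewrite !length_app. simpl. lia.
  - reflexivity.
  - eapply walk_app; eauto.
  - apply safe_app. split; auto. eapply safe_mono; [|exact S3]. lia.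
  - exists q. split; [auto|]. split; [auto|]. split; [auto|].
    rewrite !length_app in *. rewrite !sum_app in *. rewrite !Nat2Z.inj_add in *.
    (* The removed cycle has length at most [length edges] and, weights being integers, weight at
       least 1. *)
    assert (Z.of_nat (length (x :: p2)) <= Z.of_nat (length edges)) by lia. nia.
Qed.

(** Without a short lasso all removed cycles are positive, so the weight of prefixes of the bad path
    grows linearly with their length. From some point on it is nonnegative, hence the path no longer
    meets [G], and any vertex repeated after that point closes a cycle that avoids [G]. Its stem
    consists of a shortened prefix and a piece of the tail, each of length at most [length edges]:
    this is the factor 2 in [short_lasso]. *)
Lemma bad_path_short_lasso W s :
  (forall a, - W <= wt a) -> bad_path s -> short_lasso s.
Proof.
  intros HW (pi & P0 & Pp & PG). apply NNPP. intros HL.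
  set (K := length edges).
  assert (HK : (0 < K)%nat).
  { unfold K. specialize (Pp 0%nat). unfold edge in Pp. destruct edges; simpl in *; [tauto|lia]. }
  assert (HW0 : 0 <= Z.max W 0) by lia.
  assert (HW' : forall a, - Z.max W 0 <= wt a) by (intros a; specialize (HW a); lia).
  set (W' := Z.max W 0) in *. clearbody W'.
  assert (Hpre : forall k, exists q, walk s q (pi k) /\ safe 0 q /\ (length q <= K)%nat /\
     Z.of_nat k - Z.of_nat (length q) <= Z.of_nat K * (sum (prefix pi k) - sum q)).
  { intros k. destruct (safe_walk_shorten s (prefix pi k) (pi k)) as (q & Q); auto.
    - rewrite <- P0. now apply walk_prefix.
    - now apply bad_path_safe.
    - exists q. now rewrite prefix_length in Q. }
  (* A shortened prefix has at most [K] vertices and so weighs at least [- W' * K]. The original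
     exceeds this weight by at least one for every [K] vertices removed, and [k0] leaves
     [K * (W' * K)] vertices to remove. *)
  set (k0 := (K + K * (Z.to_nat W' * K))%nat).
  assert (Hfree : forall k, (k0 <= k)%nat -> ~ G (pi k)).
  { intros k Hk Hg. specialize (PG k Hg).
    destruct (Hpre k) as (q & _ & _ & Q3 & Q4).
    pose proof (sum_bound W' q HW').
    assert (Z.of_nat k >= Z.of_nat K + Z.of_nat K * (W' * Z.of_nat K)).
    { unfold k0 in Hk. apply Nat2Z.inj_le in Hk.
      rewrite Nat2Z.inj_add, !Nat2Z.inj_mul, Z2Nat.id in Hk by auto. lia. }
    assert (W' * Z.of_nat (length q) <= W' * Z.of_nat K) by nia.
    assert (sum (prefix pi k) - sum q < W' * Z.of_nat K) by lia.
    assert (Z.of_nat K * (sum (prefix pi k) - sum q) < Z.of_nat K * (W' * Z.of_nat K)) by nia.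
    lia. }
  set (rho := fun i => pi (k0 + i)%nat).
  assert (Rp : path rho) by (intros i; unfold rho; rewrite Nat.add_succ_r; apply Pp).
  pose proof (walk_prefix rho (S K) Rp) as HWr.
  destruct (long_walk_cycle _ _ _ HWr) as (p1 & x & p2 & p3 & E & Hlen).
  { rewrite prefix_length. unfold K. lia. }
  assert (HF : Forall (fun a => ~ G a) (prefix rho (S K))).
  { apply Forall_forall. intros a Ha. unfold prefix in Ha.
    apply in_map_iff in Ha as (i & <- & _). apply Hfree. lia. }
  rewrite E in HF, HWr. apply walk_cut in HWr as (V1 & V2 & _).
  apply Forall_app in HF as [F1 F2]. apply Forall_app in F2 as [F2 _].
  destruct (Hpre k0) as (q & Q1 & Q2 & Q3 & _).
  unfold rho in V1 at 1. rewrite Nat.add_0_r in V1.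
  apply HL. exists (q ++ p1), x, (x :: p2). split.
  - split; [eapply walk_app; eauto|]. split; [auto|]. split; [easy|].
    split; [apply safe_app; split; auto using safe_free|].
    split; [now apply safe_free|auto].
  - rewrite length_app. fold K in Hlen |- *. lia.
Qed.

Definition good_walk (T : nat -> Prop) (s : nat) : Prop :=
  exists p z, walk s p z /\ p <> [] /\ T z /\ 0 <= sum p.

Definition short_good_walk (T : nat -> Prop) (s : nat) : Prop :=
  let K := length edges in
  (exists p z, (length p <= K)%nat /\ walk s p z /\ p <> [] /\ T z /\ 0 <= sum p) \/
  (exists p1 x p2 p3 z,
    (length p1 <= K /\ length p2 <= K /\ length p3 <= K)%nat /\
    walk s p1 x /\ walk x p2 x /\ 0 < sum p2 /\ walk x p3 z /\ T z).

Lemma sum_repeat p k : sum (concat (repeat p k)) = Z.of_nat k * sum p.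
Proof.
  induction k as [|k IH]; simpl concat; [reflexivity|]. rewrite sum_app, IH. lia.
Qed.

Lemma walk_repeat x p k : walk x p x -> walk x (concat (repeat p k)) x.
Proof.
  intros H. induction k as [|k IH]; simpl; [constructor|]. eapply walk_app; eauto.
Qed.

(** Cutting a cycle of weight at most 0 does not lower the total. If a positive cycle is met
    instead, the weight of the rest no longer matters, since going around often enough compensates
    for it; the rest may thus be shortened blindly. *)
Lemma good_walk_short T s : good_walk T s -> short_good_walk T s.
Proof.
  intros (p & z & HW & Hne & HT & Hs).
  remember (length p) as l eqn:El. revert p El HW Hne Hs.
  induction l as [l IH] using lt_wf_ind. intros p -> HW Hne Hs.
  destruct (le_lt_dec (length p) (length edges)) as [Hl|Hl].
  { left. exists p, z. auto. }
  destruct (long_walk_cycle _ _ _ HW Hl) as (p1 & x & p2 & p3 & -> & Hlen).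
  apply walk_cut in HW as (W1 & W2 & W3).
  destruct (Z_lt_le_dec 0 (sum (x :: p2))) as [Hpos|Hneg].
  - right. destruct (walk_shorten _ _ _ W3) as (q & Q1 & Q2).
    exists p1, x, (x :: p2), q, z. split; [lia|auto].
  - eapply IH; [|reflexivity|eapply walk_app; eauto|now destruct p1|].
    + rewrite !length_app. simpl. lia.
    + rewrite !sum_app in *. lia.
Qed.

Lemma pump_good_walk (T : nat -> Prop) s p1 x p2 p3 z :
  walk s p1 x -> walk x p2 x -> 0 < sum p2 -> walk x p3 z -> T z -> good_walk T s.
Proof.
  intros W1 W2 Hpos W3 HT.
  set (k := S (Z.to_nat (Z.abs (sum p1) + Z.abs (sum p3)))).
  exists (p1 ++ concat (repeat p2 k) ++ p3), z.
  split; [eauto using walk_app, walk_repeat|]. split; [|split; [auto|]].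
  - destruct p2; [simpl in Hpos; lia|]. now destruct p1.
  - rewrite !sum_app, sum_repeat. unfold k.
    rewrite Nat2Z.inj_succ, Z2Nat.id by lia. nia.
Qed.

End Weighted.

Definition live (s : nat) : Prop := exists pi, pi 0 = s /\ path pi.

(** Liveness is the existence of a bad path for an empty target, so the bounds on lassos carry
    over. *)
Lemma live_short_lasso s :
  live s -> exists p1 x p2, walk s p1 x /\ walk x p2 x /\ p2 <> [] /\
    length p1 <= 2 * length edges /\ length p2 <= length edges.
Proof.
  intros (pi & P0 & Pp).
  destruct (bad_path_short_lasso (fun _ => 0%Z) (fun _ => False) 0 s) as
    (p1 & x & p2 & (H1 & H2 & H3 & _) & H4 & H5).
  - intros; lia.
  - exists pi. tauto.
  - exists p1, x, p2. auto.
Qed.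

Lemma lasso_live s p1 x p2 : walk s p1 x -> walk x p2 x -> p2 <> [] -> live s.
Proof.
  intros H1 H2 H3.
  assert (HF : forall p : list nat, Forall (fun _ => ~ False) p)
    by (intros; now apply Forall_forall).
  destruct (lasso_bad_path (fun _ => 0%Z) (fun _ => False) s p1 x p2) as (pi & P0 & Pp & _).
  - do 3 (split; [auto|]). split; [now apply safe_free|]. split; [now apply safe_free|auto].
  - now exists pi.
Qed.

Fixpoint prepend (p : list nat) (pi : nat -> nat) : nat -> nat :=
  match p with
  | [] => pi
  | a :: p => fun k => match k with 0 => a | S k => prepend p pi k end
  end.

Lemma prepend_prefix p pi : prefix (prepend p pi) (length p) = p.
Proof.
  induction p as [|a p IH]; simpl; auto. rewrite prefix_cons. f_equal. exact IH.
Qed.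

Lemma prepend_at p pi k : prepend p pi (length p + k) = pi k.
Proof. induction p; simpl; auto. Qed.

Lemma prepend_0 a p z pi : walk a p z -> pi 0 = z -> prepend p pi 0 = a.
Proof. destruct 1; simpl; auto. Qed.

Lemma prepend_path a p z pi :
  walk a p z -> pi 0 = z -> path pi -> path (prepend p pi).
Proof.
  intros H E Hp. induction H as [|a b p z He HW IH]; simpl; auto.
  intros [|i]; [|now apply IH]. simpl. now rewrite (prepend_0 _ _ _ _ HW E).
Qed.

End Graph.

(** * State semantics *)

Definition decide (P : Prop) : bool := if excluded_middle_informative P then true else false.

Lemma decide_iff P : decide P = true <-> P.
Proof. unfold decide. destruct (excluded_middle_informative P); intuition congruence. Qed.

Lemma decide_true (P : Prop) : P -> decide P = true.
Proof. apply decide_iff. Qed.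

Lemma decide_false (P : Prop) : ~ P -> decide P = false.
Proof. unfold decide. destruct (excluded_middle_informative P); tauto. Qed.

Definition count (P : nat -> Prop) (p : list nat) : nat :=
  length (filter (fun a => decide (P a)) p).

Lemma count_cons P a p :
  count P (a :: p) = (if decide (P a) then 1 else 0) + count P p.
Proof. unfold count. simpl. now destruct (decide (P a)). Qed.

Lemma count_le P p : count P p <= length p.
Proof. unfold count. apply filter_length_le. Qed.

Fixpoint ssat (K : KS) (f : form) (s : nat) {struct f} : Prop :=
  match f with
  | FAtom p => In (s, p) (ks_labels K)
  | FAnd f g => ssat K f s /\ ssat K g s
  | FNot f => ~ ssat K f s
  | FE b => exists pi, pi 0 = s /\ path (ks_edges K) pi /\ spsat K b pi
  | FA b => ~ exists pi, pi 0 = s /\ path (ks_edges K) pi /\ ~ spsat K b pi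
  end
with spsat (K : KS) (b : pform) (pi : nat -> nat) {struct b} : Prop :=
  match b with
  | PX f => ssat K f (pi 1)
  | PU n m f g =>
      ssat K g (pi 0) \/
      exists k, ssat K g (pi (S k)) /\ n * S k <= m * count (ssat K f) (prefix pi (S k))
  end.

Scheme form_mut := Induction for form Sort Prop
  with pform_mut := Induction for pform Sort Prop.
Combined Scheme form_pform_ind from form_mut, pform_mut.

Lemma run_path K rho i : is_run K rho -> path (ks_edges K) (fun j => rho (i + j)).
Proof. intros [_ H] j. rewrite Nat.add_succ_r. apply H. Qed.

Lemma splice_run K rho i pi :
  is_run K rho -> pi 0 = rho i -> path (ks_edges K) pi ->
  exists rho', is_run K rho' /\ (forall j, j <= i -> rho' j = rho j) /\
    (fun j => rho' (i + j)) = pi.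
Proof.
  intros [H0 H] E Hp. set (rho' := fun j => if j <=? i then rho j else pi (j - i)).
  assert (A : forall j, j <= i -> rho' j = rho j).
  { intros j Hj. unfold rho'. now apply Nat.leb_le in Hj as ->. }
  assert (B : forall j, rho' (i + j) = pi j).
  { intros j. unfold rho'. destruct (Nat.leb_spec (i + j) i).
    - replace j with 0 by lia. now rewrite Nat.add_0_r.
    - f_equal. lia. }
  exists rho'. split; [split|split; [exact A|]].
  - rewrite A by lia. exact H0.
  - intros j. destruct (le_lt_dec i j).
    + replace j with (i + (j - i)) by lia. rewrite <- Nat.add_succ_r, !B. apply Hp.
    + rewrite !A by lia. apply H.
  - apply functional_extensionality. exact B.
Qed.

(** All duplicate-free enumerations of the same positions have the same length; this turns the
    quantifier over lists in the semantics of until into a count. *)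
Lemma count_list P rho i k l :
  NoDup l -> (forall j, In j l <-> (i <= j <= i + k /\ P (rho j))) ->
  length l = count P (prefix (fun j => rho (i + j)) (S k)).
Proof.
  intros ND Hl. unfold count, prefix.
  set (l' := filter (fun j => decide (P (rho j))) (seq i (S k))).
  assert (E : length l' = length (filter (fun a => decide (P a))
    (map (fun j => rho (i + j)) (seq 0 (S k))))).
  { unfold l'. clear. rewrite <- (Nat.add_0_r i) at 1.
    generalize (S k) as n, 0 as j. induction n as [|n IH]; intros j; simpl; auto.
    rewrite <- Nat.add_succ_r.
    destruct (decide (P (rho (i + j)))); simpl; now rewrite IH. }
  rewrite <- E.
  assert (Hl' : forall j, In j l' <-> In j l).
  { intros j. unfold l'. rewrite filter_In, in_seq, decide_iff, Hl. intuition lia. }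
  apply Nat.le_antisymm; apply NoDup_incl_length; auto.
  - intros j. apply Hl'.
  - apply NoDup_filter, seq_NoDup.
  - intros j. apply Hl'.
Qed.

(** By [splice_run], the continuations of a run after position [i] are exactly the infinite paths
    from its current state, and the bodies of path quantifiers look only at positions from [i]
    on. *)
Lemma sat_ssat_mutual K :
  (forall f rho i, is_run K rho -> (sat K f rho i <-> ssat K f (rho i))) /\
  (forall b rho i, is_run K rho -> (psat K b rho i <-> spsat K b (fun j => rho (i + j)))).
Proof.
  apply form_pform_ind.
  - intros p rho i _. reflexivity.
  - intros f IHf g IHg rho i H. simpl. now rewrite IHf, IHg.
  - intros f IHf rho i H. simpl. now rewrite IHf.
  - intros b IHb rho i H. simpl. split.
    + intros (rho' & H1 & H2 & H3). exists (fun j => rho' (i + j)).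
      rewrite Nat.add_0_r, H2 by lia. split; auto. split; [now apply run_path|].
      now apply IHb.
    + intros (pi & H1 & H2 & H3).
      destruct (splice_run K rho i pi H H1 H2) as (rho' & R1 & R2 & R3).
      exists rho'. split; auto. split; auto. apply IHb; auto. now rewrite R3.
  - intros b IHb rho i H. simpl. apply not_iff_compat. split.
    + intros (rho' & H1 & H2 & H3). exists (fun j => rho' (i + j)).
      rewrite Nat.add_0_r, H2 by lia. split; auto. split; [now apply run_path|].
      now rewrite <- IHb.
    + intros (pi & H1 & H2 & H3).
      destruct (splice_run K rho i pi H H1 H2) as (rho' & R1 & R2 & R3).
      exists rho'. split; auto. split; auto. rewrite IHb; auto. now rewrite R3.
  - intros f IHf rho i H. simpl. rewrite IHf by auto. now rewrite Nat.add_1_r.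
  - intros n m f IHf g IHg rho i H. simpl. rewrite IHg, Nat.add_0_r by auto.
    apply or_iff_compat_l. split.
    + intros (k & Hk & Hg & l & ND & Hl & Hle). exists (k - i). split.
      * rewrite IHg in Hg by auto. now replace (i + S (k - i)) with (S k) by lia.
      * rewrite <- (count_list _ _ _ _ l); auto.
        -- now replace (S (k - i)) with (k - i + 1) by lia.
        -- intros j. rewrite Hl, IHf by auto. now replace (i + (k - i)) with k by lia.
    + intros (k & Hg & Hle). exists (i + k). split; [lia|]. split.
      * rewrite IHg by auto. now rewrite <- Nat.add_succ_r.
      * set (l := filter (fun j => decide (ssat K f (rho j))) (seq i (S k))).
        assert (Hl : forall j, In j l <-> (i <= j <= i + k /\ ssat K f (rho j))).
        { intros j. unfold l. rewrite filter_In, in_seq, decide_iff. intuition lia. }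
        assert (ND : NoDup l) by apply NoDup_filter, seq_NoDup.
        exists l. split; [auto|]. split.
        -- intros j. now rewrite Hl, IHf.
        -- rewrite (count_list _ _ _ _ _ ND Hl).
           now replace (i + k - i + 1) with (S k) by lia.
Qed.

(** Liveness of the initial state is the existence of a run. Since only the state matters, the
    position can be taken to be 0. *)
Lemma models_iff K f :
  models K f <-> live (ks_edges K) (ks_init K) /\ ssat K f (ks_init K).
Proof.
  split.
  - intros (rho & i & H & E & Hs). apply (proj1 (sat_ssat_mutual K)) in Hs; auto.
    rewrite E in Hs. split; auto. destruct H. now exists rho.
  - intros [(pi & P0 & Pp) Hs]. exists pi, 0.
    assert (H : is_run K pi) by (split; auto).
    split; auto. split; auto. apply (proj1 (sat_ssat_mutual K)); auto. now rewrite P0.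
Qed.

Lemma live_path edges pi k : path edges pi -> live edges (pi k).
Proof.
  intros H. exists (fun i => pi (k + i)). split; [now rewrite Nat.add_0_r|].
  intros i. rewrite Nat.add_succ_r. apply H.
Qed.

Lemma live_source edges s : live edges s -> exists t, edge edges s t.
Proof. intros (pi & <- & H). exists (pi 1). apply H. Qed.

Lemma path_cons edges s t : edge edges s t -> live edges t ->
  exists pi, pi 0 = s /\ path edges pi /\ pi 1 = t.
Proof.
  intros He (pi & P0 & Pp). exists (prepend [s] pi). split; [reflexivity|].
  split; [|exact P0].
  eapply prepend_path; eauto. econstructor; eauto. constructor.
Qed.

Lemma ssat_EX K f s :
  ssat K (FE (PX f)) s <->
  exists t, edge (ks_edges K) s t /\ live (ks_edges K) t /\ ssat K f t.
Proof.
  simpl. split.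
  - intros (pi & <- & Pp & H). exists (pi 1).
    split; [apply Pp|]. split; [now apply live_path|auto].
  - intros (t & He & Hl & Hs). destruct (path_cons _ _ _ He Hl) as (pi & P0 & Pp & P1).
    exists pi. now rewrite P1.
Qed.

Lemma ssat_AX K f s :
  ssat K (FA (PX f)) s <->
  ~ exists t, edge (ks_edges K) s t /\ live (ks_edges K) t /\ ~ ssat K f t.
Proof.
  simpl. apply not_iff_compat. split.
  - intros (pi & <- & Pp & H). exists (pi 1).
    split; [apply Pp|]. split; [now apply live_path|auto].
  - intros (t & He & Hl & Hs). destruct (path_cons _ _ _ He Hl) as (pi & P0 & Pp & P1).
    exists pi. now rewrite P1.
Qed.

Definition weight (n m : nat) (F : nat -> Prop) (a : nat) : Z :=
  ((if decide (F a) then Z.of_nat m else 0) - Z.of_nat n)%Z.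

Lemma sum_weight n m F p :
  sum (weight n m F) p = (Z.of_nat (m * count F p) - Z.of_nat (n * length p))%Z.
Proof.
  induction p as [|a p IH]; [unfold count; simpl; lia|].
  rewrite count_cons. cbn [sum length]. rewrite IH. unfold weight.
  destruct (decide (F a)); lia.
Qed.

(** A finite walk witnesses until as soon as its last vertex is live, because it can then be
    prolonged to an infinite path. *)
Lemma ssat_EU K n m f g s :
  ssat K (FE (PU n m f g)) s <->
  (live (ks_edges K) s /\ ssat K g s) \/
  good_walk (ks_edges K) (weight n m (ssat K f))
    (fun z => ssat K g z /\ live (ks_edges K) z) s.
Proof.
  cbn [ssat spsat]. split.
  - intros (pi & <- & Pp & [H|(k & Hg & Hk)]).
    + left. split; [now apply live_path|auto].
    + right. exists (prefix pi (S k)), (pi (S k)).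
      split; [now apply walk_prefix|]. split; [now rewrite prefix_cons|].
      split; [split; [auto|now apply live_path]|].
      rewrite sum_weight, prefix_length. lia.
  - intros [[(pi & P0 & Pp) H]|(p & z & HW & Hne & [Hg (pi & P0 & Pp)] & Hs)].
    + exists pi. rewrite P0. auto.
    + exists (prepend p pi). split; [eapply prepend_0; eauto|].
      split; [eapply prepend_path; eauto|]. right.
      destruct p as [|a p]; [easy|]. exists (length p).
      change (S (length p)) with (length (a :: p)). split.
      * rewrite <- (Nat.add_0_r (length (a :: p))), prepend_at, P0. auto.
      * rewrite prepend_prefix. rewrite sum_weight in Hs. lia.
Qed.

Lemma ssat_AU K n m f g s :
  ssat K (FA (PU n m f g)) s <->
  ~ bad_path (ks_edges K) (weight n m (ssat K f)) (ssat K g) s.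
Proof.
  cbn [ssat spsat]. apply not_iff_compat. unfold bad_path. split.
  - intros (pi & P0 & Pp & H). exists pi. split; auto. split; auto.
    intros [|k] Hk; [tauto|]. rewrite sum_weight, prefix_length.
    apply Z.nle_gt. intros Hle. apply H. right. exists k. split; auto. lia.
  - intros (pi & P0 & Pp & H). exists pi. split; auto. split; auto.
    intros [Hg|(k & Hg & Hk)].
    + specialize (H 0 Hg). simpl in H. lia.
    + specialize (H (S k) Hg). rewrite sum_weight, prefix_length in H. lia.
Qed.

(** * Walks as chains of pairs of bounded numbers *)

Fixpoint chain (R : nat -> nat * nat -> nat * nat -> Prop) (i k : nat)
  (x y : nat * nat) : Prop :=
  match k with
  | 0 => x = y
  | S k => exists x', R i x x' /\ chain R (S i) k x' y
  end.

Section Steps.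
Variable edges : list (nat * nat).

(** A pair consists of a vertex and the number [c] of earlier visits to [F]. At index [i] the
    accumulated weight is [m * c - n * i], so its negativity is a comparison of natural numbers and
    only the small number [c] has to be recorded. *)
Definition weighted_step (F G : nat -> Prop) (n m : nat) (i : nat) (x y : nat * nat) : Prop :=
  edge edges (fst x) (fst y) /\
  (F (fst x) -> snd y = snd x + 1) /\ (~ F (fst x) -> snd y = snd x) /\
  (G (fst x) -> m * snd x < n * i).

(** The second component is pinned to 0 so that walks without a count fit the same format. *)
Definition free_step (G : nat -> Prop) (i : nat) (x y : nat * nat) : Prop :=
  edge edges (fst x) (fst y) /\ ~ G (fst x) /\ snd y = 0.

Lemma chain_free G i k a z :
  chain (free_step G) i k (a, 0) (z, 0) <->
  exists p, walk edges a p z /\ length p = k /\ Forall (fun a => ~ G a) p.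
Proof.
  split.
  - revert i a. induction k as [|k IH]; intros i a.
    + intros [= <-]. exists []. repeat constructor.
    + intros ([u v] & (He & HG & Hv) & H). simpl in *. subst v.
      destruct (IH _ _ H) as (p & H1 & <- & H3). exists (a :: p).
      split; [econstructor; eauto|]. split; [reflexivity|now constructor].
  - intros (p & H & <- & HF). revert i. induction H as [|a b p z He HW IH]; intros i.
    + reflexivity.
    + inversion HF; subst. exists (b, 0). split; [split; auto|]. now apply IH.
Qed.

Lemma chain_weighted F G n m i k a c z c' :
  chain (weighted_step F G n m) i k (a, c) (z, c') <->
  exists p, walk edges a p z /\ length p = k /\ c' = c + count F p /\
    safe (weight n m F) G (Z.of_nat (m * c) - Z.of_nat (n * i)) p.
Proof.
  assert (Hw : forall a c i, (Z.of_nat (m * c) - Z.of_nat (n * i) + weight n m F a =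
     Z.of_nat (m * (c + if decide (F a) then 1 else 0)) - Z.of_nat (n * S i))%Z).
  { intros a0 c0 i0. unfold weight. destruct (decide (F a0)); lia. }
  split.
  - revert i a c. induction k as [|k IH]; intros i a c.
    + intros [= <- <-]. exists []. split; [constructor|]. split; [reflexivity|].
      split; [unfold count; simpl; lia|exact I].
    + intros ([u v] & (He & HF1 & HF2 & HG) & H). simpl in He, HF1, HF2, HG.
      assert (Ev : v = c + if decide (F a) then 1 else 0).
      { destruct (decide (F a)) eqn:E.
        - apply HF1, decide_iff, E.
        - rewrite HF2; [lia|]. intros h. apply decide_true in h. congruence. }
      destruct (IH _ _ _ H) as (p & H1 & <- & -> & H4). exists (a :: p).
      split; [econstructor; eauto|]. split; [reflexivity|].
      rewrite count_cons. split; [lia|]. cbn [safe]. rewrite Hw, <- Ev.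
      split; [|exact H4]. intros h. specialize (HG h). lia.
  - intros (p & H & <- & -> & HS). revert i c HS.
    induction H as [|a b p z He HW IH]; intros i c HS.
    + simpl. unfold count. simpl. f_equal. lia.
    + cbn [safe] in HS. rewrite Hw in HS. destruct HS as [HG HS].
      cbn [chain length]. exists (b, c + if decide (F a) then 1 else 0). split.
      * split; [exact He|]. cbn [fst snd]. split; [|split].
        -- intros h. now rewrite (decide_true _ h).
        -- intros h. rewrite (decide_false _ h). lia.
        -- intros h. specialize (HG h). lia.
      * rewrite count_cons, Nat.add_assoc. apply IH. exact HS.
Qed.

Variable D : nat.
Hypothesis D_ge : 2 * length edges <= D.

Definition no_target (x : nat) : Prop := False.

Lemma safe_no_target wt c p : safe wt no_target c p.
Proof. apply safe_free. apply Forall_forall. unfold no_target. tauto. Qed.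

Lemma Forall_no_target p : Forall (fun a => ~ no_target a) p.
Proof. apply Forall_forall. unfold no_target. tauto. Qed.

Definition live_chains (s : nat) : Prop :=
  exists x k1 k2, k1 <= D /\ k2 <= D /\ 1 <= k2 /\
    chain (free_step no_target) 0 k1 (s, 0) (x, 0) /\
    chain (free_step no_target) 0 k2 (x, 0) (x, 0).

Lemma live_iff_chains s : live edges s <-> live_chains s.
Proof.
  unfold live_chains. split.
  - intros H. destruct (live_short_lasso _ _ H) as (p1 & x & p2 & H1 & H2 & H3 & H4 & H5).
    exists x, (length p1), (length p2). split; [lia|]. split; [lia|].
    split; [destruct p2; [easy|simpl; lia]|]. rewrite !chain_free.
    split; [exists p1|exists p2]; auto using Forall_no_target.
  - intros (x & k1 & k2 & _ & _ & H & H1 & H2).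
    apply chain_free in H1 as (p1 & A1 & A2 & _).
    apply chain_free in H2 as (p2 & B1 & B2 & _).
    apply (lasso_live _ _ p1 x p2); auto. destruct p2; [simpl in *; lia|easy].
Qed.

Definition good_walk_chains (F T : nat -> Prop) (n m s : nat) : Prop :=
  (exists z k c, k <= D /\ c <= D /\ 1 <= k /\
     chain (weighted_step F no_target n m) 0 k (s, 0) (z, c) /\ n * k <= m * c /\ T z) \/
  (exists x z k1 k2 k3 c, k1 <= D /\ k2 <= D /\ k3 <= D /\ c <= D /\
     chain (free_step no_target) 0 k1 (s, 0) (x, 0) /\
     chain (weighted_step F no_target n m) 0 k2 (x, 0) (x, c) /\ n * k2 < m * c /\
     chain (free_step no_target) 0 k3 (x, 0) (z, 0) /\ T z).

Lemma good_walk_iff_chains F T n m s :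
  good_walk edges (weight n m F) T s <-> good_walk_chains F T n m s.
Proof.
  split.
  - intros H. apply good_walk_short in H.
    destruct H as [(p & z & Hl & HW & Hne & HT & Hs)|
      (p1 & x & p2 & p3 & z & Hl & H1 & H2 & Hp & H3 & HT)].
    + left. exists z, (length p), (count F p). pose proof (count_le F p).
      split; [lia|]. split; [lia|]. split; [destruct p; [easy|simpl; lia]|].
      rewrite sum_weight in Hs. split; [|split; [lia|auto]].
      apply chain_weighted. exists p. auto using safe_no_target.
    + right. exists x, z, (length p1), (length p2), (length p3), (count F p2).
      pose proof (count_le F p2). do 4 (split; [lia|]).
      rewrite sum_weight in Hp. rewrite !chain_free, chain_weighted.
      split; [exists p1; auto using Forall_no_target|].
      split; [exists p2; auto using safe_no_target|]. split; [lia|].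
      split; [exists p3; auto using Forall_no_target|auto].
  - intros [(z & k & c & _ & _ & Hk & H & Hle & HT)|
      (x & z & k1 & k2 & k3 & c & _ & _ & _ & _ & H1 & H2 & Hlt & H3 & HT)].
    + apply chain_weighted in H as (p & HW & <- & -> & _). exists p, z.
      rewrite sum_weight. split; [auto|]. split; [destruct p; [simpl in Hk; lia|easy]|].
      split; [auto|lia].
    + apply chain_free in H1 as (p1 & A1 & _). apply chain_free in H3 as (p3 & A3 & _).
      apply chain_weighted in H2 as (p2 & A2 & <- & -> & _).
      eapply pump_good_walk; eauto. rewrite sum_weight. lia.
Qed.

(** The chain of the cycle starts at index [k1] with count [c1], so that its steps see the weight
    accumulated on the stem. Hence [c2] counts over both parts, up to [2 * D], and the final
    inequality says that the cycle weighs at most 0. *)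
Definition lasso_chains (F G : nat -> Prop) (n m s : nat) : Prop :=
  exists x k1 c1 k2, k1 <= D /\ c1 <= D /\ k2 <= D /\ 1 <= k2 /\
    chain (weighted_step F G n m) 0 k1 (s, 0) (x, c1) /\
    ((exists c2, c2 <= 2 * D /\ chain (weighted_step F G n m) k1 k2 (x, c1) (x, c2) /\
       m * c2 <= m * c1 + n * k2) \/
     chain (free_step G) 0 k2 (x, 0) (x, 0)).

Lemma bad_path_iff_chains F G n m s :
  bad_path edges (weight n m F) G s <-> lasso_chains F G n m s.
Proof.
  assert (E : (Z.of_nat (m * 0) - Z.of_nat (n * 0) = 0)%Z) by lia.
  split.
  - intros H. apply (bad_path_short_lasso _ _ _ (Z.of_nat n)) in H.
    2: { intros a. unfold weight. destruct (decide (F a)); lia. }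
    destruct H as (p1 & x & p2 & (W1 & W2 & Hne & S1 & S2 & Hc) & L1 & L2).
    pose proof (count_le F p1). pose proof (count_le F p2).
    exists x, (length p1), (count F p1), (length p2).
    do 3 (split; [lia|]). split; [destruct p2; [easy|simpl; lia]|]. split.
    { apply chain_weighted. exists p1. rewrite E. auto. }
    destruct Hc as [Hc|Hc].
    + left. exists (count F p1 + count F p2). split; [lia|].
      rewrite sum_weight in Hc, S2. split; [|lia].
      apply chain_weighted. exists p2. auto.
    + right. apply chain_free. exists p2. auto.
  - intros (x & k1 & c1 & k2 & _ & _ & _ & Hk2 & H1 & H2).
    apply chain_weighted in H1 as (p1 & W1 & <- & -> & S1). rewrite E in S1.
    destruct H2 as [(c2 & _ & H2 & Hle)|H2].
    + apply chain_weighted in H2 as (p2 & W2 & <- & -> & S2).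
      apply (lasso_bad_path _ _ _ s p1 x p2). do 2 (split; [auto|]).
      split; [destruct p2; [simpl in Hk2; lia|easy]|]. split; [auto|].
      rewrite !sum_weight. split; [exact S2|]. left. lia.
    + apply chain_free in H2 as (p2 & W2 & <- & HF).
      apply (lasso_bad_path _ _ _ s p1 x p2). do 2 (split; [auto|]).
      split; [destruct p2; [simpl in Hk2; lia|easy]|]. split; [auto|].
      split; [now apply safe_free|auto].
Qed.

End Steps.

(** * Encodings and the formula for model checking *)

Definition occurs (w : list bool) (p : nat) (u : list bool) : Prop :=
  exists post, skipn p w = u ++ post.

Lemma occurs_app w p u v :
  occurs w p (u ++ v) <-> occurs w p u /\ occurs w (p + length u) v.
Proof.
  unfold occurs. split.
  - intros [post E]. split; [exists (v ++ post); now rewrite app_assoc|].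
    exists post. rewrite Nat.add_comm, <- skipn_skipn, E, <- app_assoc.
    now rewrite skipn_app, skipn_all, Nat.sub_diag.
  - intros [[post1 E1] [post2 E2]]. exists post2.
    rewrite Nat.add_comm, <- skipn_skipn, E1 in E2.
    rewrite skipn_app, skipn_all, Nat.sub_diag in E2. simpl in E2. subst post1.
    now rewrite E1, app_assoc.
Qed.

Lemma occurs_nil w p : occurs w p [].
Proof. now exists (skipn p w). Qed.

Lemma skipn_cons_nth {A} (w : list A) p b post :
  skipn p w = b :: post <-> nth_error w p = Some b /\ skipn (S p) w = post.
Proof.
  revert w. induction p as [|p IH]; intros [|a w]; simpl; split.
  - discriminate.
  - intros [H _]; discriminate.
  - intros [= -> ->]. auto.
  - intros [[= ->] ->]. auto.
  - discriminate.
  - intros [H _]; discriminate.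
  - intros H. apply IH in H. exact H.
  - intros H. apply IH. exact H.
Qed.

Lemma occurs_single w p b : occurs w p [b] <-> nth_error w p = Some b.
Proof.
  unfold occurs. split.
  - intros [post E]. now apply skipn_cons_nth in E.
  - intros E. exists (skipn (S p) w). now apply skipn_cons_nth.
Qed.

Lemma occurs_cons w p b u :
  occurs w p (b :: u) <-> nth_error w p = Some b /\ occurs w (p + 1) u.
Proof. change (b :: u) with ([b] ++ u). now rewrite occurs_app, occurs_single. Qed.

Lemma occurs_nth w p u :
  occurs w p u <-> forall i, i < length u -> nth_error w (p + i) = nth_error u i.
Proof.
  revert p; induction u as [|b u IH]; intros p.
  - split; [simpl; lia|intros _; apply occurs_nil].
  - rewrite occurs_cons, IH. split.
    + intros [H1 H2] [|i] Hi; simpl in *; [now rewrite Nat.add_0_r|].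
      rewrite <- H2 by lia. f_equal. lia.
    + intros H. split.
      * specialize (H 0 ltac:(simpl; lia)). now rewrite Nat.add_0_r in H.
      * intros i Hi. specialize (H (S i) ltac:(simpl; lia)). simpl in H. rewrite <- H.
        f_equal. lia.
Qed.

Lemma occurs_bound w p u : occurs w p u -> u <> [] -> p + length u <= length w.
Proof.
  intros [post E] Hu. assert (H : length (skipn p w) = length (u ++ post)) by now rewrite E.
  rewrite length_skipn, length_app in H. destruct u; [easy|simpl in *; lia].
Qed.

(** * Binary encodings and their unique readability *)

Lemma bin_aux_fuel fu n : n <= fu -> bin_aux fu n = bin n.
Proof.
  revert n. induction fu as [fu IH] using lt_wf_ind. intros n Hn. unfold bin.
  destruct n as [|n]; [now destruct fu|]. destruct fu as [|fu]; [lia|].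
  cbn [bin_aux]. f_equal.
  assert (Nat.div2 (S n) <= n) by (apply Nat.div2_decr; lia).
  destruct (Nat.eq_dec fu n) as [->|]; [reflexivity|].
  rewrite !IH; auto; lia.
Qed.

Lemma bin_step n : n <> 0 -> bin n = Nat.odd n :: bin (Nat.div2 n).
Proof.
  intros Hn. unfold bin at 1. destruct n as [|n]; [easy|]. cbn [bin_aux]. f_equal.
  apply bin_aux_fuel, Nat.div2_decr. lia.
Qed.

(** A relational form of the length of [bin x] that treats 0 uniformly and can be expressed through
    binary digits. *)
Definition bit_length (x l : nat) : Prop :=
  x < 2 ^ l /\ (l = 0 \/ Nat.testbit x (l - 1) = true).

Lemma bit_length_exists x : exists l, bit_length x l.
Proof.
  destruct (Nat.eq_dec x 0) as [->|Hx].
  - exists 0. split; auto.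
  - exists (S (Nat.log2 x)). split; [apply Nat.log2_spec; lia|]. right.
    rewrite Nat.sub_succ, Nat.sub_0_r. now apply Nat.bit_log2.
Qed.

Lemma bin_bits x l : bit_length x l -> bin x = map (Nat.testbit x) (seq 0 l).
Proof.
  revert x. induction l as [|l IH]; intros x [Hx Ht].
  - simpl in Hx. now replace x with 0 by lia.
  - destruct Ht as [|Ht]; [lia|]. rewrite Nat.sub_succ, Nat.sub_0_r in Ht.
    assert (Hx0 : x <> 0) by (intros ->; now rewrite Nat.bits_0 in Ht).
    rewrite bin_step by auto. simpl. f_equal.
    rewrite IH.
    + rewrite <- seq_shift, map_map. apply map_ext. intros i. now rewrite Nat.div2_div, Nat.div2_bits.
    + split.
      * rewrite Nat.div2_div. apply Nat.Div0.div_lt_upper_bound. simpl in Hx. lia.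
      * destruct l as [|l]; [now left|]. right.
        rewrite Nat.sub_succ, Nat.sub_0_r, Nat.div2_div, Nat.div2_bits. exact Ht.
Qed.

Lemma bits_above x l i : x < 2 ^ l -> l <= i -> Nat.testbit x i = false.
Proof.
  intros Hx Hi. destruct (Nat.eq_dec x 0) as [->|Hx0]; [apply Nat.bits_0|].
  apply Nat.bits_above_log2. apply Nat.log2_lt_pow2; [lia|].
  eapply Nat.lt_le_trans; [exact Hx|]. apply Nat.pow_le_mono_r; lia.
Qed.

Lemma nth_bin x i : nth i (bin x) false = Nat.testbit x i.
Proof.
  destruct (bit_length_exists x) as [l Hl]. rewrite (bin_bits _ _ Hl).
  destruct (le_lt_dec l i) as [Hi|Hi].
  - rewrite nth_overflow by (rewrite length_map, length_seq; lia).
    symmetry. eapply bits_above; eauto. apply Hl.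
  - rewrite nth_indep with (d' := Nat.testbit x 0) by (rewrite length_map, length_seq; lia).
    now rewrite map_nth, seq_nth by lia.
Qed.

Lemma bin_inj x y : bin x = bin y -> x = y.
Proof.
  intros E. apply Nat.bits_inj. intros i. now rewrite <- !nth_bin, E.
Qed.

Definition guarded (bs : list bool) : list bool := flat_map (fun b => [true; b]) bs.

Lemma enc_nat_guarded x : enc_nat x = guarded (bin x) ++ [false].
Proof. reflexivity. Qed.

Lemma guarded_length bs : length (guarded bs) = 2 * length bs.
Proof. induction bs as [|b bs IH]; simpl; lia. Qed.

Lemma guarded_even bs i : i < length bs -> nth_error (guarded bs) (2 * i) = Some true.
Proof.
  revert i; induction bs as [|b bs IH]; intros [|i] Hi; simpl in Hi; try lia; [reflexivity|].
  replace (2 * S i) with (S (S (2 * i))) by lia. simpl. apply IH. lia.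
Qed.

Lemma guarded_odd bs i : nth_error (guarded bs) (2 * i + 1) = nth_error bs i.
Proof.
  revert i; induction bs as [|b bs IH]; intros i.
  - cbn [guarded flat_map]. now rewrite !nth_error_nil.
  - destruct i as [|i]; [reflexivity|].
    replace (2 * S i + 1) with (S (S (2 * i + 1))) by lia. apply IH.
Qed.

Lemma guarded_prefix_free bs bs' u v :
  guarded bs ++ false :: u = guarded bs' ++ false :: v -> bs = bs' /\ u = v.
Proof.
  revert bs'; induction bs as [|b bs IH]; intros [|b' bs']; simpl; intros E.
  - now inversion E.
  - discriminate.
  - discriminate.
  - inversion E as [[E1 E2]]. apply IH in E2 as [-> ->]. auto.
Qed.

Lemma enc_nat_prefix_free x y u v :
  enc_nat x ++ u = enc_nat y ++ v -> x = y /\ u = v.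
Proof.
  rewrite !enc_nat_guarded, <- !app_assoc. simpl. intros E.
  apply guarded_prefix_free in E as [E ->]. split; auto. now apply bin_inj.
Qed.

(** Prefix-freeness ensures that at most one formula can be read at a position of the input, so that
    positions can index the table in place of subformulas. *)
Lemma enc_form_prefix_free_mutual :
  (forall f g u v, enc_form f ++ u = enc_form g ++ v -> f = g /\ u = v) /\
  (forall f g u v, enc_pform f ++ u = enc_pform g ++ v -> f = g /\ u = v).
Proof.
  apply form_pform_ind.
  - intros p [q| | | |] u v; cbn; try discriminate. intros [= E].
    apply enc_nat_prefix_free in E as [-> ->]. auto.
  - intros f IHf g IHg [|f' g'| | |] u v; cbn; try discriminate. intros [= E].
    rewrite <- !app_assoc in E. apply IHf in E as [-> E]. apply IHg in E as [-> ->]. auto.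
  - intros f IHf [| |f'| |] u v; cbn; try discriminate. intros [= E].
    apply IHf in E as [-> ->]. auto.
  - intros b IHb [| | |b'|] u v; cbn; try discriminate. intros [= E].
    apply IHb in E as [-> ->]. auto.
  - intros b IHb [| | | |b'] u v; cbn; try discriminate. intros [= E].
    apply IHb in E as [-> ->]. auto.
  - intros f IHf [f'|] u v; cbn; try discriminate. intros [= E].
    apply IHf in E as [-> ->]. auto.
  - intros n m f IHf g IHg [|n' m' f' g'] u v; cbn; try discriminate. intros [= E].
    rewrite <- !app_assoc in E. apply enc_nat_prefix_free in E as [-> E].
    apply enc_nat_prefix_free in E as [-> E].
    apply IHf in E as [-> E]. apply IHg in E as [-> ->]. auto.
Qed.

Lemma occurs_nat_inj w p x y : occurs w p (enc_nat x) -> occurs w p (enc_nat y) -> x = y.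
Proof.
  intros [u E] [v E']. rewrite E in E'. now apply enc_nat_prefix_free in E'.
Qed.

Lemma occurs_form_inj w p f g :
  occurs w p (enc_form f) -> occurs w p (enc_form g) -> f = g.
Proof.
  intros [u E] [v E']. rewrite E in E'. now apply enc_form_prefix_free_mutual in E'.
Qed.

Lemma enc_nat_length x l : bit_length x l -> length (enc_nat x) = 2 * l + 1.
Proof.
  intros H. rewrite enc_nat_guarded, length_app, guarded_length, (bin_bits _ _ H).
  rewrite length_map, length_seq. reflexivity.
Qed.

(** The pointwise form of an occurrence, which [qNat] expresses. *)
Lemma occurs_nat_iff w p x l : bit_length x l ->
  (occurs w p (enc_nat x) <->
   nth_error w (p + 2 * l) = Some false /\
   forall i, i < l -> nth_error w (p + 2 * i) = Some true /\
     nth_error w (p + 2 * i + 1) = Some (Nat.testbit x i)).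
Proof.
  intros H. rewrite enc_nat_guarded, occurs_app, occurs_single, guarded_length.
  rewrite (bin_bits _ _ H), length_map, length_seq.
  assert (Hn : forall i, i < l ->
    nth_error (map (Nat.testbit x) (seq 0 l)) i = Some (Nat.testbit x i)).
  { intros i Hi. rewrite nth_error_map, nth_error_seq.
    now apply Nat.ltb_lt in Hi as ->. }
  rewrite occurs_nth, guarded_length, length_map, length_seq.
  split.
  - intros [H1 H2]. split; auto. intros i Hi. split.
    + rewrite H1 by lia. apply guarded_even. rewrite length_map, length_seq. lia.
    + rewrite <- Nat.add_assoc, H1, guarded_odd by lia. auto.
  - intros [H1 H2]. split; auto. intros i Hi.
    rewrite (Nat.div2_odd i). set (j := Nat.div2 i).
    assert (Hj : j < l).
    { pose proof (Nat.div2_odd i) as E. fold j in E. destruct (Nat.odd i); simpl in E; lia. }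
    destruct (H2 j Hj) as [A1 A2].
    destruct (Nat.odd i); cbn [Nat.b2n].
    + rewrite Nat.add_assoc, A2, guarded_odd. symmetry. auto.
    + rewrite Nat.add_0_r, A1. symmetry. apply guarded_even.
      rewrite length_map, length_seq. lia.
Qed.

Lemma occurs_nat_lt w p x : occurs w p (enc_nat x) -> x < 2 ^ length w.
Proof.
  intros H. destruct (bit_length_exists x) as [l Hl].
  pose proof (occurs_bound _ _ _ H) as Hb. rewrite (enc_nat_length _ _ Hl) in Hb.
  eapply Nat.lt_le_trans; [apply Hl|]. apply Nat.pow_le_mono_r; [lia|].
  enough (p + (2 * l + 1) <= length w) by lia. apply Hb.
  rewrite enc_nat_guarded. now destruct (guarded (bin x)).
Qed.

(** * Sequences as digits, and chains as sequences *)

Lemma digit_1 x i : digit 1 x i = Nat.b2n (Nat.testbit x i).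
Proof. unfold digit. now rewrite Nat.testbit_spec'. Qed.

Lemma digit_le b x i : digit b x i <= b.
Proof. unfold digit. pose proof (Nat.mod_upper_bound (x / S b ^ i) (S b)). lia. Qed.

Lemma digits_exist b (g : nat -> nat) k :
  (forall j, j < k -> g j <= b) ->
  exists x, x < S b ^ k /\ forall j, j < k -> digit b x j = g j.
Proof.
  revert g. induction k as [|k IH]; intros g Hg.
  - exists 0. split; [simpl; lia|lia].
  - destruct (IH (fun j => g (S j))) as (x & Hx & Hd); [intros; apply Hg; lia|].
    pose proof (Hg 0 ltac:(lia)) as H0.
    assert (Ediv : (g 0 + S b * x) / S b = x).
    { symmetry. apply Nat.div_unique with (g 0); lia. }
    exists (g 0 + S b * x). split; [simpl Nat.pow; nia|].
    intros [|j] Hj; unfold digit.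
    + rewrite Nat.pow_0_r, Nat.div_1_r. symmetry. apply Nat.mod_unique with x; lia.
    + rewrite Nat.pow_succ_r', <- Nat.Div0.div_div, Ediv. apply Hd. lia.
Qed.

Lemma chain_seq R i k f :
  (forall j, j < k -> R (i + j) (f j) (f (S j))) -> chain R i k (f 0) (f k).
Proof.
  revert i f. induction k as [|k IH]; intros i f H; [reflexivity|].
  exists (f 1). split.
  - specialize (H 0 ltac:(lia)). now rewrite Nat.add_0_r in H.
  - apply (IH (S i) (fun j => f (S j))). intros j Hj.
    specialize (H (S j) ltac:(lia)). now rewrite Nat.add_succ_r in H.
Qed.

Lemma seq_chain R i k x y :
  chain R i k x y ->
  exists f, f 0 = x /\ f k = y /\ forall j, j < k -> R (i + j) (f j) (f (S j)).
Proof.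
  revert i x. induction k as [|k IH]; intros i x H.
  - exists (fun _ => x). simpl in H. repeat split; auto. lia.
  - destruct H as (x' & H1 & H2). destruct (IH _ _ H2) as (f & F0 & Fk & Hf).
    exists (fun j => match j with 0 => x | S j => f j end). split; auto. split; auto.
    intros [|j] Hj.
    + rewrite Nat.add_0_r, F0. exact H1.
    + rewrite Nat.add_succ_r. apply Hf. lia.
Qed.

Lemma chain_app R i k k' x y z :
  chain R i k x y -> chain R (i + k) k' y z -> chain R i (k + k') x z.
Proof.
  revert i x. induction k as [|k IH]; intros i x; cbn [chain Nat.add].
  - intros ->. now rewrite Nat.add_0_r.
  - intros (x' & H1 & H2) H3. exists x'. split; auto. apply IH; auto.
    now rewrite Nat.add_succ_comm.
Qed.

(** * The formula for model checking *)

Section Formulas.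
Variables (V : Type) (D b : V).
Let tm := term V.
Let fm := formula V.

Definition LEq (s t : tm) : fm := LAnd (LLe s t) (LLe t s).
Definition LLt (s t : tm) : fm := LNot (LLe t s).
Definition LOr (f g : fm) : fm := LNot (LAnd (LNot f) (LNot g)).
Definition LImp (f g : fm) : fm := LNot (LAnd f (LNot g)).
Definition LIff (f g : fm) : fm := LAnd (LImp f g) (LImp g f).
Definition LExB (t : tm) (F : tm -> fm) : fm :=
  LEx (fun x => LAnd (LLe (TVar x) t) (F (TVar x))).
Definition LAllB (t : tm) (F : tm -> fm) : fm := LNot (LExB t (fun x => LNot (F x))).
Definition exD : (tm -> fm) -> fm := LExB (TVar D).
Definition exb : (tm -> fm) -> fm := LExB (TVar b).

Definition plus (t : tm) (c : nat) : tm := TAdd t (TConst c).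
Definition twice (t : tm) : tm := TAdd t t.

(** [TDigit x (TConst 1) i] is bit [i] of [x], the base being [1 + 1], and [l] is the bit length of
    [x]. For the vanishing of the higher bits it suffices to test indices up to [b], because
    [x <= b < 2 ^ b]. *)
Definition qNat (p q x : tm) : fm :=
  exD (fun l =>
    LAnd (LEq q (plus (TAdd p (twice l)) 1))
    (LAnd (LBit false (TAdd p (twice l)))
    (LAnd (LOr (LEq l (TConst 0))
            (exD (fun l' => LAnd (LEq l (plus l' 1))
               (LEq (TDigit x (TConst 1) l') (TConst 1)))))
    (LAnd
      (LAllB (TVar D) (fun i => LImp (LLt i l)
         (LAnd (LBit true (TAdd p (twice i)))
           (LOr (LAnd (LBit true (plus (TAdd p (twice i)) 1))
                      (LEq (TDigit x (TConst 1) i) (TConst 1)))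
                (LAnd (LBit false (plus (TAdd p (twice i)) 1))
                      (LEq (TDigit x (TConst 1) i) (TConst 0)))))))
      (LAllB (TVar b) (fun i => LImp (LLe l i)
         (LEq (TDigit x (TConst 1) i) (TConst 0)))))))).

(** A sequence of pairs is quantified as two numbers, whose digits in base [b + 1] are the first and
    the second components. *)
Definition qChain (R : tm -> tm -> tm -> tm -> tm -> fm) (i k a c z c' : tm) : fm :=
  LEx (fun Y => LEx (fun C =>
    let y j := TDigit (TVar Y) (TVar b) j in
    let n j := TDigit (TVar C) (TVar b) j in
    LAnd (LAnd (LAnd (LEq (y (TConst 0)) a) (LEq (n (TConst 0)) c))
               (LAnd (LEq (y k) z) (LEq (n k) c')))
      (LAllB k (fun j => LImp (LLt j k)
         (R (TAdd i j) (y j) (n j) (y (plus j 1)) (n (plus j 1))))))).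

Definition qItem (p p' : tm) : fm :=
  LAnd (LBit true p) (exb (fun s => exb (fun t => exD (fun c =>
    LAnd (qNat (plus p 1) c s) (qNat c p' t))))).

Definition qItems (p p' : tm) : fm :=
  exD (fun k => qChain (fun _ u _ u' v' => LAnd (qItem u u') (LEq v' (TConst 0)))
    (TConst 0) k p (TConst 0) p' (TConst 0)).

(* [(s, t)] is in the list of pairs encoded at position [q]. *)
Definition qMem (q s t : tm) : fm :=
  exD (fun p => LAnd (qItems q p) (LAnd (LBit true p)
    (exD (fun c => LAnd (qNat (plus p 1) c s) (exD (fun p' => qNat c p' t)))))).

(* The list of pairs encoded at position [q] ends before position [r]. *)
Definition qEnd (q r : tm) : fm :=
  exD (fun p => LAnd (qItems q p) (LAnd (LBit false p) (LEq r (plus p 1)))).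

Definition qTag (p : tm) (b0 b1 b2 : bool) : fm :=
  LAnd (LBit b0 p) (LAnd (LBit b1 (plus p 1)) (LBit b2 (plus p 2))).

Definition qPath (p : tm) : fm := LOr (qTag p false true true) (qTag p true false false).

(* Reads one constructor at position [p], with [k] formulas still to be read. *)
Definition qToken (p k p' k' : tm) : fm :=
  LOr (LAnd (qTag p false false false)
         (LAnd (exb (fun x => qNat (plus p 3) p' x)) (LEq k (plus k' 1))))
  (LOr (LAnd (qTag p false false true)
         (LAnd (LEq p' (plus p 3)) (LAnd (LEq k' (plus k 1)) (LLe (TConst 1) k))))
  (LOr (LAnd (qTag p false true false)
         (LAnd (LEq p' (plus p 3)) (LAnd (LEq k' k) (LLe (TConst 1) k))))
  (LOr (LAnd (qPath p) (LAnd (LBit false (plus p 3))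
         (LAnd (LEq p' (plus p 4)) (LAnd (LEq k' k) (LLe (TConst 1) k)))))
       (LAnd (qPath p) (LAnd (LBit true (plus p 3))
         (LAnd (exD (fun c => exb (fun n => exb (fun m =>
                  LAnd (qNat (plus p 4) c n) (qNat c p' m)))))
           (LAnd (LEq k' (plus k 1)) (LLe (TConst 1) k)))))))).

(* A formula is encoded between positions [p] and [q]. *)
Definition qForm (p q : tm) : fm :=
  exD (fun k => qChain (fun _ u v u' v' => qToken u v u' v')
    (TConst 0) k p (TConst 1) q (TConst 0)).

Section Graph_formulas.
Variables (Edge : tm -> tm -> fm).

Definition qWeighted (F G : tm -> fm) (n m i k a c z c' : tm) : fm :=
  qChain (fun i u v u' v' =>
    LAnd (Edge u u') (LAnd (LImp (F u) (LEq v' (plus v 1)))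
      (LAnd (LImp (LNot (F u)) (LEq v' v))
         (LImp (G u) (LLt (TMul m v) (TMul n i)))))) i k a c z c'.

Definition qFree (G : tm -> fm) (k a z : tm) : fm :=
  qChain (fun _ u _ u' v' =>
    LAnd (Edge u u') (LAnd (LNot (G u)) (LEq v' (TConst 0))))
    (TConst 0) k a (TConst 0) z (TConst 0).

Definition qFalse (u : tm) : fm := LLt u u.

Definition qLive (s : tm) : fm :=
  exb (fun x => exD (fun k1 => exD (fun k2 =>
    LAnd (LLe (TConst 1) k2) (LAnd (qFree qFalse k1 s x) (qFree qFalse k2 x x))))).

Definition qGoodWalk (F T : tm -> fm) (n m s : tm) : fm :=
  LOr
   (exb (fun z => exD (fun k => exD (fun c =>
      LAnd (LLe (TConst 1) k)
      (LAnd (qWeighted F qFalse n m (TConst 0) k s (TConst 0) z c)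
      (LAnd (LLe (TMul n k) (TMul m c)) (T z)))))))
   (exb (fun x => exb (fun z => exD (fun k1 => exD (fun k2 => exD (fun k3 => exD (fun c =>
      LAnd (qFree qFalse k1 s x)
      (LAnd (qWeighted F qFalse n m (TConst 0) k2 x (TConst 0) x c)
      (LAnd (LLt (TMul n k2) (TMul m c))
      (LAnd (qFree qFalse k3 x z) (T z))))))))))).

Definition qLasso (F G : tm -> fm) (n m s : tm) : fm :=
  exb (fun x => exD (fun k1 => exD (fun c1 => exD (fun k2 =>
    LAnd (LLe (TConst 1) k2)
    (LAnd (qWeighted F G n m (TConst 0) k1 s (TConst 0) x c1)
      (LOr
        (LExB (twice (TVar D)) (fun c2 =>
           LAnd (qWeighted F G n m k1 k2 x c1 x c2)
             (LLe (TMul m c2) (TAdd (TMul m c1) (TMul n k2)))))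
        (qFree G k2 x x))))))).

(* [X] encodes for each position [p] a list of at most [D + 1] states. *)
Definition qTable (X p s : tm) : fm :=
  exD (fun j => LEq (TDigit X (TVar b) (TAdd (TMul p (plus (TVar D) 1)) j)) (plus s 1)).

Variable Label : tm -> tm -> fm.

(** Each disjunct is the defining equation of the constructor read at [p], where truth of a
    subformula is looked up in the table at the position where that subformula begins. *)
Definition qRule (X p s : tm) : fm :=
  LOr (LAnd (qTag p false false false)
    (exD (fun q => exb (fun x => LAnd (qNat (plus p 3) q x) (Label s x)))))
  (LOr (LAnd (qTag p false false true)
    (exD (fun q => LAnd (qForm (plus p 3) q)
       (LAnd (qTable X (plus p 3) s) (qTable X q s)))))
  (LOr (LAnd (qTag p false true false) (LNot (qTable X (plus p 3) s)))
  (LOr (LAnd (qTag p false true true) (LAnd (LBit false (plus p 3))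
    (exb (fun t => LAnd (Edge s t) (LAnd (qLive t) (qTable X (plus p 4) t))))))
  (LOr (LAnd (qTag p true false false) (LAnd (LBit false (plus p 3))
    (LNot (exb (fun t => LAnd (Edge s t) (LAnd (qLive t) (LNot (qTable X (plus p 4) t))))))))
  (LAnd (qPath p) (LAnd (LBit true (plus p 3))
    (exb (fun n => exb (fun m => exD (fun c1 => exD (fun c2 => exD (fun q =>
       LAnd (LAnd (qNat (plus p 4) c1 n) (LAnd (qNat c1 c2 m) (qForm c2 q)))
       (LOr (LAnd (qTag p false true true)
              (LOr (LAnd (qLive s) (qTable X q s))
                 (qGoodWalk (qTable X c2) (fun z => LAnd (qTable X q z) (qLive z)) n m s)))
            (LAnd (qTag p true false false)
              (LNot (qLasso (qTable X c2) (qTable X q) n m s)))))))))))))))).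

(** Only states with an outgoing edge are constrained: they include all live states and are few
    enough for a row of the table. The condition covers every position at which some formula can be
    read, even by accident inside the encoding of the structure; such rows can be filled like the
    others. *)
Definition qCorrect (X : tm) : fm :=
  LAllB (TVar D) (fun p => LAllB (TVar D) (fun q => LImp (qForm p q)
    (LAllB (TVar b) (fun s => LImp (exb (fun t => Edge s t))
       (LIff (qTable X p s) (qRule X p s)))))).

End Graph_formulas.

Definition qModels : fm :=
  exD (fun q1 => exD (fun q2 => exD (fun q3 => exD (fun q4 => exb (fun x => exb (fun s =>
    LAnd (LAnd (qNat (TConst 0) q1 x) (LAnd (qNat q1 q2 s)
           (LAnd (qEnd q2 q3) (qEnd q3 q4))))
    (LAnd (qLive (qMem q2) s)
      (LEx (fun X => LAnd (qCorrect (qMem q2) (qMem q3) (TVar X))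
                          (qTable (TVar X) q4 s)))))))))).

End Formulas.

(** * Parametricity of the formula *)

Section Parametric.
Variables (V1 V2 : Type) (D1 b1 : V1) (D2 b2 : V2).

Definition base_ok (G : list (V1 * V2)) : Prop := In (D1, D2) G /\ In (b1, b2) G.

Lemma term_rel_incl G G' t t' :
  incl G G' -> term_rel V1 V2 G t t' -> term_rel V1 V2 G' t t'.
Proof. intros H. induction 1; constructor; auto. Qed.

(** Stable under extension of the context, because such functions are applied below further
    binders. *)
Definition rel1 G (F : term V1 -> formula V1) (F' : term V2 -> formula V2) : Prop :=
  forall G' s s', incl G G' -> term_rel _ _ G' s s' -> formula_rel _ _ G' (F s) (F' s').

Definition rel2 G (F : term V1 -> term V1 -> formula V1)
  (F' : term V2 -> term V2 -> formula V2) : Prop :=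
  forall G' s s' t t', incl G G' -> term_rel _ _ G' s s' -> term_rel _ _ G' t t' ->
  formula_rel _ _ G' (F s t) (F' s' t').

Definition rel5 G (F : term V1 -> term V1 -> term V1 -> term V1 -> term V1 -> formula V1)
  (F' : term V2 -> term V2 -> term V2 -> term V2 -> term V2 -> formula V2) : Prop :=
  forall G' s s' t t' u u' v v' x x', incl G G' ->
  term_rel _ _ G' s s' -> term_rel _ _ G' t t' -> term_rel _ _ G' u u' ->
  term_rel _ _ G' v v' -> term_rel _ _ G' x x' ->
  formula_rel _ _ G' (F s t u v x) (F' s' t' u' v' x').

Lemma rel_eq G s t s' t' : term_rel V1 V2 G s s' -> term_rel _ _ G t t' ->
  formula_rel _ _ G (LEq _ s t) (LEq _ s' t').
Proof. intros. repeat (constructor; auto). Qed.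

Lemma rel_lt G s t s' t' : term_rel V1 V2 G s s' -> term_rel _ _ G t t' ->
  formula_rel _ _ G (LLt _ s t) (LLt _ s' t').
Proof. intros. repeat (constructor; auto). Qed.

Lemma rel_or G f g f' g' : formula_rel V1 V2 G f f' -> formula_rel _ _ G g g' ->
  formula_rel _ _ G (LOr _ f g) (LOr _ f' g').
Proof. intros. repeat (constructor; auto). Qed.

Lemma rel_imp G f g f' g' : formula_rel V1 V2 G f f' -> formula_rel _ _ G g g' ->
  formula_rel _ _ G (LImp _ f g) (LImp _ f' g').
Proof. intros. repeat (constructor; auto). Qed.

Lemma rel_iff G f g f' g' : formula_rel V1 V2 G f f' -> formula_rel _ _ G g g' ->
  formula_rel _ _ G (LIff _ f g) (LIff _ f' g').
Proof. intros. constructor; apply rel_imp; auto. Qed.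

Lemma rel_exB G t t' F F' :
  term_rel V1 V2 G t t' ->
  (forall x y, formula_rel _ _ ((x, y) :: G) (F (TVar x)) (F' (TVar y))) ->
  formula_rel _ _ G (LExB _ t F) (LExB _ t' F').
Proof.
  intros Ht HF. constructor. intros x y. constructor; auto. constructor.
  - constructor. now left.
  - eapply term_rel_incl; [|exact Ht]. now apply incl_tl.
Qed.

Lemma rel_allB G t t' F F' :
  term_rel V1 V2 G t t' ->
  (forall x y, formula_rel _ _ ((x, y) :: G) (F (TVar x)) (F' (TVar y))) ->
  formula_rel _ _ G (LAllB _ t F) (LAllB _ t' F').
Proof. intros Ht HF. constructor. apply rel_exB; auto. intros. now constructor. Qed.

Lemma rel_exD G F F' :
  base_ok G ->
  (forall x y, formula_rel _ _ ((x, y) :: G) (F (TVar x)) (F' (TVar y))) ->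
  formula_rel _ _ G (exD V1 D1 F) (exD V2 D2 F').
Proof. intros [H _] HF. apply rel_exB; auto. now constructor. Qed.

Lemma rel_exb G F F' :
  base_ok G ->
  (forall x y, formula_rel _ _ ((x, y) :: G) (F (TVar x)) (F' (TVar y))) ->
  formula_rel _ _ G (exb V1 b1 F) (exb V2 b2 F').
Proof. intros [_ H] HF. apply rel_exB; auto. now constructor. Qed.

Lemma rel_plus G t t' c :
  term_rel V1 V2 G t t' -> term_rel _ _ G (plus _ t c) (plus _ t' c).
Proof. intros. repeat (constructor; auto). Qed.

Lemma rel_twice G t t' :
  term_rel V1 V2 G t t' -> term_rel _ _ G (twice _ t) (twice _ t').
Proof. intros. repeat (constructor; auto). Qed.

Lemma base_ok_incl G G' : incl G G' -> base_ok G -> base_ok G'.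
Proof. intros H [H1 H2]. split; auto. Qed.

Ltac in_tac := first
  [ assumption
  | left; reflexivity
  | right; in_tac
  | match goal with H : incl _ ?G |- In _ ?G => apply H; in_tac end ].

Ltac incl_tac := let z := fresh in let h := fresh in intros z h; in_tac.

Ltac trel := first
  [ assumption
  | apply rel_const
  | apply rel_var; simpl; tauto
  | apply rel_plus; trel
  | apply rel_twice; trel
  | apply rel_add; trel
  | apply rel_mul; trel
  | apply rel_digit; trel
  | eapply term_rel_incl; [|eassumption]; incl_tac
  | apply rel_var; in_tac
  | apply rel_var; match goal with H : base_ok _ |- _ => destruct H; in_tac end ].

Ltac base := first
  [ assumption | match goal with H : base_ok ?G |- base_ok _ =>
      apply (base_ok_incl G); [incl_tac|exact H] end ].

Ltac frel := repeat first
  [ apply rel_eq; trel | apply rel_lt; trel | apply rel_le; trel | apply rel_bit; trel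
  | match goal with
    | H : rel1 _ ?F _ |- formula_rel _ _ _ (?F _) _ => apply H; [incl_tac|trel]
    | H : rel2 _ ?F _ |- formula_rel _ _ _ (?F _ _) _ => apply H; [incl_tac|trel|trel]
    end
  | match goal with
    | |- formula_rel _ _ _ (LOr _ _ _) _ => apply rel_or
    | |- formula_rel _ _ _ (LImp _ _ _) _ => apply rel_imp
    | |- formula_rel _ _ _ (LIff _ _ _) _ => apply rel_iff
    | |- formula_rel _ _ _ (LExB _ _ _) _ => apply rel_exB; [trel|intros]
    | |- formula_rel _ _ _ (LAllB _ _ _) _ => apply rel_allB; [trel|intros]
    | |- formula_rel _ _ _ (exD _ _ _) _ => apply rel_exD; [base|intros]
    | |- formula_rel _ _ _ (exb _ _ _) _ => apply rel_exb; [base|intros]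
    | |- formula_rel _ _ _ (LAnd _ _) _ => apply rel_and
    | |- formula_rel _ _ _ (LNot _) _ => apply rel_not
    | |- formula_rel _ _ _ (LEx _) _ => apply rel_ex; intros
    end ].

Lemma qNat_rel G p q x p' q' x' :
  base_ok G -> term_rel _ _ G p p' -> term_rel _ _ G q q' -> term_rel _ _ G x x' ->
  formula_rel _ _ G (qNat V1 D1 b1 p q x) (qNat V2 D2 b2 p' q' x').
Proof. intros. unfold qNat. frel. Qed.

Lemma qChain_rel G R R' i k a c z c' i' k' a' d z' d' :
  base_ok G -> rel5 G R R' ->
  term_rel _ _ G i i' -> term_rel _ _ G k k' -> term_rel _ _ G a a' ->
  term_rel _ _ G c d -> term_rel _ _ G z z' -> term_rel _ _ G c' d' ->
  formula_rel _ _ G (qChain V1 b1 R i k a c z c') (qChain V2 b2 R' i' k' a' d z' d').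
Proof.
  intros HB HR. intros. unfold qChain. frel.
  apply HR; [incl_tac|trel..].
Qed.

Ltac frel' := repeat progress (frel; try match goal with
  | |- formula_rel _ _ _ (qNat _ _ _ _ _ _) _ => apply qNat_rel; [base|trel..]
  | |- formula_rel _ _ _ (qChain _ _ _ _ _ _ _ _ _) _ =>
      apply qChain_rel; [base|red; intros|trel..]
  end).

Lemma qItem_rel G p p' q q' :
  base_ok G -> term_rel _ _ G p q -> term_rel _ _ G p' q' ->
  formula_rel _ _ G (qItem V1 D1 b1 p p') (qItem V2 D2 b2 q q').
Proof. intros. unfold qItem. frel'. Qed.

Lemma qItems_rel G p p' q q' :
  base_ok G -> term_rel _ _ G p q -> term_rel _ _ G p' q' ->
  formula_rel _ _ G (qItems V1 D1 b1 p p') (qItems V2 D2 b2 q q').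
Proof. intros. unfold qItems. frel'. apply qItem_rel; [base|trel..]. Qed.

Lemma qMem_rel G p s t q s' t' :
  base_ok G -> term_rel _ _ G p q -> term_rel _ _ G s s' -> term_rel _ _ G t t' ->
  formula_rel _ _ G (qMem V1 D1 b1 p s t) (qMem V2 D2 b2 q s' t').
Proof. intros. unfold qMem. frel'. apply qItems_rel; [base|trel..]. Qed.

Lemma qEnd_rel G p p' q q' :
  base_ok G -> term_rel _ _ G p q -> term_rel _ _ G p' q' ->
  formula_rel _ _ G (qEnd V1 D1 b1 p p') (qEnd V2 D2 b2 q q').
Proof. intros. unfold qEnd. frel'. apply qItems_rel; [base|trel..]. Qed.

Lemma qForm_rel G p p' q q' :
  base_ok G -> term_rel _ _ G p q -> term_rel _ _ G p' q' ->
  formula_rel _ _ G (qForm V1 D1 b1 p p') (qForm V2 D2 b2 q q').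
Proof. intros. unfold qForm. frel'. unfold qToken, qPath, qTag. frel'. Qed.

Lemma qFalse_rel G : rel1 G (qFalse V1) (qFalse V2).
Proof. red. intros. unfold qFalse. frel. Qed.

Lemma qTable_rel G X p s X' p' s' :
  base_ok G -> term_rel _ _ G X X' -> term_rel _ _ G p p' -> term_rel _ _ G s s' ->
  formula_rel _ _ G (qTable V1 D1 b1 X p s) (qTable V2 D2 b2 X' p' s').
Proof. intros. unfold qTable. frel'. Qed.

Section Relations.
Variables (Edge1 : term V1 -> term V1 -> formula V1).
Variables (Edge2 : term V2 -> term V2 -> formula V2).

Lemma qWeighted_rel G F F' H H' n m i k a c z d n' m' i' k' a' c' z' d' :
  base_ok G -> rel2 G Edge1 Edge2 -> rel1 G F F' -> rel1 G H H' ->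
  term_rel _ _ G n n' -> term_rel _ _ G m m' ->
  term_rel _ _ G i i' -> term_rel _ _ G k k' -> term_rel _ _ G a a' ->
  term_rel _ _ G c c' -> term_rel _ _ G z z' -> term_rel _ _ G d d' ->
  formula_rel _ _ G (qWeighted V1 b1 Edge1 F H n m i k a c z d)
    (qWeighted V2 b2 Edge2 F' H' n' m' i' k' a' c' z' d').
Proof. intros. unfold qWeighted. frel'. Qed.

Lemma qFree_rel G H H' k a z k' a' z' :
  base_ok G -> rel2 G Edge1 Edge2 -> rel1 G H H' ->
  term_rel _ _ G k k' -> term_rel _ _ G a a' -> term_rel _ _ G z z' ->
  formula_rel _ _ G (qFree V1 b1 Edge1 H k a z) (qFree V2 b2 Edge2 H' k' a' z').
Proof. intros. unfold qFree. frel'. Qed.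

Lemma rel1_incl G G' F F' : incl G G' -> rel1 G F F' -> rel1 G' F F'.
Proof. intros H HF G'' s s' Hi. apply HF. eapply incl_tran; eauto. Qed.

Lemma rel2_incl G G' F F' : incl G G' -> rel2 G F F' -> rel2 G' F F'.
Proof. intros H HF G'' s s' t t' Hi. apply HF. eapply incl_tran; eauto. Qed.

Ltac fun_tac := first
  [ assumption | apply qFalse_rel
  | eapply rel1_incl; [|eassumption]; incl_tac
  | eapply rel2_incl; [|eassumption]; incl_tac ].

Lemma qLive_rel G s s' :
  base_ok G -> rel2 G Edge1 Edge2 -> term_rel _ _ G s s' ->
  formula_rel _ _ G (qLive V1 D1 b1 Edge1 s) (qLive V2 D2 b2 Edge2 s').
Proof. intros. unfold qLive. frel'; (apply qFree_rel; [base|fun_tac|fun_tac|trel..]). Qed.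

Lemma qGoodWalk_rel G F F' T T' n m s n' m' s' :
  base_ok G -> rel2 G Edge1 Edge2 -> rel1 G F F' -> rel1 G T T' ->
  term_rel _ _ G n n' -> term_rel _ _ G m m' -> term_rel _ _ G s s' ->
  formula_rel _ _ G (qGoodWalk V1 D1 b1 Edge1 F T n m s)
    (qGoodWalk V2 D2 b2 Edge2 F' T' n' m' s').
Proof.
  intros. unfold qGoodWalk.
  frel'; first [apply qFree_rel; [base|fun_tac|fun_tac|trel..]
    |apply qWeighted_rel; [base|fun_tac|fun_tac|fun_tac|trel..]].
Qed.

Lemma qLasso_rel G F F' H H' n m s n' m' s' :
  base_ok G -> rel2 G Edge1 Edge2 -> rel1 G F F' -> rel1 G H H' ->
  term_rel _ _ G n n' -> term_rel _ _ G m m' -> term_rel _ _ G s s' ->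
  formula_rel _ _ G (qLasso V1 D1 b1 Edge1 F H n m s)
    (qLasso V2 D2 b2 Edge2 F' H' n' m' s').
Proof.
  intros. unfold qLasso.
  frel'; first [apply qFree_rel; [base|fun_tac|fun_tac|trel..]
    |apply qWeighted_rel; [base|fun_tac|fun_tac|fun_tac|trel..]].
Qed.

Variables (Label1 : term V1 -> term V1 -> formula V1).
Variables (Label2 : term V2 -> term V2 -> formula V2).

Lemma qRule_rel G X p s X' p' s' :
  base_ok G -> rel2 G Edge1 Edge2 -> rel2 G Label1 Label2 ->
  term_rel _ _ G X X' -> term_rel _ _ G p p' -> term_rel _ _ G s s' ->
  formula_rel _ _ G (qRule V1 D1 b1 Edge1 Label1 X p s)
    (qRule V2 D2 b2 Edge2 Label2 X' p' s').
Proof.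
  intros. unfold qRule, qPath, qTag.
  frel'; first [apply qTable_rel; [base|trel..]|apply qForm_rel; [base|trel..]
    |apply qLive_rel; [base|fun_tac|trel..]
    |apply qGoodWalk_rel; [base|fun_tac| | |trel..]
    |apply qLasso_rel; [base|fun_tac| | |trel..]];
    red; intros; frel';
    first [apply qTable_rel; [base|trel..]|apply qLive_rel; [base|fun_tac|trel..]].
Qed.

Lemma qCorrect_rel G X X' :
  base_ok G -> rel2 G Edge1 Edge2 -> rel2 G Label1 Label2 -> term_rel _ _ G X X' ->
  formula_rel _ _ G (qCorrect V1 D1 b1 Edge1 Label1 X)
    (qCorrect V2 D2 b2 Edge2 Label2 X').
Proof.
  intros. unfold qCorrect.
  frel'; first [apply qTable_rel; [base|trel..]|apply qForm_rel; [base|trel..]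
    |apply qRule_rel; [base|fun_tac|fun_tac|trel..]].
Qed.

End Relations.

Lemma qModels_rel :
  formula_rel _ _ [(D1, D2); (b1, b2)] (qModels V1 D1 b1) (qModels V2 D2 b2).
Proof.
  assert (base_ok [(D1, D2); (b1, b2)]) by (split; simpl; tauto).
  assert (HM : forall G q q', base_ok G -> term_rel _ _ G q q' ->
     rel2 G (qMem V1 D1 b1 q) (qMem V2 D2 b2 q')).
  { intros G q q' HB Hq G' s s' t t' Hi Hs Ht.
    apply qMem_rel; auto; [now apply (base_ok_incl G)|now apply (term_rel_incl G)]. }
  unfold qModels.
  frel'; first [apply qEnd_rel; [base|trel..]|apply qTable_rel; [base|trel..]
    |apply qLive_rel; [base|apply HM; [base|trel]|trel]
    |apply qCorrect_rel; [base|apply HM; [base|trel]|apply HM; [base|trel]|trel]].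
Qed.

End Parametric.

(** * Correctness of the formula for model checking *)

Arguments LEq : simpl never.
Arguments LLt : simpl never.
Arguments LOr : simpl never.
Arguments LImp : simpl never.
Arguments LIff : simpl never.
Arguments LExB : simpl never.
Arguments LAllB : simpl never.
Arguments exD : simpl never.
Arguments exb : simpl never.

Section Semantics.
Variables (w : list bool) (D b B : nat).
Hypothesis D_ge : 3 * length w + 6 <= D.
Hypothesis b_ge : 2 ^ D <= b.
Hypothesis B_ge : S b ^ ((D + 1) * (D + 1)) <= B.

Notation ev := (teval B).
Notation ok := (holds w B).

Lemma D_le_b : 8 * D <= b.
Proof.
  etransitivity; [|exact b_ge]. assert (H : 6 <= D) by lia. clear - H.
  induction H as [|D H IH]; [simpl; lia|]. rewrite Nat.pow_succ_r'. lia.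
Qed.

Lemma b_large : 64 <= b.
Proof.
  etransitivity; [|exact b_ge]. change 64 with (2 ^ 6). apply Nat.pow_le_mono_r; lia.
Qed.

(** The factors of all products in the formula are at most [b], so with this margin no sum or
    product is truncated at [B]. *)
Lemma B_quadratic : 100 * (S b * S b) <= B.
Proof.
  etransitivity; [|exact B_ge]. transitivity (S b ^ 4).
  - pose proof b_large. simpl. nia.
  - apply Nat.pow_le_mono_r; nia.
Qed.

Lemma B_linear : 100 * S b <= B.
Proof. pose proof B_quadratic. nia. Qed.

Ltac bounds := pose proof D_le_b as Db; pose proof b_large as b64; pose proof B_linear as Bb.

Lemma holds_eq s t : ok (LEq _ s t) <-> (ev s) = (ev t).
Proof. unfold LEq, LLt. simpl. lia. Qed.

Lemma holds_lt s t : ok (LLt _ s t) <-> (ev s) < (ev t).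
Proof. unfold LEq, LLt. simpl. lia. Qed.

Lemma holds_or f g : ok (LOr _ f g) <-> ok f \/ ok g.
Proof. unfold LOr, LImp. simpl. tauto. Qed.

Lemma holds_imp f g : ok (LImp _ f g) <-> (ok f -> ok g).
Proof. unfold LOr, LImp. simpl. tauto. Qed.

Lemma holds_iff f g : ok (LIff _ f g) <-> (ok f <-> ok g).
Proof. unfold LIff. cbn [holds]. rewrite !holds_imp. tauto. Qed.

Lemma holds_exB t F :
  (ev t) <= B -> ok (LExB _ t F) <-> exists x, x <= (ev t) /\ ok (F (TVar x)).
Proof.
  intros H. unfold LExB. simpl. split.
  - intros (x & _ & H1 & H2). eauto.
  - intros (x & H1 & H2). exists x. split; [lia|auto].
Qed.

Lemma holds_allB t F :
  (ev t) <= B -> ok (LAllB _ t F) <-> forall x, x <= (ev t) -> ok (F (TVar x)).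
Proof.
  intros H. unfold LAllB. cbn [holds]. rewrite holds_exB by auto. cbn [holds]. split.
  - intros H1 x Hx. apply NNPP. intros H2. apply H1. eauto.
  - intros H1 (x & Hx & H2). auto.
Qed.

Lemma holds_exD F : ok (exD _ D F) <-> exists x, x <= D /\ ok (F (TVar x)).
Proof. bounds. apply holds_exB. simpl. lia. Qed.

Lemma holds_exb F : ok (exb _ b F) <-> exists x, x <= b /\ ok (F (TVar x)).
Proof. bounds. apply holds_exB. simpl. lia. Qed.

Lemma teval_bit x i :
  teval B (TDigit x (TConst 1) i) = Nat.b2n (Nat.testbit (ev x) (ev i)).
Proof. bounds. cbn [teval]. rewrite Nat.min_r by lia. apply digit_1. Qed.

Lemma holds_nat p q x :
  (ev p) <= 2 * D -> (ev x) <= b ->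
  ok (qNat _ D b p q x) <->
  occurs w (ev p) (enc_nat (ev x)) /\ (ev q) = (ev p) + length (enc_nat (ev x)).
Proof.
  intros Hp Hx. bounds. unfold qNat. rewrite holds_exD. cbn [holds]. split.
  - intros (l & Hl & H1 & H2 & H3 & H4 & H5).
    rewrite holds_eq in H1. cbn [teval plus twice] in H1, H2.
    rewrite !Nat.min_r in H1 by lia. rewrite !Nat.min_r in H2 by lia.
    rewrite holds_allB in H4, H5 by (simpl; lia). cbn [teval] in H4, H5.
    assert (BL : bit_length (ev x) l).
    { split.
      - apply lt_pow2_bits. intros k Hk. destruct (le_lt_dec k b) as [Hkb|Hkb].
        + specialize (H5 k Hkb). rewrite holds_imp, holds_eq, teval_bit in H5.
          cbn [holds teval] in H5. specialize (H5 Hk). rewrite Nat.min_0_r in H5.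
          destruct (Nat.testbit (ev x) k); [discriminate|reflexivity].
        + apply (bits_above _ b); [|lia]. pose proof (Nat.pow_gt_lin_r 2 b). lia.
      - rewrite holds_or, holds_eq, holds_exD in H3. cbn [teval] in H3.
        destruct H3 as [H3|(l' & Hl' & H3 & H3')]; [left; lia|right].
        rewrite holds_eq in H3. rewrite holds_eq, teval_bit in H3'.
        cbn [teval plus] in H3, H3'. rewrite !Nat.min_r in H3 by lia.
        rewrite Nat.min_r in H3' by lia. replace (l - 1) with l' by lia.
        destruct (Nat.testbit (ev x) l'); [reflexivity|discriminate]. }
    rewrite (occurs_nat_iff _ _ _ l), (enc_nat_length _ l) by auto.
    split; [|lia]. split; [now replace ((ev p) + 2 * l) with ((ev p) + (l + l)) by lia|].
    intros i Hi. specialize (H4 i ltac:(lia)).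
    rewrite holds_imp, holds_lt in H4. specialize (H4 Hi). destruct H4 as [H4 H6].
    rewrite holds_or in H6. cbn [holds] in H4, H6. rewrite !holds_eq, !teval_bit in H6.
    cbn [teval plus twice] in H4, H6. rewrite !Nat.min_r in H4 by lia.
    rewrite !Nat.min_r in H6 by lia.
    replace (2 * i) with (i + i) by lia. split; [exact H4|].
    destruct H6 as [[H6 E]|[H6 E]]; destruct (Nat.testbit (ev x) i); auto; discriminate.
  - intros [Hocc Hq]. destruct (bit_length_exists (ev x)) as [l BL].
    pose proof (occurs_bound _ _ _ Hocc) as Hb.
    rewrite (enc_nat_length _ l) in Hq by auto.
    assert (Hl : 2 * l + 1 + (ev p) <= length w).
    { rewrite (enc_nat_length _ l) in Hb by auto. enough ((ev p) + (2 * l + 1) <= length w) by lia.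
      apply Hb. rewrite enc_nat_guarded. now destruct (guarded (bin (ev x))). }
    rewrite (occurs_nat_iff _ _ _ l) in Hocc by auto. destruct Hocc as [O1 O2].
    exists l. split; [lia|].
    rewrite holds_eq, holds_or, holds_eq, holds_exD, !holds_allB by (simpl; lia).
    cbn [teval plus twice]. rewrite !Nat.min_r by lia.
    split; [lia|]. split; [now replace (l + l) with (2 * l) by lia|]. split; [|split].
    + destruct BL as [_ [->|Ht]]; [left; lia|].
      destruct l as [|l]; [left; lia|]. right. exists l. split; [lia|].
      cbn [holds]. rewrite !holds_eq, teval_bit. cbn [teval plus].
      rewrite !Nat.min_r by lia. split; [lia|].
      rewrite Nat.sub_succ, Nat.sub_0_r in Ht. now rewrite Ht.
    + intros i Hi. rewrite holds_imp, holds_lt. cbn [teval]. intros Hil.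
      destruct (O2 i Hil) as [A1 A2]. cbn [holds]. rewrite holds_or. cbn [holds].
      rewrite !holds_eq, !teval_bit. cbn [teval plus twice]. rewrite !Nat.min_r by lia.
      replace (i + i) with (2 * i) by lia. split; [exact A1|]. rewrite A2.
      destruct (Nat.testbit (ev x) i); auto.
    + intros i Hi. rewrite holds_imp, holds_eq, teval_bit. cbn [holds teval].
      intros Hil. rewrite (bits_above _ l) by (auto; apply BL). simpl. lia.
Qed.

(** [R] has to be correct only on pairs satisfying [Inv]. The steps preserve this invariant, and it
    bounds both components by [b], which allows them to be stored as digits. *)
Lemma holds_chain R Rs (Inv : nat -> nat * nat -> Prop) i k a c z c' :
  (forall ti u v u' v', (ev ti) <= 2 * D -> Inv (ev ti) ((ev u), (ev v)) ->
     (ev u') <= b -> (ev v') <= b ->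
     (ok (R ti u v u' v') <-> Rs (ev ti) ((ev u), (ev v)) ((ev u'), (ev v')))) ->
  (forall i x y, Inv i x -> Rs i x y -> Inv (S i) y) ->
  (forall i x, i <= 2 * D -> Inv i x -> fst x <= b /\ snd x <= b) ->
  (ev i) + (ev k) <= 2 * D -> (ev k) <= D -> Inv (ev i) ((ev a), (ev c)) ->
  ok (qChain _ b R i k a c z c') <-> chain Rs (ev i) (ev k) ((ev a), (ev c)) ((ev z), (ev c')).
Proof.
  intros HR HI Hb Hik Hk H0. bounds. unfold qChain. cbn [holds]. split.
  - intros (Y & _ & C & _ & (((E1 & E2) & E3 & E4) & H)).
    rewrite holds_eq in E1, E2, E3, E4. rewrite holds_allB in H by lia.
    cbn [teval] in E1, E2, E3, E4. rewrite Nat.min_r in E1, E2 by lia.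
    set (f := fun j => (digit b Y j, digit b C j)).
    assert (Hstep : forall j, j < (ev k) -> Inv ((ev i) + j) (f j) ->
       Rs ((ev i) + j) (f j) (f (S j))).
    { intros j Hj Hinv. specialize (H j ltac:(lia)). rewrite holds_imp, holds_lt in H.
      specialize (H Hj). rewrite HR in H; cbn [teval plus] in *;
        rewrite ?(Nat.min_r B) in * by lia; rewrite ?Nat.add_1_r in *;
        auto using digit_le. lia. }
    assert (Hinv : forall j, j <= (ev k) -> Inv ((ev i) + j) (f j)).
    { induction j as [|j IH]; intros Hj.
      - rewrite Nat.add_0_r. unfold f. rewrite E1, E2. exact H0.
      - rewrite Nat.add_succ_r. eapply HI; [apply IH; lia|]. apply Hstep; [lia|].
        apply IH. lia. }
    pose proof (chain_seq Rs (ev i) (ev k) f) as Hc. unfold f in Hc.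
    rewrite E1, E2, E3, E4 in Hc. apply Hc. intros j Hj.
    apply Hstep; auto. apply Hinv. lia.
  - intros H. apply seq_chain in H as (f & F0 & Fk & Hf).
    assert (Hinv : forall j, j <= (ev k) -> Inv ((ev i) + j) (f j)).
    { induction j as [|j IH]; intros Hj.
      - rewrite Nat.add_0_r, F0. exact H0.
      - rewrite Nat.add_succ_r. eapply HI; [apply IH; lia|]. apply Hf. lia. }
    assert (Hfb : forall j, j <= (ev k) -> fst (f j) <= b /\ snd (f j) <= b).
    { intros j Hj. eapply Hb; [|apply Hinv; auto]. lia. }
    assert (HB : S b ^ S D <= B).
    { etransitivity; [|exact B_ge]. apply Nat.pow_le_mono_r; nia. }
    (* There are [D + 1] digits for the [ev k + 1] entries of the chain; those in excess are 0. *)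
    destruct (digits_exist b (fun j => if j <=? (ev k) then fst (f j) else 0) (S D))
      as (Y & HY & DY).
    { intros j _. destruct (Nat.leb_spec j (ev k)); [now apply Hfb|lia]. }
    destruct (digits_exist b (fun j => if j <=? (ev k) then snd (f j) else 0) (S D))
      as (C & HC & DC).
    { intros j _. destruct (Nat.leb_spec j (ev k)); [now apply Hfb|lia]. }
    assert (DYC : forall j, j <= (ev k) -> (digit b Y j, digit b C j) = f j).
    { intros j Hj. rewrite DY, DC by lia. apply Nat.leb_le in Hj as ->.
      now destruct (f j). }
    exists Y. split; [lia|]. exists C. split; [lia|].
    rewrite !holds_eq, holds_allB by lia. cbn [teval]. rewrite (Nat.min_r B 0) by lia.
    pose proof (DYC 0 ltac:(lia)) as E0. pose proof (DYC (ev k) ltac:(lia)) as Ek.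
    rewrite F0 in E0. rewrite Fk in Ek. inversion E0. inversion Ek.
    split; [auto|]. intros j Hj. rewrite holds_imp, holds_lt. cbn [teval]. intros Hjk.
    pose proof (DYC j ltac:(lia)) as Ej. pose proof (DYC (S j) ltac:(lia)) as ESj.
    rewrite HR; cbn [teval plus]; rewrite ?(Nat.min_r B) by lia; rewrite ?Nat.add_1_r;
      auto using digit_le; [|lia|rewrite Ej; apply Hinv; lia].
    rewrite Ej, ESj. apply Hf. exact Hjk.
Qed.

Lemma ev_plus t c : ev t + c <= B -> ev (plus _ t c) = ev t + c.
Proof. intros H. cbn [teval plus]. lia. Qed.

Lemma occurs_nat_le p x : occurs w p (enc_nat x) -> x <= b.
Proof.
  intros H. apply occurs_nat_lt in H.
  enough (2 ^ length w <= 2 ^ D) by lia. apply Nat.pow_le_mono_r; lia.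
Qed.

Lemma enc_nat_nonempty x : enc_nat x <> [].
Proof. rewrite enc_nat_guarded. now destruct (guarded (bin x)). Qed.

Lemma occurs_nat_end p x : occurs w p (enc_nat x) -> p + length (enc_nat x) <= length w.
Proof. intros H. eapply occurs_bound; eauto using enc_nat_nonempty. Qed.

(** * Reading the lists of edges and labels *)

Definition item (p p' : nat) : Prop :=
  exists s t, occurs w p (true :: enc_pair (s, t)) /\
    p' = p + length (true :: enc_pair (s, t)).

Lemma item_bound p p' : item p p' -> p' <= length w.
Proof. intros (s & t & H & ->). eapply occurs_bound; eauto. easy. Qed.

Lemma holds_item p p' : ev p <= D -> ok (qItem _ D b p p') <-> item (ev p) (ev p').
Proof.
  intros Hp. bounds. unfold qItem, item. cbn [holds]. rewrite holds_exb. split.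
  - intros (H1 & s & Hs & H). rewrite holds_exb in H. destruct H as (t & Ht & H).
    rewrite holds_exD in H. destruct H as (c & Hc & H). cbn [holds] in H.
    rewrite !holds_nat in H by (rewrite ?ev_plus; simpl; lia).
    rewrite ev_plus in H by lia. cbn [teval] in H.
    destruct H as ((O1 & E1) & (O2 & E2)). subst c. exists s, t. split.
    + rewrite occurs_cons. split; [auto|]. unfold enc_pair. rewrite occurs_app. auto.
    + unfold enc_pair. simpl. rewrite length_app. lia.
  - intros (s & t & H & E). rewrite occurs_cons in H. unfold enc_pair in H.
    rewrite occurs_app in H. cbn [fst snd] in H. destruct H as (H1 & H2 & H3).
    split; [auto|]. exists s. split; [eapply occurs_nat_le; eauto|].
    rewrite holds_exb. exists t. split; [eapply occurs_nat_le; eauto|].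
    pose proof (occurs_nat_le _ _ H2). pose proof (occurs_nat_le _ _ H3).
    pose proof (occurs_nat_end _ _ H2). pose proof (occurs_nat_end _ _ H3).
    rewrite holds_exD. exists (ev p + 1 + length (enc_nat s)). split; [lia|].
    cbn [holds]. rewrite !holds_nat by (rewrite ?ev_plus; simpl; lia).
    rewrite ev_plus by lia. cbn [teval]. split; [auto|]. split; [auto|].
    rewrite E. unfold enc_pair. simpl. rewrite length_app. lia.
Qed.

Definition item_step (i : nat) (x y : nat * nat) : Prop :=
  item (fst x) (fst y) /\ snd y = 0.

Lemma holds_items p p' : ev p <= D ->
  ok (qItems _ D b p p') <->
  exists k, k <= D /\ chain item_step 0 k (ev p, 0) (ev p', 0).
Proof.
  intros Hp. bounds. unfold qItems. rewrite holds_exD.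
  assert (E : forall k, k <= D ->
    ok (qChain nat b (fun _ u _ u' v' => LAnd (qItem nat D b u u') (LEq nat v' (TConst 0)))
       (TConst 0) (TVar k) p (TConst 0) p' (TConst 0)) <->
    chain item_step 0 k (ev p, 0) (ev p', 0)).
  { intros k Hk.
    rewrite (holds_chain _ item_step (fun _ x => fst x <= D /\ snd x = 0)); cbn [teval];
      rewrite ?Nat.min_0_r; try lia; cbn [fst snd]; try tauto.
    - intros ti u v u' v' Hti [Hu Hv] Hu' Hv'. cbn [holds fst snd] in *.
      rewrite holds_item, holds_eq by auto. cbn [teval]. rewrite Nat.min_0_r.
      unfold item_step. cbn [fst snd]. tauto.
    - intros i x y _ [H1 H2]. split; [|auto]. apply item_bound in H1. lia. }
  split; intros (k & Hk & H); exists k; (split; [auto|]); apply E; auto.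
Qed.

Definition enc_items (L : list (nat * nat)) : list bool :=
  flat_map (fun x => true :: enc_pair x) L.

Lemma enc_list_items L : enc_list enc_pair L = enc_items L ++ [false].
Proof. reflexivity. Qed.

Lemma occurs_pair_inj p s t s' t' :
  occurs w p (enc_pair (s, t)) -> occurs w p (enc_pair (s', t')) -> s = s' /\ t = t'.
Proof.
  unfold enc_pair. cbn [fst snd]. rewrite !occurs_app. intros [H1 H2] [H3 H4].
  pose proof (occurs_nat_inj _ _ _ _ H1 H3). subst s'.
  split; [auto|]. eapply occurs_nat_inj; eauto.
Qed.

(** Since encodings of pairs are uniquely readable, a chain of items starting at a list cannot leave
    the boundaries between its entries, and the closing [false] stops it at the end. *)
Lemma items_reach L q : occurs w q (enc_list enc_pair L) ->
  forall z, (exists k, k <= D /\ chain item_step 0 k (q, 0) (z, 0)) <->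
    exists L1 L2, L = L1 ++ L2 /\ z = q + length (enc_items L1).
Proof.
  intros HL z. split.
  - intros (k & _ & H). revert H. generalize 0 at 1 as i. revert q L HL.
    induction k as [|k IH]; intros q L HL i H.
    + injection H as <-. exists [], L. split; [reflexivity|simpl; lia].
    + destruct H as ([q' v] & [(s & t & O & E) Ev] & H). cbn [fst snd] in *. subst v.
      rewrite enc_list_items in HL. destruct L as [|[s' t'] L].
      * simpl in HL. rewrite occurs_cons in HL, O. destruct HL, O. congruence.
      * simpl in HL. rewrite occurs_cons in HL, O. destruct HL as [_ HL], O as [_ O].
        rewrite <- app_assoc, occurs_app in HL. destruct HL as [O' HL].
        destruct (occurs_pair_inj _ _ _ _ _ O O') as [<- <-].
        destruct (IH q' L) with (i := S i) as (L1 & L2 & -> & ->).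
        -- rewrite E. cbn [length]. now rewrite Nat.add_succ_r, <- Nat.add_succ_l, <- Nat.add_1_r.
        -- exact H.
        -- exists ((s, t) :: L1), L2. split; [reflexivity|]. rewrite E. simpl.
           rewrite length_app. lia.
  - intros (L1 & L2 & -> & ->).
    rewrite enc_list_items in HL. unfold enc_items in HL.
    rewrite flat_map_app, <- app_assoc, occurs_app in HL. destruct HL as [HL _].
    exists (length L1). split.
    + destruct L1 as [|x L1]; [simpl; lia|].
      assert (Hne : flat_map (fun x => true :: enc_pair x) (x :: L1) <> []) by easy.
      pose proof (occurs_bound _ _ _ HL Hne).
      enough (length (x :: L1) <= length (enc_items (x :: L1))) by (unfold enc_items in *; lia).
      generalize (x :: L1) as l. induction l as [|y l IH]; simpl; [lia|].
      rewrite length_app. lia.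
    + generalize 0 at 1 as i. revert q HL.
      induction L1 as [|[s t] L1 IH]; intros q HL i.
      * simpl. f_equal. lia.
      * cbn [flat_map] in HL. rewrite occurs_app in HL. destruct HL as [O HL].
        exists (q + length (true :: enc_pair (s, t)), 0). split.
        -- split; [|reflexivity]. exists s, t. auto.
        -- specialize (IH _ HL (S i)). cbn [enc_items flat_map].
           rewrite length_app, Nat.add_assoc. exact IH.
Qed.

Lemma holds_end q r L : ev q <= D -> occurs w (ev q) (enc_list enc_pair L) ->
  ok (qEnd _ D b q r) <-> ev r = ev q + length (enc_list enc_pair L).
Proof.
  intros Hq HL. bounds. unfold qEnd. rewrite holds_exD.
  rewrite enc_list_items, length_app. cbn [length]. split.
  - intros (p & Hp & H1 & H2 & H3). rewrite holds_items, (items_reach L) in H1 by auto.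
    destruct H1 as (L1 & L2 & -> & E). cbn [holds teval] in *.
    rewrite holds_eq, ev_plus in H3 by (simpl; lia). cbn [teval] in H3. subst p.
    rewrite enc_list_items in HL. unfold enc_items in *. rewrite flat_map_app in *.
    rewrite <- app_assoc, occurs_app in HL. destruct HL as [_ HL].
    destruct L2 as [|x L2]; [rewrite length_app; simpl; lia|].
    simpl in HL. rewrite occurs_cons in HL. destruct HL. congruence.
  - intros E. rewrite enc_list_items in HL.
    pose proof (occurs_bound _ _ _ HL ltac:(now destruct (enc_items L))) as Hb.
    rewrite length_app in Hb. simpl in Hb.
    exists (ev q + length (enc_items L)). split; [lia|]. cbn [holds].
    rewrite holds_items, (items_reach L), holds_eq, ev_plus by (auto; simpl; lia).
    cbn [teval]. split; [exists L, []; now rewrite app_nil_r|]. split; [|lia].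
    rewrite occurs_app in HL. destruct HL as [_ HL]. now rewrite occurs_single in HL.
Qed.

Lemma holds_mem q s t L : ev q <= D -> ev s <= b -> ev t <= b ->
  occurs w (ev q) (enc_list enc_pair L) ->
  ok (qMem _ D b q s t) <-> In (ev s, ev t) L.
Proof.
  intros Hq Hs Ht HL. bounds. unfold qMem. rewrite holds_exD. split.
  - intros (p & Hp & H1 & H2 & H3). rewrite holds_items, (items_reach L) in H1 by auto.
    destruct H1 as (L1 & L2 & -> & E). cbn [teval] in E. cbn [holds] in H2.
    rewrite holds_exD in H3. destruct H3 as (c & Hc & H3 & H4).
    rewrite holds_exD in H4. destruct H4 as (p' & Hp' & H4).
    rewrite holds_nat in H3 by (rewrite ?ev_plus; simpl; lia).
    rewrite holds_nat in H4 by (simpl; lia).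
    rewrite ev_plus in H3 by (simpl; lia). cbn [teval] in *.
    rewrite enc_list_items in HL. unfold enc_items in *. rewrite flat_map_app in HL.
    rewrite <- app_assoc, occurs_app, <- E in HL. destruct HL as [_ HL].
    destruct L2 as [|[s' t'] L2].
    { simpl in HL. rewrite occurs_single in HL. congruence. }
    simpl in HL. rewrite occurs_cons, <- app_assoc, occurs_app in HL.
    destruct HL as (_ & HL & _).
    destruct (occurs_pair_inj (p + 1) (ev s) (ev t) s' t') as [-> ->].
    + unfold enc_pair. rewrite occurs_app. destruct H3 as [O1 ->], H4 as [O2 _]. auto.
    + exact HL.
    + apply in_elt.
  - intros HIn. apply in_split in HIn as (L1 & L2 & ->).
    rewrite enc_list_items in HL. pose proof HL as HL'. unfold enc_items in HL'.
    rewrite flat_map_app, <- app_assoc, occurs_app in HL'. destruct HL' as [_ HL'].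
    set (p := ev q + length (enc_items L1)).
    change (ev q + length (flat_map (fun x => true :: enc_pair x) L1)) with p in HL'.
    simpl in HL'. rewrite occurs_cons, <- app_assoc, occurs_app in HL'.
    destruct HL' as (H1 & H2 & _). unfold enc_pair in H2. rewrite occurs_app in H2.
    destruct H2 as [O1 O2]. cbn [fst snd] in *.
    pose proof (occurs_nat_end _ _ O1). pose proof (occurs_nat_end _ _ O2).
    exists p. split; [lia|]. cbn [holds].
    rewrite holds_items, (items_reach (L1 ++ (ev s, ev t) :: L2)) by auto.
    split; [eexists; eexists; split; [reflexivity|reflexivity]|].
    split; [exact H1|]. rewrite holds_exD.
    exists (p + 1 + length (enc_nat (ev s))). split; [lia|]. cbn [holds].
    rewrite holds_exD, holds_nat by (rewrite ?ev_plus; simpl; lia).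
    rewrite ev_plus by (simpl; lia). cbn [teval]. split; [auto|].
    eexists. split; [|rewrite holds_nat by (simpl; lia); cbn [teval]; split; [exact O2|reflexivity]].
    lia.
Qed.

(** * Reading formulas in prefix notation *)

Lemma holds_tag p b0 b1 b2 : ev p <= D ->
  ok (qTag _ p b0 b1 b2) <-> occurs w (ev p) [b0; b1; b2].
Proof.
  intros Hp. bounds. unfold qTag. cbn [holds]. rewrite !ev_plus by lia.
  rewrite !occurs_cons, <- Nat.add_assoc. split; [|tauto].
  intros (H1 & H2 & H3). repeat split; auto. apply occurs_nil.
Qed.

Definition path_tag (e : bool) : list bool :=
  if e then [false; true; true] else [true; false; false].

Lemma holds_path p : ev p <= D ->
  ok (qPath _ p) <-> exists e, occurs w (ev p) (path_tag e).
Proof.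
  intros Hp. unfold qPath. rewrite holds_or, !holds_tag by auto. split.
  - intros [H|H]; [exists true|exists false]; exact H.
  - intros [[|] H]; auto.
Qed.

(* [token u r]: the word [u] encodes a constructor with [r] formulas to follow. *)
Inductive token : list bool -> nat -> Prop :=
  | token_atom x : token ([false; false; false] ++ enc_nat x) 0
  | token_and : token [false; false; true] 2
  | token_not : token [false; true; false] 1
  | token_next e : token (path_tag e ++ [false]) 1
  | token_until e n m : token (path_tag e ++ [true] ++ enc_nat n ++ enc_nat m) 2.

Lemma path_tag_length e : length (path_tag e) = 3.
Proof. now destruct e. Qed.

Lemma token_length u r : token u r -> 1 <= length u.
Proof. destruct 1; try destruct e; simpl; lia. Qed.

Lemma holds_token p k p' k' : ev p <= D -> ev k <= b -> ev k' <= b ->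
  ok (qToken _ D b p k p' k') <->
  exists u r, token u r /\ occurs w (ev p) u /\ ev p' = ev p + length u /\
    1 <= ev k /\ ev k' + 1 = ev k + r.
Proof.
  intros Hp Hk Hk'. bounds. unfold qToken. rewrite !holds_or. cbn [holds].
  rewrite holds_exb, holds_exD, !holds_tag, holds_path by auto.
  rewrite !holds_eq. rewrite !ev_plus by lia.
  assert (E1 : ev (TConst 1) = 1) by (simpl; lia). rewrite E1. split.
  - intros [(H1 & (x & Hx & H2) & H3)|[(H1 & H2 & H3 & H4)|[(H1 & H2 & H3 & H4)|
      [([e H1] & H2 & H3 & H4 & H5)|([e H1] & H2 & (c & Hc & H3) & H4 & H5)]]]].
    + rewrite holds_nat in H2 by (rewrite ?ev_plus; simpl; lia).
      rewrite ev_plus in H2 by lia. cbn [teval] in H2. destruct H2 as [H2 H2'].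
      eexists; eexists; split; [apply (token_atom x)|].
      rewrite occurs_app, length_app. cbn [length]. split; [auto|]. lia.
    + eexists; eexists; split; [apply token_and|]. cbn [length]. split; [auto|]. lia.
    + eexists; eexists; split; [apply token_not|]. cbn [length]. split; [auto|]. lia.
    + eexists; eexists; split; [apply (token_next e)|].
      rewrite occurs_app, occurs_single, length_app, path_tag_length. cbn [length].
      split; [auto|]. lia.
    + rewrite holds_exb in H3. destruct H3 as (n & Hn & H3).
      rewrite holds_exb in H3. destruct H3 as (m & Hm & H3). cbn [holds] in H3.
      rewrite !holds_nat in H3 by (rewrite ?ev_plus; simpl; lia).
      rewrite ev_plus in H3 by lia. cbn [teval] in H3. destruct H3 as [[O1 O2] [O3 O4]].
      subst c. eexists; eexists; split; [apply (token_until e n m)|].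
      rewrite !occurs_app, occurs_single, !length_app, path_tag_length. cbn [length].
      split; [|lia]. rewrite <- !Nat.add_assoc in *. auto.
  - intros (u & r & Ht & O & E2 & Hk1 & E3). inversion Ht; subst u r; clear Ht.
    + left. rewrite occurs_app, length_app in *. cbn [length] in *. destruct O as [O1 O2].
      split; [auto|]. split; [|lia]. exists x. pose proof (occurs_nat_le _ _ O2).
      split; [auto|]. rewrite holds_nat by (rewrite ?ev_plus; simpl; lia).
      rewrite ev_plus by lia. cbn [teval]. split; [auto|lia].
    + right; left. cbn [length] in *. split; [auto|]. lia.
    + right; right; left. cbn [length] in *. split; [auto|]. lia.
    + right; right; right; left.
      rewrite occurs_app, occurs_single, length_app, path_tag_length in *.
      cbn [length] in *. destruct O as [O1 O2].
      split; [now exists e|]. split; [auto|]. lia.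
    + right; right; right; right.
      rewrite !occurs_app, occurs_single, !length_app, path_tag_length in *.
      cbn [length] in *. destruct O as (O1 & O2 & O3 & O4).
      split; [now exists e|]. split; [auto|]. split; [|lia].
      pose proof (occurs_nat_le _ _ O3). pose proof (occurs_nat_le _ _ O4).
      pose proof (occurs_nat_end _ _ O3). pose proof (occurs_nat_end _ _ O4).
      exists (ev p + 3 + 1 + length (enc_nat n)). split; [lia|].
      rewrite holds_exb. exists n. split; [auto|].
      rewrite holds_exb. exists m. split; [auto|]. cbn [holds].
      rewrite !holds_nat by (rewrite ?ev_plus; simpl; lia).
      rewrite ev_plus by lia. cbn [teval].
      replace (ev p + 4) with (ev p + 3 + 1) by lia. split; [auto|]. split; [auto|lia].
Qed.

Definition token_step (i : nat) (x y : nat * nat) : Prop :=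
  exists u r, token u r /\ occurs w (fst x) u /\ fst y = fst x + length u /\
    1 <= snd x /\ snd y + 1 = snd x + r.

Lemma token_step_bound i x y : token_step i x y -> fst y <= length w.
Proof.
  intros (u & r & Ht & O & -> & _). apply (occurs_bound _ _ _ O).
  intros ->. now apply token_length in Ht.
Qed.

Definition enc_forms (fs : list form) : list bool := flat_map enc_form fs.

(** The chain is read from its end: what follows a token is a list [fs] of encoded formulas, and the
    token takes as many of them as it has arguments and replaces them by one formula. *)
Lemma token_chain_forms i k p c q : chain token_step i k (p, c) (q, 0) ->
  exists fs, length fs = c /\ occurs w p (enc_forms fs) /\ q = p + length (enc_forms fs).
Proof.
  revert i p c. induction k as [|k IH]; intros i p c H.
  - injection H as <- ->. exists []. split; [reflexivity|]. split; [apply occurs_nil|].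
    simpl. lia.
  - destruct H as ([p' c'] & (u & r & Ht & O & E1 & Hc & E2) & H). cbn [fst snd] in *.
    destruct (IH _ _ _ H) as (fs & Hl & O' & ->). subst p'.
    assert (Huse : forall (f : form) rest, c = S (length rest) ->
      enc_form f ++ enc_forms rest = u ++ enc_forms fs ->
      exists fs', length fs' = c /\ occurs w p (enc_forms fs') /\
        p + length u + length (enc_forms fs) = p + length (enc_forms fs')).
    { intros f rest Hlen E. exists (f :: rest). split; [simpl; lia|].
      cbn [enc_forms flat_map]. fold (enc_forms rest). rewrite E, occurs_app, length_app.
      split; [auto|lia]. }
    inversion Ht; subst u r; clear Ht.
    + apply (Huse (FAtom x) fs); [lia|]. reflexivity.
    + destruct fs as [|f [|g fs]]; cbn [length] in Hl; try lia.
      apply (Huse (FAnd f g) fs); [simpl in *; lia|]. simpl. now rewrite <- !app_assoc.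
    + destruct fs as [|f fs]; cbn [length] in Hl; try lia.
      apply (Huse (FNot f) fs); [simpl in *; lia|]. reflexivity.
    + destruct fs as [|f fs]; cbn [length] in Hl; try lia.
      apply (Huse (if e then FE (PX f) else FA (PX f)) fs); [simpl in *; lia|].
      now destruct e.
    + destruct fs as [|f [|g fs]]; cbn [length] in Hl; try lia.
      apply (Huse (if e then FE (PU n m f g) else FA (PU n m f g)) fs);
        [simpl in *; lia|]. destruct e; simpl; now rewrite <- !app_assoc.
Qed.

(** [token_step] ignores the index, so chains indexed from 0 can be prolonged without shifting. *)
Lemma token_chain_step i k x y :
  token_step 0 x y -> chain token_step 0 k y i -> chain token_step 0 (S k) x i.
Proof.
  intros H1 H2. exists y. split; [exact H1|].
  revert H2. generalize 0 at 1 as j, 1 as j'. clear. revert y.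
  induction k as [|k IH]; intros y j j' H; [exact H|].
  destruct H as (z & H1 & H2). exists z. split; [exact H1|]. eapply IH; eauto.
Qed.

Lemma token_chain_app k k' x y z :
  chain token_step 0 k x y -> chain token_step 0 k' y z ->
  chain token_step 0 (k + k') x z.
Proof.
  intros H1 H2. eapply chain_app; [exact H1|].
  revert H2. generalize 0 at 1 as j, (0 + k) as j'. clear. revert y.
  induction k' as [|k' IH]; intros y j j' H; [exact H|].
  destruct H as (u & H1 & H2). exists u. split; [exact H1|]. eapply IH; eauto.
Qed.

(** The induction needs an arbitrary number [c] of formulas still pending after the present one. A
    path formula is taken together with the tag of its quantifier because one token covers both. *)
Lemma form_token_chain_mutual :
  (forall f p c, occurs w p (enc_form f) -> exists k, k <= length (enc_form f) /\
     chain token_step 0 k (p, S c) (p + length (enc_form f), c)) /\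
  (forall g e p c, occurs w p (path_tag e ++ enc_pform g) ->
     exists k, k <= length (path_tag e ++ enc_pform g) /\
     chain token_step 0 k (p, S c) (p + length (path_tag e ++ enc_pform g), c)).
Proof.
  assert (Hstep : forall u r p c q d k, token u r -> occurs w p u -> 
    chain token_step 0 k (p + length u, c + r) (q, d) ->
    chain token_step 0 (S k) (p, S c) (q, d)).
  { intros u r p c q d k Ht O H. eapply token_chain_step; [|exact H].
    exists u, r. cbn [fst snd]. repeat split; auto; lia. }
  apply form_pform_ind.
  - intros x p c O. exists 1. cbn [enc_form]. split; [simpl; lia|].
    apply (Hstep _ _ _ _ _ _ _ (token_atom x) O). simpl. now rewrite Nat.add_0_r.
  - intros f IHf g IHg p c O. cbn [enc_form] in *. rewrite !length_app.
    rewrite !occurs_app in O. destruct O as (O1 & O2 & O3).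
    destruct (IHf _ (S c) O2) as (k1 & L1 & C1). destruct (IHg _ c O3) as (k2 & L2 & C2).
    exists (S (k1 + k2)). split; [simpl; lia|].
    apply (Hstep _ _ _ _ _ _ _ token_and O1).
    replace (c + 2) with (S (S c)) by lia. rewrite !Nat.add_assoc.
    eapply token_chain_app; eauto.
  - intros f IHf p c O. cbn [enc_form] in *. rewrite !length_app.
    rewrite !occurs_app in O. destruct O as (O1 & O2).
    destruct (IHf _ c O2) as (k1 & L1 & C1). exists (S k1). split; [simpl; lia|].
    apply (Hstep _ _ _ _ _ _ _ token_not O1).
    replace (c + 1) with (S c) by lia. rewrite Nat.add_assoc. exact C1.
  - intros g IH p c O. exact (IH true p c O).
  - intros g IH p c O. exact (IH false p c O).
  - intros f IHf e p c O. cbn [enc_pform] in *. rewrite app_assoc in *.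
    rewrite occurs_app in O. destruct O as (O1 & O2).
    destruct (IHf _ c O2) as (k1 & L1 & C1). exists (S k1). rewrite length_app.
    split; [rewrite length_app; simpl; lia|].
    apply (Hstep _ _ _ _ _ _ _ (token_next e) O1).
    replace (c + 1) with (S c) by lia. rewrite Nat.add_assoc. exact C1.
  - intros n m f IHf g IHg e p c O. cbn [enc_pform] in *.
    replace (path_tag e ++ [true] ++ enc_nat n ++ enc_nat m ++ enc_form f ++ enc_form g)
      with ((path_tag e ++ [true] ++ enc_nat n ++ enc_nat m) ++ enc_form f ++ enc_form g) in *
      by (now rewrite <- !app_assoc).
    rewrite occurs_app in O. destruct O as (O1 & O2). rewrite occurs_app in O2.
    destruct O2 as (O2 & O3).
    destruct (IHf _ (S c) O2) as (k1 & L1 & C1). destruct (IHg _ c O3) as (k2 & L2 & C2).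
    exists (S (k1 + k2)). rewrite length_app. pose proof (token_length _ _ (token_until e n m)).
    rewrite (length_app (enc_form f)).
    split; [lia|].
    apply (Hstep _ _ _ _ _ _ _ (token_until e n m) O1).
    replace (c + 2) with (S (S c)) by lia. rewrite !Nat.add_assoc.
    eapply token_chain_app; eauto.
Qed.

Lemma holds_form p q : ev p <= D ->
  ok (qForm _ D b p q) <->
  exists f, occurs w (ev p) (enc_form f) /\ ev q = ev p + length (enc_form f).
Proof.
  intros Hp. bounds. unfold qForm. rewrite holds_exD.
  assert (E : forall k, k <= D ->
    ok (qChain nat b (fun _ u v u' v' => qToken nat D b u v u' v')
       (TConst 0) (TVar k) p (TConst 1) q (TConst 0)) <->
    chain token_step 0 k (ev p, 1) (ev q, 0)).
  { intros k Hk.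
    (* A token adds at most one pending formula, so the counter stays within the range of a
       digit. *)
    rewrite (holds_chain _ token_step (fun i x => fst x <= D /\ snd x <= 1 + i)).
    - cbn [teval]. rewrite Nat.min_0_r, (Nat.min_r B 1) by lia. tauto.
    - intros ti u v u' v' Hti [Hu Hv] Hu' Hv'. cbn [fst snd] in *.
      rewrite holds_token by lia. reflexivity.
    - intros i x y [H1 H2] Hs. pose proof (token_step_bound _ _ _ Hs).
      split; [lia|]. destruct Hs as (u & r & Ht & _ & _ & Hc & Er).
      assert (r <= 2) by (inversion Ht; lia). lia.
    - intros i x Hi [H1 H2]. lia.
    - cbn [teval]. lia.
    - cbn [teval]. lia.
    - cbn [teval fst snd]. lia. }
  split.
  - intros (k & Hk & H). rewrite E in H by auto.
    apply token_chain_forms in H as (fs & Hl & O & Eq).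
    destruct fs as [|f [|g fs]]; try discriminate. exists f.
    cbn [enc_forms flat_map] in *. rewrite app_nil_r in *. auto.
  - intros (f & O & Eq).
    destruct (proj1 form_token_chain_mutual f _ 0 O) as (k & Hk & H).
    assert (Hb : ev p + length (enc_form f) <= length w).
    { apply (occurs_bound _ _ _ O). now destruct f. }
    exists k. split; [lia|]. rewrite E by lia. now rewrite Eq.
Qed.

Lemma ev_mul s t : ev s <= b -> ev t <= b -> ev (TMul s t) = ev s * ev t.
Proof.
  intros Hs Ht. pose proof B_quadratic. cbn [teval]. rewrite Nat.min_r; [reflexivity|nia].
Qed.

Lemma ev_const c : c <= b -> ev (TConst c) = c.
Proof. intros H. bounds. cbn [teval]. lia. Qed.

Lemma chain_invariant (R : nat -> nat * nat -> nat * nat -> Prop) (P : nat * nat -> Prop) i k x y :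
  (forall i x y, R i x y -> P y) -> P x -> chain R i k x y -> P y.
Proof.
  intros HR. revert i x. induction k as [|k IH]; intros i x Hx H.
  - simpl in H. now subst y.
  - destruct H as (x' & H1 & H2). eauto.
Qed.

(** * Meaning of the formulas about walks and lassos *)

Section Graph_semantics.
Variable Edge : term nat -> term nat -> formula nat.
Variable edges : list (nat * nat).
Hypothesis holds_Edge : forall u v, ev u <= b -> ev v <= b ->
  (ok (Edge u v) <-> edge edges (ev u) (ev v)).
Hypothesis edges_bound : forall u v, edge edges u v -> u < b /\ v < b.
Hypothesis edges_length : 2 * length edges <= D.

(** A walk consults [F] and [G] only at vertices that it leaves, so agreement is needed only at
    states with an outgoing edge, the ones that the table covers. *)
Definition represents (F : term nat -> formula nat) (P : nat -> Prop) : Prop :=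
  forall u, ev u <= b -> (exists v, edge edges (ev u) v) -> (ok (F u) <-> P (ev u)).

Lemma represents_false : represents (qFalse nat) no_target.
Proof. intros u _ _. unfold qFalse, no_target. rewrite holds_lt. lia. Qed.

Lemma holds_weighted F G FP GP n m i k a c z c' :
  represents F FP -> represents G GP -> ev n <= b -> ev m <= b ->
  ev i + ev k <= 2 * D -> ev k <= D -> ev a <= b -> ev c <= ev i + D ->
  ok (qWeighted _ b Edge F G n m i k a c z c') <->
  chain (weighted_step edges FP GP (ev n) (ev m)) (ev i) (ev k)
    (ev a, ev c) (ev z, ev c').
Proof.
  intros HF HG Hn Hm Hik Hk Ha Hc. bounds. unfold qWeighted.
  apply holds_chain with (Inv := fun i x => fst x <= b /\ snd x <= i + D); auto.
  - intros ti u v u' v' Hti [Hu Hv] Hu' Hv'. cbn [fst snd holds] in *.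
    rewrite holds_Edge, !holds_imp, holds_lt, !holds_eq, !ev_mul, ev_plus by lia.
    cbn [holds]. unfold weighted_step. cbn [fst snd].
    split; intros (H1 & H2);
      pose proof (HF u Hu (ex_intro _ _ H1)); pose proof (HG u Hu (ex_intro _ _ H1)); tauto.
  - intros j x y [H1 H2] (E1 & E2 & E3 & _). split; [apply edges_bound in E1; lia|].
    destruct (classic (FP (fst x))) as [h|h]; [rewrite E2 by auto|rewrite E3 by auto]; lia.
  - intros j x Hj [H1 H2]. lia.
Qed.

Lemma holds_free G GP k a z :
  represents G GP -> ev k <= D -> ev a <= b ->
  ok (qFree _ b Edge G k a z) <->
  chain (free_step edges GP) 0 (ev k) (ev a, 0) (ev z, 0).
Proof.
  intros HG Hk Ha. bounds. unfold qFree.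
  rewrite (holds_chain _ (free_step edges GP) (fun i x => fst x <= b /\ snd x = 0)).
  - rewrite !ev_const by lia. tauto.
  - intros ti u v u' v' Hti [Hu Hv] Hu' Hv'. cbn [fst snd holds] in *.
    rewrite holds_Edge, holds_eq, ev_const by lia. unfold free_step. cbn [fst snd].
    split; intros (H1 & H2); pose proof (HG u Hu (ex_intro _ _ H1)); tauto.
  - intros j x y [H1 H2] (E1 & _ & E2). split; [apply edges_bound in E1; lia|auto].
  - intros j x Hj [H1 H2]. lia.
  - rewrite ev_const by lia. lia.
  - auto.
  - rewrite !ev_const by lia. auto.
Qed.

Lemma free_chain_bound GP i k a z :
  a <= b -> chain (free_step edges GP) i k (a, 0) (z, 0) -> z <= b.
Proof.
  intros Ha H. apply (chain_invariant _ (fun x => fst x <= b)) in H; auto.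
  intros j x y (E & _). apply edges_bound in E. lia.
Qed.

Lemma weighted_chain_bound FP GP n m i k a c z c' :
  a <= b -> chain (weighted_step edges FP GP n m) i k (a, c) (z, c') -> z <= b.
Proof.
  intros Ha H. apply (chain_invariant _ (fun x => fst x <= b)) in H; auto.
  intros j x y (E & _). apply edges_bound in E. lia.
Qed.

Lemma holds_live s : ev s <= b -> ok (qLive _ D b Edge s) <-> live edges (ev s).
Proof.
  intros Hs. bounds. rewrite (live_iff_chains _ D) by auto. unfold qLive, live_chains.
  rewrite holds_exb. split.
  - intros (x & Hx & H). rewrite holds_exD in H. destruct H as (k1 & Hk1 & H).
    rewrite holds_exD in H. destruct H as (k2 & Hk2 & H). cbn [holds] in H.
    rewrite !(holds_free _ _ _ _ _ represents_false) in H by auto.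
    rewrite ev_const in H by lia. cbn [teval] in H. exists x, k1, k2. tauto.
  - intros (x & k1 & k2 & Hk1 & Hk2 & H & H1 & H2).
    pose proof (free_chain_bound _ _ _ _ _ Hs H1) as Hx.
    exists x. split; [auto|]. rewrite holds_exD. exists k1. split; [auto|].
    rewrite holds_exD. exists k2. split; [auto|]. cbn [holds].
    rewrite !(holds_free _ _ _ _ _ represents_false) by auto.
    rewrite ev_const by lia. auto.
Qed.

(** The last vertex of the walk is not left by any of its edges, so [T] must be correct at all
    states up to [b], not only at sources. *)
Lemma holds_good_walk F FP T TP n m s :
  represents F FP -> (forall z, ev z <= b -> (ok (T z) <-> TP (ev z))) ->
  ev n <= b -> ev m <= b -> ev s <= b ->
  ok (qGoodWalk _ D b Edge F T n m s) <->
  good_walk edges (weight (ev n) (ev m) FP) TP (ev s).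
Proof.
  intros HF HT Hn Hm Hs. bounds. rewrite (good_walk_iff_chains _ D) by auto.
  unfold qGoodWalk, good_walk_chains. rewrite holds_or, !holds_exb.
  apply ZifyClasses.or_morph.
  - split.
    + intros (z & Hz & H). rewrite holds_exD in H. destruct H as (k & Hk & H).
      rewrite holds_exD in H. destruct H as (c & Hc & H). cbn [holds] in H.
      rewrite (holds_weighted _ _ _ _ _ _ _ _ _ _ _ _ HF represents_false) in H
        by (rewrite ?ev_const; cbn [teval]; lia).
      rewrite HT, !ev_mul, !ev_const in H by (cbn [teval]; lia). cbn [teval] in H.
      exists z, k, c. tauto.
    + intros (z & k & c & Hk & Hc & H1 & H2 & H3 & H4).
      pose proof (weighted_chain_bound _ _ _ _ _ _ _ _ _ _ Hs H2) as Hz.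
      exists z. split; [auto|]. rewrite holds_exD. exists k. split; [auto|].
      rewrite holds_exD. exists c. split; [auto|]. cbn [holds].
      rewrite (holds_weighted _ _ _ _ _ _ _ _ _ _ _ _ HF represents_false)
        by (rewrite ?ev_const; cbn [teval]; lia).
      rewrite HT, !ev_mul, !ev_const by (cbn [teval]; lia). auto.
  - split.
    + intros (x & Hx & H). rewrite holds_exb in H. destruct H as (z & Hz & H).
      rewrite holds_exD in H. destruct H as (k1 & Hk1 & H).
      rewrite holds_exD in H. destruct H as (k2 & Hk2 & H).
      rewrite holds_exD in H. destruct H as (k3 & Hk3 & H).
      rewrite holds_exD in H. destruct H as (c & Hc & H). cbn [holds] in H.
      rewrite (holds_weighted _ _ _ _ _ _ _ _ _ _ _ _ HF represents_false) in H
        by (rewrite ?ev_const; cbn [teval]; lia).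
      rewrite !(holds_free _ _ _ _ _ represents_false) in H by auto.
      rewrite HT, holds_lt, !ev_mul, !ev_const in H by (cbn [teval]; lia). cbn [teval] in H.
      exists x, z, k1, k2, k3, c. tauto.
    + intros (x & z & k1 & k2 & k3 & c & Hk1 & Hk2 & Hk3 & Hc & H1 & H2 & H3 & H4 & H5).
      pose proof (free_chain_bound _ _ _ _ _ Hs H1) as Hx.
      pose proof (free_chain_bound _ _ _ _ _ Hx H4) as Hz.
      exists x. split; [auto|]. rewrite holds_exb. exists z. split; [auto|].
      rewrite holds_exD. exists k1. split; [auto|].
      rewrite holds_exD. exists k2. split; [auto|].
      rewrite holds_exD. exists k3. split; [auto|].
      rewrite holds_exD. exists c. split; [auto|]. cbn [holds].
      rewrite (holds_weighted _ _ _ _ _ _ _ _ _ _ _ _ HF represents_false)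
        by (rewrite ?ev_const; cbn [teval]; lia).
      rewrite !(holds_free _ _ _ _ _ represents_false) by auto.
      rewrite HT, holds_lt, !ev_mul, !ev_const by (cbn [teval]; lia). auto.
Qed.

Lemma holds_lasso F FP G GP n m s :
  represents F FP -> represents G GP -> ev n <= b -> ev m <= b -> ev s <= b ->
  ok (qLasso _ D b Edge F G n m s) <->
  bad_path edges (weight (ev n) (ev m) FP) GP (ev s).
Proof.
  intros HF HG Hn Hm Hs. bounds. rewrite (bad_path_iff_chains _ D) by auto.
  pose proof B_quadratic as Bq.
  assert (Hsum : forall c k, c <= b -> k <= b ->
    ev (TAdd (TMul m (TVar c)) (TMul n (TVar k))) = ev m * c + ev n * k).
  { intros c k Hc Hk. cbn [teval]. rewrite !Nat.min_r by nia. reflexivity. }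
  assert (H2D : ev (twice _ (TVar D)) = 2 * D) by (cbn [teval twice]; lia).
  unfold qLasso, lasso_chains. rewrite holds_exb. split.
  - intros (x & Hx & H). rewrite holds_exD in H. destruct H as (k1 & Hk1 & H).
    rewrite holds_exD in H. destruct H as (c1 & Hc1 & H).
    rewrite holds_exD in H. destruct H as (k2 & Hk2 & H). cbn [holds] in H.
    rewrite holds_or, holds_exB in H by lia.
    rewrite (holds_weighted _ _ _ _ _ _ _ _ _ _ _ _ HF HG) in H
      by (rewrite ?ev_const; cbn [teval]; lia).
    rewrite (holds_free _ _ _ _ _ HG), !ev_const in H by (cbn [teval]; lia).
    destruct H as (H1 & H2 & H3). cbn [teval] in H1, H2.
    exists x, k1, c1, k2. do 4 (split; [auto|]). split; [exact H2|].
    destruct H3 as [(c2 & Hc2 & H3)|H3]; [left|right; exact H3].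
    rewrite H2D in Hc2. cbn [holds] in H3.
    rewrite (holds_weighted _ _ _ _ _ _ _ _ _ _ _ _ HF HG) in H3
      by (cbn [teval]; lia).
    rewrite Hsum, ev_mul in H3 by (cbn [teval]; lia). cbn [teval] in H3.
    exists c2. tauto.
  - intros (x & k1 & c1 & k2 & Hk1 & Hc1 & Hk2 & H1 & H2 & H3).
    pose proof (weighted_chain_bound _ _ _ _ _ _ _ _ _ _ Hs H2) as Hx.
    exists x. split; [auto|]. rewrite holds_exD. exists k1. split; [auto|].
    rewrite holds_exD. exists c1. split; [auto|].
    rewrite holds_exD. exists k2. split; [auto|]. cbn [holds].
    rewrite holds_or, holds_exB by lia.
    rewrite (holds_weighted _ _ _ _ _ _ _ _ _ _ _ _ HF HG)
      by (rewrite ?ev_const; cbn [teval]; lia).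
    rewrite (holds_free _ _ _ _ _ HG), !ev_const by (cbn [teval]; lia).
    split; [auto|]. split; [exact H2|].
    destruct H3 as [(c2 & Hc2 & H3 & H4)|H3]; [left|right; exact H3].
    exists c2. rewrite H2D. split; [auto|]. cbn [holds].
    rewrite (holds_weighted _ _ _ _ _ _ _ _ _ _ _ _ HF HG) by (cbn [teval]; lia).
    rewrite Hsum, ev_mul by (cbn [teval]; lia). auto.
Qed.

End Graph_semantics.

(** * The table of truth values and its local conditions *)

Lemma list_bound q L s t :
  occurs w q (enc_list enc_pair L) -> In (s, t) L -> s < b /\ t < b.
Proof.
  intros H HIn. apply in_split in HIn as (L1 & L2 & ->).
  rewrite enc_list_items in H. unfold enc_items in H.
  rewrite flat_map_app, <- app_assoc, occurs_app in H. destruct H as [_ H].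
  simpl in H. rewrite occurs_cons, <- app_assoc, occurs_app in H.
  destruct H as (_ & H & _). unfold enc_pair in H. rewrite occurs_app in H.
  destruct H as [H1 H2]. apply occurs_nat_lt in H1. apply occurs_nat_lt in H2.
  cbn [fst snd] in *.
  assert (2 ^ length w <= 2 ^ D) by (apply Nat.pow_le_mono_r; lia). lia.
Qed.

Lemma list_length q L : occurs w q (enc_list enc_pair L) -> 2 * length L <= D.
Proof.
  intros H. rewrite enc_list_items in H.
  pose proof (occurs_bound _ _ _ H ltac:(now destruct (enc_items L))) as Hb.
  rewrite length_app in Hb.
  enough (length L <= length (enc_items L)) by lia. clear.
  induction L as [|x L IH]; simpl; [lia|]. rewrite length_app. lia.
Qed.

(** States are shifted by one so that the digit 0 marks an empty slot; row [p] occupies the [D + 1]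
    digits from [p * (D + 1)] on. *)
Definition table (X p s : nat) : Prop :=
  exists j, j <= D /\ digit b X (p * (D + 1) + j) = s + 1.

Lemma holds_table X p s : ev p <= D -> ev s <= b ->
  ok (qTable _ D b X p s) <-> table (ev X) (ev p) (ev s).
Proof.
  intros Hp Hs. bounds. pose proof B_quadratic as Bq. unfold qTable, table.
  rewrite holds_exD.
  assert (E : forall j, j <= D ->
    ev (TAdd (TMul p (plus _ (TVar D) 1)) (TVar j)) = ev p * (D + 1) + j).
  { intros j Hj. cbn [teval plus]. rewrite !Nat.min_r by nia. reflexivity. }
  split; intros (j & Hj & H); exists j; (split; [auto|]).
  - rewrite holds_eq, ev_plus in H by lia. cbn [teval] in H, E. rewrite E in H by auto.
    exact H.
  - rewrite holds_eq, ev_plus by lia. cbn [teval] in *. rewrite E by auto. exact H.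
Qed.

Lemma occurs_inj p u v : occurs w p u -> occurs w p v -> length u = length v -> u = v.
Proof.
  intros [x E1] [y E2] Hl. rewrite E1 in E2. apply (f_equal (firstn (length u))) in E2.
  rewrite !firstn_app, firstn_all, Nat.sub_diag in E2.
  rewrite Hl, firstn_all, Nat.sub_diag in E2.
  simpl in E2. now rewrite !app_nil_r in E2.
Qed.

Section Model.
Variables (K : KS) (q_edges q_labels : term nat).
Hypothesis edges_end : ev q_edges <= D.
Hypothesis labels_end : ev q_labels <= D.
Hypothesis occurs_edges : occurs w (ev q_edges) (enc_list enc_pair (ks_edges K)).
Hypothesis occurs_labels : occurs w (ev q_labels) (enc_list enc_pair (ks_labels K)).

Let E := qMem _ D b q_edges.
Let L := qMem _ D b q_labels.

Lemma holds_E u v : ev u <= b -> ev v <= b ->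
  (ok (E u v) <-> edge (ks_edges K) (ev u) (ev v)).
Proof. intros. now apply holds_mem. Qed.

Lemma E_bound u v : edge (ks_edges K) u v -> u < b /\ v < b.
Proof. eapply list_bound; eauto. Qed.

Lemma E_length : 2 * length (ks_edges K) <= D.
Proof. eapply list_length; eauto. Qed.

Definition source (s : nat) : Prop := exists t, edge (ks_edges K) s t.

Definition correct_at (X p : nat) (f : form) : Prop :=
  forall s, source s -> (table X p s <-> ssat K f s).

Lemma source_bound s : source s -> s <= b.
Proof. intros [t H]. apply E_bound in H. lia. Qed.

Lemma represents_table X p f :
  ev p <= D -> correct_at (ev X) (ev p) f ->
  represents (ks_edges K) (qTable _ D b X p) (ssat K f).
Proof. intros Hp H u Hu Hs. rewrite holds_table by auto. now apply H. Qed.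

Lemma occurs_form_end p f : occurs w p (enc_form f) -> p + length (enc_form f) <= length w.
Proof. intros H. apply (occurs_bound _ _ _ H). now destruct f. Qed.

Lemma holds_child_form p q g : ev p <= D -> occurs w (ev p) (enc_form g) ->
  ok (qForm _ D b p q) <-> ev q = ev p + length (enc_form g).
Proof.
  intros Hp H. rewrite holds_form by auto. split; [|eauto].
  intros (f & H1 & H2). now rewrite (occurs_form_inj _ _ _ _ H H1).
Qed.

(** The induction hypothesis for the rule of [f], stated for all formulas with a shorter encoding,
    wherever they occur. *)
Definition children_correct (X : nat) (f : form) : Prop :=
  forall g p, length (enc_form g) < length (enc_form f) -> occurs w p (enc_form g) ->
  correct_at X p g.

Lemma live_target s t : ev s <= b -> ev t <= b ->
  ok (LAnd (E s t) (qLive _ D b E t)) <->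
  edge (ks_edges K) (ev s) (ev t) /\ live (ks_edges K) (ev t).
Proof.
  intros Hs Ht. cbn [holds].
  rewrite holds_E, (holds_live E (ks_edges K)); auto using holds_E, E_bound, E_length.
  reflexivity.
Qed.

Lemma holds_target s (T : term nat -> formula nat) (P : nat -> Prop) :
  ev s <= b -> (forall t, ev t <= b -> live (ks_edges K) (ev t) -> (ok (T t) <-> P (ev t))) ->
  ok (exb _ b (fun t => LAnd (E s t) (LAnd (qLive _ D b E t) (T t)))) <->
  exists t, edge (ks_edges K) (ev s) t /\ live (ks_edges K) t /\ P t.
Proof.
  intros Hs HT. rewrite holds_exb. split.
  - intros (t & Ht & H1 & H2 & H3).
    pose proof (live_target s (TVar t) Hs Ht) as Hl. cbn [holds teval] in Hl.
    destruct (proj1 Hl (conj H1 H2)) as [A1 A2]. exists t.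
    split; [auto|]. split; [auto|]. now apply (HT (TVar t)).
  - intros (t & A1 & A2 & A3). pose proof (E_bound _ _ A1) as Hb.
    assert (Ht : ev (TVar t) <= b) by (cbn [teval]; lia).
    pose proof (live_target s (TVar t) Hs Ht) as Hl. cbn [holds teval] in Hl.
    destruct (proj2 Hl (conj A1 A2)) as [H1 H2].
    exists t. split; [exact Ht|]. cbn [holds]. split; [auto|]. split; [auto|].
    now apply (HT (TVar t)).
Qed.

Lemma holds_tag_iff p u b0 b1 b2 :
  ev p <= D -> occurs w (ev p) u -> length u = 3 ->
  ok (qTag _ p b0 b1 b2) <-> u = [b0; b1; b2].
Proof.
  intros Hp H Hl. rewrite holds_tag by auto. split.
  - intros H'. now apply (occurs_inj (ev p)).
  - now intros <-.
Qed.

(** The parsing shared by both quantified forms of until: unique readability forces the guessed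
    numbers and positions to be the intended ones, and the tag then selects [T1] or [T2]. *)
Lemma holds_until p e n m f g (T1 T2 : term nat -> term nat -> term nat -> term nat -> formula nat)
  (P1 P2 : Prop) :
  occurs w (ev p) (path_tag e ++ enc_pform (PU n m f g)) ->
  (forall tn tm c q, ev tn = n -> ev tm = m ->
    ev c <= D -> ev q <= D -> occurs w (ev c) (enc_form f) -> occurs w (ev q) (enc_form g) ->
    (ok (T1 tn tm c q) <-> P1) /\ (ok (T2 tn tm c q) <-> P2)) ->
  ok (exb _ b (fun n => exb _ b (fun m => exD _ D (fun c1 => exD _ D (fun c2 => exD _ D (fun q =>
       LAnd (LAnd (qNat _ D b (plus _ p 4) c1 n) (LAnd (qNat _ D b c1 c2 m) (qForm _ D b c2 q)))
       (LOr _ (LAnd (qTag _ p false true true) (T1 n m c2 q))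
              (LAnd (qTag _ p true false false) (T2 n m c2 q)))))))))
  <-> if e then P1 else P2.
Proof.
  intros H HT. bounds. cbn [enc_pform] in H.
  rewrite !occurs_app, path_tag_length in H.
  destruct H as (Ht & H3 & Hn & Hm & Hf & Hg). cbn [length] in *.
  pose proof (occurs_nat_le _ _ Hn) as Bn. pose proof (occurs_nat_le _ _ Hm) as Bm.
  pose proof (occurs_form_end _ _ Hf) as Ef. pose proof (occurs_form_end _ _ Hg) as Eg.
  set (c1 := ev p + 3 + 1 + length (enc_nat n)) in *.
  set (c2 := c1 + length (enc_nat m)) in *. set (q := c2 + length (enc_form f)) in *.
  assert (Hc : ev p + 4 <= c1 /\ c1 <= c2 /\ c2 <= q) by (unfold q, c2, c1; lia).
  assert (Hp : ev p <= D) by lia.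
  assert (HT' : forall tn tm c q', ev tn = n -> ev tm = m -> ev c = c2 -> ev q' = q ->
    ok (LOr _ (LAnd (qTag _ p false true true) (T1 tn tm c q'))
              (LAnd (qTag _ p true false false) (T2 tn tm c q'))) <-> if e then P1 else P2).
  { intros tn tm c q' E1 E2 E3 E4. rewrite holds_or. cbn [holds].
    rewrite !(holds_tag_iff p (path_tag e)) by auto using path_tag_length.
    destruct (HT tn tm c q') as [-> ->]; auto; try lia;
      [now rewrite E3|now rewrite E4|].
    destruct e; cbn [path_tag]; split; try tauto; intros [[? ?]|[? ?]]; auto; discriminate. }
  rewrite holds_exb. split.
  - intros (n' & Hn' & H). rewrite holds_exb in H. destruct H as (m' & Hm' & H).
    rewrite holds_exD in H. destruct H as (c1' & Hc1 & H).
    rewrite holds_exD in H. destruct H as (c2' & Hc2 & H).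
    rewrite holds_exD in H. destruct H as (q' & Hq & ((A1 & A2 & A3) & A4)).
    rewrite holds_nat in A1, A2 by (rewrite ?ev_plus; cbn [teval]; lia).
    rewrite ev_plus in A1 by lia. cbn [teval] in A1, A2.
    destruct A1 as [A1 A1'], A2 as [A2 A2'].
    replace (ev p + 4) with (ev p + 3 + 1) in A1, A1' by lia.
    rewrite (occurs_nat_inj _ _ _ _ A1 Hn) in *. subst c1'. fold c1 in A2, A2'.
    rewrite (occurs_nat_inj _ _ _ _ A2 Hm) in *. subst c2'. fold c2 in A3, A4.
    rewrite (holds_child_form _ _ f) in A3 by (cbn [teval]; auto; lia). cbn [teval] in A3.
    apply HT' in A4; auto.
  - intros HP. exists n. split; [auto|]. rewrite holds_exb. exists m. split; [auto|].
    rewrite holds_exD. exists c1. split; [lia|]. rewrite holds_exD. exists c2.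
    split; [lia|]. rewrite holds_exD. exists q. split; [lia|].
    split; [split; [|split]|].
    + rewrite holds_nat by (rewrite ?ev_plus; cbn [teval]; lia).
      rewrite ev_plus by lia. cbn [teval].
      replace (ev p + 4) with (ev p + 3 + 1) by lia. auto.
    + rewrite holds_nat by (cbn [teval]; lia). cbn [teval]. auto.
    + rewrite (holds_child_form _ _ f) by (cbn [teval]; auto; lia). reflexivity.
    + apply HT'; auto.
Qed.

Definition quantified (e : bool) (g : pform) : form := if e then FE g else FA g.

Lemma enc_quantified e g : enc_form (quantified e g) = path_tag e ++ enc_pform g.
Proof. now destruct e. Qed.

Lemma holds_rule_path X p s e g :
  occurs w (ev p) (enc_form (quantified e g)) -> children_correct (ev X) (quantified e g) ->
  source (ev s) ->
  ok (qRule _ D b E L X p s) <-> ssat K (quantified e g) (ev s).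
Proof.
  intros H HC Hs. bounds. pose proof (occurs_form_end _ _ H) as He.
  pose proof (source_bound _ Hs) as Hsb.
  pose proof H as H'. rewrite enc_quantified in H, He.
  rewrite length_app, path_tag_length in He.
  assert (Hg : 1 <= length (enc_pform g)) by (destruct g; simpl; lia).
  pose proof H as Hp. rewrite occurs_app, path_tag_length in Hp. destruct Hp as [Ht Hr].
  (* Once the tag and the bit after it are known, all disjuncts of [qRule] but one are
     contradictory. *)
  assert (Tag : forall b0 b1 b2, ok (qTag _ p b0 b1 b2) <-> path_tag e = [b0; b1; b2]).
  { intros. apply holds_tag_iff; auto using path_tag_length; lia. }
  assert (Path : ok (qPath _ p)) by (apply holds_path; [lia|eauto]).
  unfold qRule. rewrite !holds_or. cbn [holds]. rewrite !Tag, ev_plus by lia.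
  destruct g as [f|n m f g].
  - cbn [enc_pform] in Hr. rewrite occurs_app, occurs_single in Hr. destruct Hr as [Hb Hf].
    cbn [length] in Hf. replace (ev p + 3 + 1) with (ev p + 4) in Hf by lia.
    pose proof (occurs_form_end _ _ Hf) as Ef.
    assert (C1 : correct_at (ev X) (ev p + 4) f).
    { apply HC; [|auto]. rewrite enc_quantified, length_app, path_tag_length.
      cbn [enc_pform]. rewrite length_app. simpl. lia. }
    rewrite Hb.
    assert (Tab : forall t, ev t <= b -> live (ks_edges K) (ev t) ->
      (ok (qTable _ D b X (plus _ p 4) t) <-> ssat K f (ev t))).
    { intros t Hbt Hl. rewrite holds_table by (rewrite ?ev_plus; lia).
      rewrite ev_plus by lia. apply C1, live_source, Hl. }
    pose proof (holds_target s _ (ssat K f) Hsb Tab) as HE.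
    pose proof (holds_target s (fun t => LNot (qTable _ D b X (plus _ p 4) t))
      (fun t => ~ ssat K f t) Hsb
      (fun t H1 H2 => not_iff_compat (Tab t H1 H2))) as HA.
    destruct e; cbn [quantified path_tag].
    + rewrite ssat_EX, <- HE. split; [|do 3 right; left; auto].
      intros [[Et _]|[[Et _]|[[Et _]|[(_ & _ & Hx)|[[Et _]|(_ & Hx & _)]]]]];
        try discriminate; auto.
    + rewrite ssat_AX, <- HA. split; [|do 4 right; left; auto].
      intros [[Et _]|[[Et _]|[[Et _]|[[Et _]|[(_ & _ & Hx)|(_ & Hx & _)]]]]];
        try discriminate; auto.
  - pose proof Hr as Hb. cbn [enc_pform] in Hb. rewrite occurs_app, occurs_single in Hb.
    destruct Hb as [Hb _]. rewrite Hb.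
    set (body := exb nat b (fun _ => exb nat b _)).
    enough (Hbody : ok body <-> if e then ssat K (FE (PU n m f g)) (ev s)
                               else ssat K (FA (PU n m f g)) (ev s)).
    { destruct e; cbn [quantified path_tag]; rewrite <- Hbody; (split; [|do 5 right; auto]);
        intros [[Et _]|[[Et _]|[[Et _]|[(Et & Ex & _)|[(Et & Ex & _)|(_ & _ & Hx)]]]]];
        try discriminate; auto. }
    unfold body. clear body.
    apply (holds_until p e n m f g
      (fun tn tm c q => LOr _ (LAnd (qLive _ D b E s) (qTable _ D b X q s))
         (qGoodWalk _ D b E (qTable _ D b X c)
            (fun z => LAnd (qTable _ D b X q z) (qLive _ D b E z)) tn tm s))
      (fun tn tm c q => LNot (qLasso _ D b E (qTable _ D b X c) (qTable _ D b X q) tn tm s)));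
      [exact H|].
    intros tn tm c q En Em Hc Hq Of Og.
    assert (Lf : length (enc_form f) + length (enc_form g) <= length (enc_pform (PU n m f g))).
    { cbn [enc_pform]. rewrite !length_app. lia. }
    assert (Cf : correct_at (ev X) (ev c) f).
    { apply HC; [|auto]. rewrite enc_quantified, length_app, path_tag_length. lia. }
    assert (Cg : correct_at (ev X) (ev q) g).
    { apply HC; [|auto]. rewrite enc_quantified, length_app, path_tag_length. lia. }
    assert (Bn : ev tn <= b /\ ev tm <= b).
    { cbn [enc_pform] in Hr. rewrite !occurs_app in Hr. destruct Hr as (_ & On & Om & _).
      rewrite En, Em. eauto using occurs_nat_le. }
    assert (Live : forall z, ev z <= b -> (ok (qLive _ D b E z) <-> live (ks_edges K) (ev z))).
    { intros z Hz. apply holds_live; auto using holds_E, E_bound, E_length. }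
    (* The row of [g] is known to be right only at sources; liveness of [z] provides the outgoing
       edge. *)
    assert (Tg : forall z, ev z <= b -> live (ks_edges K) (ev z) ->
      (ok (qTable _ D b X q z) <-> ssat K g (ev z))).
    { intros z Hz Hl. rewrite holds_table by auto. apply Cg, live_source, Hl. }
    split.
    + rewrite ssat_EU, holds_or. cbn [holds]. rewrite Live by auto.
      rewrite (holds_good_walk E (ks_edges K)) with (FP := ssat K f)
        (TP := fun z => ssat K g z /\ live (ks_edges K) z);
        auto using holds_E, E_bound, E_length, represents_table; try tauto.
      * rewrite En, Em. specialize (Tg s Hsb). tauto.
      * intros z Hz. cbn [holds]. rewrite Live by auto. specialize (Tg z Hz). tauto.
    + rewrite ssat_AU. cbn [holds].
      rewrite (holds_lasso E (ks_edges K)) with (FP := ssat K f) (GP := ssat K g);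
        auto using holds_E, E_bound, E_length, represents_table; try tauto.
      now rewrite En, Em.
Qed.

Lemma holds_rule X p s f :
  occurs w (ev p) (enc_form f) -> children_correct (ev X) f -> source (ev s) ->
  ok (qRule _ D b E L X p s) <-> ssat K f (ev s).
Proof.
  intros H HC Hs.
  destruct (classic (exists e g, f = quantified e g)) as [(e & g & ->)|Hnq].
  { now apply holds_rule_path. }
  bounds. pose proof (occurs_form_end _ _ H) as He.
  pose proof (source_bound _ Hs) as Hsb.
  assert (Hlen : 3 <= length (enc_form f)) by (destruct f; simpl; lia).
  assert (Hp : ev p + 3 <= length w) by lia.
  unfold qRule. rewrite !holds_or. cbn [holds]. rewrite holds_path by lia.
  assert (Htag : forall u v, enc_form f = u ++ v -> length u = 3 ->
    (forall b0 b1 b2, ok (qTag _ p b0 b1 b2) <-> u = [b0; b1; b2]) /\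
    (forall e, occurs w (ev p) (path_tag e) <-> u = path_tag e) /\
    occurs w (ev p + 3) v).
  { intros u v Ef Hl. rewrite Ef, occurs_app, Hl in H. destruct H as [H1 H2].
    split; [intros; apply holds_tag_iff; auto; lia|]. split; [|exact H2].
    intros e. split; [|now intros <-]. intros H3. apply (occurs_inj (ev p)); auto.
    now rewrite path_tag_length. }
  destruct f as [x|f g|f|g|g].
  - destruct (Htag [false; false; false] (enc_nat x) eq_refl eq_refl) as (T1 & T2 & O).
    rewrite !T1. cbn [ssat]. split.
    + intros [[_ Hx]|[[Et _]|[[Et _]|[[Et _]|[[Et _]|[[e Et] _]]]]]];
        try discriminate; [|apply T2 in Et; destruct e; discriminate].
      rewrite holds_exD in Hx. destruct Hx as (q & Hq & Hx).
      rewrite holds_exb in Hx. destruct Hx as (y & Hy & Hx & HLab).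
      rewrite holds_nat in Hx by (rewrite ?ev_plus; cbn [teval]; lia).
      rewrite ev_plus in Hx by lia. cbn [teval] in Hx. destruct Hx as [Hx _].
      rewrite (occurs_nat_inj _ _ _ _ Hx O) in *.
      apply (holds_mem _ _ _ (ks_labels K)) in HLab; auto.
    + intros HIn. left. split; [reflexivity|].
      pose proof (occurs_nat_le _ _ O) as Bx. pose proof (occurs_nat_end _ _ O).
      rewrite holds_exD. exists (ev p + 3 + length (enc_nat x)). split; [lia|].
      rewrite holds_exb. exists x. split; [auto|]. cbn [holds].
      rewrite holds_nat by (rewrite ?ev_plus; cbn [teval]; lia).
      rewrite ev_plus by lia. cbn [teval]. split; [auto|].
      apply (holds_mem _ _ _ (ks_labels K)); auto.
  - destruct (Htag [false; false; true] (enc_form f ++ enc_form g) eq_refl eq_refl)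
      as (T1 & T2 & O).
    rewrite occurs_app in O. destruct O as [O1 O2].
    pose proof (occurs_form_end _ _ O1) as e1. pose proof (occurs_form_end _ _ O2) as e2.
    assert (C1 : correct_at (ev X) (ev p + 3) f).
    { apply HC; [|auto]. cbn [enc_form]. rewrite !length_app. simpl. lia. }
    assert (C2 : correct_at (ev X) (ev p + 3 + length (enc_form f)) g).
    { apply HC; [|auto]. cbn [enc_form]. rewrite !length_app. simpl. lia. }
    rewrite !T1. cbn [ssat]. split.
    + intros [[Et _]|[[_ Hx]|[[Et _]|[[Et _]|[[Et _]|[[e Et] _]]]]]];
        try discriminate; [|apply T2 in Et; destruct e; discriminate].
      rewrite holds_exD in Hx. destruct Hx as (q & Hq & Hx & H1 & H2).
      rewrite (holds_child_form _ _ f) in Hx by (rewrite ev_plus by lia; auto; lia).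
      rewrite ev_plus in Hx by lia. cbn [teval] in Hx. subst q.
      rewrite holds_table in H1, H2 by (rewrite ?ev_plus; cbn [teval]; lia).
      rewrite ev_plus in H1 by lia. cbn [teval] in H2. now rewrite <- (C1 _ Hs), <- (C2 _ Hs).
    + intros [H1 H2]. right; left. split; [reflexivity|].
      rewrite holds_exD. exists (ev p + 3 + length (enc_form f)). split; [lia|].
      cbn [holds]. rewrite (holds_child_form _ _ f) by (rewrite ev_plus by lia; auto; lia).
      rewrite !holds_table by (rewrite ?ev_plus; cbn [teval]; lia).
      rewrite ev_plus by lia. cbn [teval]. rewrite (C1 _ Hs), (C2 _ Hs). auto.
  - destruct (Htag [false; true; false] (enc_form f) eq_refl eq_refl) as (T1 & T2 & O).
    pose proof (occurs_form_end _ _ O).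
    assert (C1 : correct_at (ev X) (ev p + 3) f).
    { apply HC; [|auto]. cbn [enc_form]. rewrite !length_app. simpl. lia. }
    rewrite !T1. rewrite (holds_table _ (plus _ p 3)) by (rewrite ?ev_plus; lia).
    rewrite (ev_plus p 3), (C1 _ Hs) by lia. cbn [ssat]. split.
    + intros [[Et _]|[[Et _]|[[_ Hx]|[[Et _]|[[Et _]|[[e Et] _]]]]]];
        try discriminate; [|apply T2 in Et; destruct e; discriminate].
      exact Hx.
    + intros Hx. right; right; left. auto.
  - destruct Hnq. now exists true, g.
  - destruct Hnq. now exists false, g.
Qed.

Lemma holds_correct X :
  ok (qCorrect _ D b E L X) <->
  forall p f s, occurs w p (enc_form f) -> source s ->
    (table (ev X) p s <-> ok (qRule _ D b E L X (TVar p) (TVar s))).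
Proof.
  bounds. assert (HD : ev (TVar D) <= B) by (cbn [teval]; lia).
  assert (Hb : ev (TVar b) <= B) by (cbn [teval]; lia).
  unfold qCorrect. rewrite holds_allB by auto. cbn [teval]. split.
  - intros H p f s Hocc Hs. pose proof (occurs_form_end _ _ Hocc) as He.
    assert (Hl : 1 <= length (enc_form f)) by (destruct f; simpl; lia).
    pose proof (source_bound _ Hs) as Hsb.
    specialize (H p ltac:(lia)). rewrite holds_allB in H by auto. cbn [teval] in H.
    specialize (H (p + length (enc_form f)) ltac:(lia)).
    rewrite holds_imp, (holds_child_form _ _ f) in H by (cbn [teval]; auto; lia).
    cbn [teval] in H. specialize (H eq_refl). rewrite holds_allB in H by auto.
    cbn [teval] in H. specialize (H s Hsb).
    rewrite holds_imp, holds_iff, holds_table, holds_exb in H by (cbn [teval]; lia).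
    cbn [teval] in H. apply H. destruct Hs as [t Ht]. pose proof (E_bound _ _ Ht).
    exists t. split; [lia|]. now apply holds_E; cbn [teval]; [lia..|].
  - intros H p Hp. rewrite holds_allB by auto. cbn [teval]. intros q Hq.
    rewrite holds_imp, holds_form by auto. cbn [teval]. intros (f & Hocc & _).
    rewrite holds_allB by auto. cbn [teval]. intros s Hsb.
    rewrite holds_imp, holds_iff, holds_table, holds_exb by (cbn [teval]; lia).
    cbn [teval]. intros (t & Ht & He). apply (H p f s); auto.
    exists t. now apply holds_E in He; cbn [teval] in *; [|lia..].
Qed.

(** The rule at a position consults only rows of formulas with strictly shorter encodings, so the
    local conditions leave no choice for the entries at sources. *)
Lemma correct_unique X :
  ok (qCorrect _ D b E L X) ->
  forall f p, occurs w p (enc_form f) -> correct_at (ev X) p f.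
Proof.
  rewrite holds_correct. intros H f. remember (length (enc_form f)) as l eqn:El.
  revert f El. induction l as [l IH] using lt_wf_ind. intros f -> p Hocc s Hs.
  rewrite (H p f s Hocc Hs).
  apply (holds_rule X (TVar p) (TVar s) f); auto.
  intros g p' Hlt Hg. now apply (IH _ Hlt g eq_refl).
Qed.

(** The true table satisfies the local conditions. It consists of [D + 1] rows of [D + 1] digits,
    and this is the reason why [B] must reach [S b ^ ((D + 1) * (D + 1))]. *)
Lemma correct_exists : exists X, X <= B /\ ok (qCorrect _ D b E L (TVar X)).
Proof.
  pose proof E_length as HE.
  set (holds_at := fun p s => exists f, occurs w p (enc_form f) /\ ssat K f s).
  (* Slot [j] of row [p] is reserved for the source of the [j]-th edge, and stays empty unless the
     formula read at [p] holds there. *)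
  set (g := fun i => match nth_error (map fst (ks_edges K)) (i mod (D + 1)) with
    | Some s => if decide (holds_at (i / (D + 1)) s) then s + 1 else 0
    | None => 0
    end).
  assert (Hin : forall s, In s (map fst (ks_edges K)) <-> source s).
  { intros s. rewrite in_map_iff. split.
    - intros ([u v] & <- & Huv). now exists v.
    - intros [t Ht]. now exists (s, t). }
  destruct (digits_exist b g ((D + 1) * (D + 1))) as (X & HX & HdX).
  { intros i _. unfold g. destruct (nth_error _ _) as [s|] eqn:Es; [|lia].
    destruct (decide _); [|lia]. apply nth_error_In, Hin in Es as [t Ht].
    apply E_bound in Ht. lia. }
  exists X. split; [lia|].
  assert (HT : forall p s, p <= D -> source s -> (table X p s <-> holds_at p s)).
  { intros p s Hp Hs. unfold table.
    assert (Hg : forall j, j <= D -> digit b X (p * (D + 1) + j) =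
      match nth_error (map fst (ks_edges K)) j with
      | Some s => if decide (holds_at p s) then s + 1 else 0
      | None => 0
      end).
    { intros j Hj. rewrite HdX by nia. unfold g.
      rewrite <- (Nat.mod_unique (p * (D + 1) + j) (D + 1) p j) by lia.
      rewrite <- (Nat.div_unique (p * (D + 1) + j) (D + 1) p j) by lia. reflexivity. }
    split.
    - intros (j & Hj & Hd). rewrite Hg in Hd by auto.
      destruct (nth_error _ j) as [s'|]; [|lia].
      destruct (decide (holds_at p s')) eqn:Ed; [|lia]. apply (proj1 (decide_iff _)) in Ed.
      replace s with s' by lia. exact Ed.
    - intros Hh. apply Hin, In_nth_error in Hs as [j Hj].
      assert (j < length (map fst (ks_edges K))) by (apply nth_error_Some; congruence).
      rewrite length_map in *. exists j. split; [lia|].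
      rewrite Hg, Hj by lia. now rewrite decide_true. }
  apply holds_correct. cbn [teval].
  assert (Hcor : forall p f, occurs w p (enc_form f) -> correct_at X p f).
  { intros p f Hocc s Hs. pose proof (occurs_form_end _ _ Hocc).
    rewrite HT by (auto; lia). split.
    - intros (f' & Hf' & Hsat). now rewrite (occurs_form_inj _ _ _ _ Hocc Hf').
    - intros Hsat. now exists f. }
  intros p f s Hocc Hs. rewrite (Hcor p f Hocc s Hs). symmetry.
  apply (holds_rule (TVar X) (TVar p) (TVar s) f); auto.
  intros f' p' _ Hf'. now apply Hcor.
Qed.

End Model.

Lemma holds_models K f :
  w = enc_ks K ++ enc_form f -> ok (qModels _ D b) <-> models K f.
Proof.
  intros Ew. bounds. unfold enc_ks in Ew.
  assert (Ow : occurs w 0 (((enc_nat (ks_n K) ++ enc_nat (ks_init K) ++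
    enc_list enc_pair (ks_edges K) ++ enc_list enc_pair (ks_labels K)) ++ enc_form f))).
  { exists []. now rewrite app_nil_r. }
  rewrite <- !app_assoc, !occurs_app in Ow. destruct Ow as (O1 & O2 & O3 & O4 & O5).
  cbn [Nat.add] in *.
  set (p1 := length (enc_nat (ks_n K))) in *.
  set (p2 := p1 + length (enc_nat (ks_init K))) in *.
  set (p3 := p2 + length (enc_list enc_pair (ks_edges K))) in *.
  set (p4 := p3 + length (enc_list enc_pair (ks_labels K))) in *.
  assert (Hp4 : p4 + length (enc_form f) <= length w).
  { apply (occurs_bound _ _ _ O5). now destruct f. }
  assert (Hle : p1 <= p2 /\ p2 <= p3 /\ p3 <= p4) by (unfold p4, p3, p2; lia).
  pose proof (occurs_nat_le _ _ O1) as B1. pose proof (occurs_nat_le _ _ O2) as B2.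
  assert (EB : forall u v, edge (ks_edges K) u v -> u < b /\ v < b)
    by (intros u v; eapply list_bound; eauto).
  pose proof (list_length _ _ O3) as EL.
  assert (Live : forall s, s <= b ->
    (ok (qLive _ D b (qMem _ D b (TVar p2)) (TVar s)) <-> live (ks_edges K) s)).
  { intros s Hs. apply holds_live; auto. intros. apply holds_E; cbn [teval]; auto; lia. }
  rewrite models_iff. unfold qModels. rewrite holds_exD. split.
  - intros (q1 & Hq1 & H). rewrite holds_exD in H. destruct H as (q2 & Hq2 & H).
    rewrite holds_exD in H. destruct H as (q3 & Hq3 & H).
    rewrite holds_exD in H. destruct H as (q4 & Hq4 & H).
    rewrite holds_exb in H. destruct H as (x & Hx & H).
    rewrite holds_exb in H. destruct H as (s & Hs & H). cbn [holds] in H.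
    destruct H as ((A1 & A2 & A3 & A4) & A5 & X & HX & A6 & A7).
    rewrite holds_nat in A1, A2 by (rewrite ?ev_const; cbn [teval]; lia).
    rewrite ev_const in A1 by lia. cbn [teval Nat.add] in A1, A2.
    destruct A1 as [A1 A1'], A2 as [A2 A2'].
    rewrite (occurs_nat_inj _ _ _ _ A1 O1) in *. subst q1. fold p1 in A2, A2'.
    rewrite (occurs_nat_inj _ _ _ _ A2 O2) in *. subst q2. fold p2 in A3, A5, A6.
    rewrite (holds_end _ _ (ks_edges K)) in A3 by (cbn [teval]; auto; lia).
    cbn [teval] in A3. subst q3. fold p3 in A4, A6.
    rewrite (holds_end _ _ (ks_labels K)) in A4 by (cbn [teval]; auto; lia).
    cbn [teval] in A4. subst q4. fold p4 in A7.
    apply Live in A5; [|auto]. split; [exact A5|].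
    rewrite holds_table in A7 by (cbn [teval]; lia). cbn [teval] in A7.
    assert (HU : correct_at K X p4 f).
    { apply (correct_unique K (TVar p2) (TVar p3)) with (X := TVar X);
        cbn [teval]; auto; lia. }
    apply HU; [|exact A7]. now apply live_source.
  - intros [Hl Hsat].
    exists p1. split; [lia|]. rewrite holds_exD. exists p2. split; [lia|].
    rewrite holds_exD. exists p3. split; [lia|]. rewrite holds_exD. exists p4. split; [lia|].
    rewrite holds_exb. exists (ks_n K). split; [auto|].
    rewrite holds_exb. exists (ks_init K). split; [auto|].
    cbn [holds]. split; [split; [|split; [|split]]|].
    + rewrite holds_nat by (rewrite ?ev_const; cbn [teval]; lia).
      rewrite ev_const by lia. cbn [teval]. auto.
    + rewrite holds_nat by (cbn [teval]; lia). cbn [teval]. auto.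
    + now rewrite (holds_end _ _ (ks_edges K)) by (cbn [teval]; auto; lia).
    + now rewrite (holds_end _ _ (ks_labels K)) by (cbn [teval]; auto; lia).
    + split.
      { now apply Live. }
      destruct (correct_exists K (TVar p2) (TVar p3)) as (X & HX & HC);
        cbn [teval]; auto; try lia.
      exists X. split; [auto|]. split; [exact HC|].
      rewrite holds_table by (cbn [teval]; lia). cbn [teval].
      assert (HU : correct_at K X p4 f).
      { apply (correct_unique K (TVar p2) (TVar p3)) with (X := TVar X);
          cbn [teval]; auto; lia. }
      apply HU; [|exact Hsat]. now apply live_source.
Qed.

End Semantics.

(** * The bounds are large enough; the decision procedure *)

Lemma iterations_ge N : dim N ^ 8 <= iterations N.
Proof.
  assert (H : forall v, v ^ 2 <= grow v) by (intros v; unfold grow; simpl; lia).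
  unfold iterations. change 8 with (2 * 2 * 2). rewrite !Nat.pow_mul_r.
  etransitivity; [|apply H]. apply Nat.pow_le_mono_l.
  etransitivity; [|apply H]. apply Nat.pow_le_mono_l. apply H.
Qed.

Lemma base_ge N : 2 ^ dim N <= base N.
Proof.
  unfold base. pose proof (dim_le_iterations N). pose proof (dim_ge N). nia.
Qed.

(** Three applications of [grow] make [iterations N] at most [dim N ^ 27], hence at most
    [2 ^ (27 * dim N)]. A further [dim N] in the exponent is the other factor of [base N], and the
    last one absorbs the successor. *)
Lemma base_le N : S (base N) <= 2 ^ (29 * dim N).
Proof.
  pose proof (dim_ge N) as Hd. unfold base. set (d := dim N) in *.
  assert (Hi : iterations N <= d ^ 27).
  { unfold iterations. change 27 with (1 * 3 * 3 * 3). fold d.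
    pose proof (grow_ge d). pose proof (grow_ge (grow d)).
    do 3 (apply grow_pow; [lia|]). now rewrite Nat.pow_1_r. }
  assert (H2 : d ^ 27 <= 2 ^ (27 * d)).
  { rewrite (Nat.mul_comm 27), Nat.pow_mul_r. apply Nat.pow_le_mono_l.
    pose proof (Nat.pow_gt_lin_r 2 d). lia. }
  replace (29 * d) with (d + (27 * d + d)) by lia. rewrite !Nat.pow_add_r.
  assert (H3 : 2 <= 2 ^ d).
  { change 2 with (2 ^ 1) at 1. apply Nat.pow_le_mono_r; lia. }
  assert (H4 : 2 ^ d * iterations N <= 2 ^ d * 2 ^ (27 * d))
    by (apply Nat.mul_le_mono_l; lia).
  pose proof (Nat.pow_nonzero 2 (27 * d) ltac:(lia)).
  set (u := 2 ^ d) in *. set (v := 2 ^ (27 * d)) in *.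
  assert (1 <= u * v) by nia. nia.
Qed.

(** With [d = dim N], the left-hand side is at most 2 to the power [29 * d * (d + 1) ^ 2]. As [d] is
    at least 6, this exponent is below [d ^ 8], which [iterations N] reaches. *)
Lemma bound_ge N : S (base N) ^ ((dim N + 1) * (dim N + 1)) <= bound N.
Proof.
  pose proof (dim_ge N) as Hd. pose proof (iterations_ge N) as Hi.
  transitivity (2 ^ iterations N).
  - etransitivity; [apply Nat.pow_le_mono_l, base_le|].
    rewrite <- Nat.pow_mul_r. apply Nat.pow_le_mono_r; [lia|].
    etransitivity; [|exact Hi]. set (d := dim N) in *. clearbody d.
    assert (H1 : (d + 1) * (d + 1) <= 2 * (d * d)) by nia.
    assert (H2 : 58 <= d * d * d) by nia.
    replace (d ^ 8) with (d * (d * d) * (d * d * d) * (d * d)) by (cbn [Nat.pow]; ring).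
    assert (H3 : 29 * d * ((d + 1) * (d + 1)) <= 58 * (d * (d * d))) by nia.
    assert (H4 : 58 * (d * (d * d)) <= (d * d * d) * (d * (d * d)))
      by (apply Nat.mul_le_mono_r; lia).
    assert (1 <= d * d) by nia.
    set (e := d * (d * d)) in *. set (g := d * d * d) in *.
    assert (g * e <= e * g * (d * d)) by nia. lia.
  - unfold bound. pose proof (base_ge N). pose proof (Nat.pow_nonzero 2 (dim N)).
    nia.
Qed.

Theorem theorem2 :
  exists (M : TM) (c : nat),
    forall (K : KS) (Phi : form),
      ks_wf K -> form_wf Phi ->
      decides_within M (enc_ks K ++ enc_form Phi)
        (2 ^ ((length (enc_ks K ++ enc_form Phi) + 1) ^ c))
        (models K Phi).
Proof.
  destruct (formula_decides qModels (fun V1 V2 x1 x2 y1 y2 => qModels_rel V1 V2 x1 y1 x2 y2)) as (M & c & H).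
  exists M, c. intros K Phi _ _. apply H.
  - rewrite length_app. destruct Phi; simpl; lia.
  - apply holds_models; auto using base_ge, bound_ge.
    set (N := length _). pose proof (dim_ge N). lia.
Qed.
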